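(* Let $X$ be a $G$-Banach space with the $G$-Daugavet property and suppose that $\alpha_G(X)<2$. Then the following hold. (1) If $G$ is a topological group and the action is continuous, then $X$ contains a copy of $\ell_1$. (2) $X$ does not have the Radon-Nikodým property. (3) $B_X$ is not an SCD set.
   Context: Banach spaces are over $\mathbb K=\mathbb R$ or $\mathbb C$; $B_X$, $S_X$ are the closed unit ball and unit sphere. A $G$-Banach space is a Banach space $X$ endowed with an action of a group $G$ by surjective linear isometries; when $G$ is a topological group, the action is continuous if the map $G\times X\to X$, $(g,x)\mapsto gx$, is continuous. $X$ has the $G$-Daugavet property if every rank-one bounded linear operator $T:X\to X$ satisfies $\sup_{g\in G}\|\mathrm{Id}_X+g\circ T\|=1+\|T\|$, where $(g\circ T)(x)=g(Tx)$. The parameter $\alpha_G(X)$ is $\alpha_G(X)=\sup\{\|gx-x\|:g\in G,\ x\in S_X\}$. ''Contains a copy of $\ell_1$'' means it has a closed subspace linearly isomorphic to $\ell_1$. A bounded convex set $A$ is slicely countably determined (an SCD set) if there is a countable family $\{S_n:n\in\mathbb N\}$ of slices of $A$ (nonempty sets $\{x\in A:\mathrm{Re}\,x^*(x)>a\}$ with $x^*\in X^*$, $a\in\mathbb R$) such that $A\subseteq\overline{\mathrm{co}}(B)$ for every $B\subseteq A$ intersecting all the $S_n$. *)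

(* Defs.v *)
From HB Require Import structures.
From mathcomp Require Import all_boot all_order all_algebra.
From mathcomp Require Import complex.
From mathcomp Require Import all_classical all_reals all_analysis.

Set Implicit Arguments.
Unset Strict Implicit.
Unset Printing Implicit Defensive.

Import Order.TTheory GRing.Theory Num.Theory.
Import numFieldNormedType.Exports.

Local Open Scope classical_set_scope.
Local Open Scope ring_scope.

(** ** Scalars: the real numbers or the complex numbers *)

Variant scalar_kind := RealScalars | ComplexScalars.

Definition scalars (R : realType) (k : scalar_kind) : numFieldType :=
  match k with
  | RealScalars => R
  | ComplexScalars => R[i]%C
  end.

Definition real_part (R : realType) (k : scalar_kind) : scalars R k -> R :=
  match k with
  | RealScalars => fun z : R => z
  | ComplexScalars => fun z : R[i]%C => complex.Re z
  end.

Definition of_real (R : realType) (k : scalar_kind) : R -> scalars R k :=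
  match k with
  | RealScalars => fun t : R => t
  | ComplexScalars => fun t : R => (t%:C)%C
  end.

(** The norm of a normed module over [K] is [K]-valued in the library; it is a
    nonnegative real element of [K], and [rnorm] is its value in [R]. *)
Definition rnorm (R : realType) (k : scalar_kind)
    (X : normedModType (scalars R k)) (x : X) : R :=
  real_part `|x|.

Definition unit_ball (R : realType) (k : scalar_kind)
    (X : normedModType (scalars R k)) : set X :=
  [set x | rnorm x <= 1].

Definition unit_sphere (R : realType) (k : scalar_kind)
    (X : normedModType (scalars R k)) : set X :=
  [set x | rnorm x = 1].

Arguments unit_ball {R k} X.
Arguments unit_sphere {R k} X.

(** Operator norm; meaningful for bounded linear [f]. *)
Definition opnorm (R : realType) (k : scalar_kind)
    (X Y : normedModType (scalars R k)) (f : X -> Y) : R :=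
  sup [set rnorm (f x) | x in unit_ball X].

Definition rank_one (R : realType) (k : scalar_kind)
    (X Y : normedModType (scalars R k)) (f : X -> Y) : Prop :=
  exists2 y : Y, y != 0 & range f = range (fun c : scalars R k => c *: y).

(** ** Group actions by surjective linear isometries *)

Record isometric_action (R : realType) (k : scalar_kind) (G : groupType)
    (X : normedModType (scalars R k)) := IsometricAction {
  iso_act :> G -> X -> X ;
  iso_act_linear : forall g : G, linear (iso_act g) ;
  iso_act_norm : forall (g : G) (x : X), `|iso_act g x| = `|x| ;
  iso_act_surj : forall (g : G) (y : X), exists x : X, iso_act g x = y ;
  iso_act1 : forall x : X, iso_act 1%g x = x ;
  iso_actM : forall (g h : G) (x : X),
    iso_act (g * h)%g x = iso_act g (iso_act h x)
}.

Definition G_Daugavet (R : realType) (k : scalar_kind) (G : groupType)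
    (X : normedModType (scalars R k)) (a : isometric_action G X) : Prop :=
  forall T : {linear X -> X},
    bounded_near T (nbhs (0 : X)) -> rank_one T ->
    sup [set opnorm (fun x => x + a g (T x)) | g in [set: G]] = 1 + opnorm T.

Definition alpha (R : realType) (k : scalar_kind) (G : groupType)
    (X : normedModType (scalars R k)) (a : isometric_action G X) : R :=
  sup [set r | exists g : G,
               exists2 x : X, unit_sphere X x & r = rnorm (a g x - x)].

(** ** Group topologies *)

Record topology_on (T : Type) := TopologyOn {
  tau_open : set_system T ;
  tau_openT : tau_open setT ;
  tau_openI : setI_closed tau_open ;
  tau_open_bigU : forall (I : Type) (f : I -> set T),
    (forall i, tau_open (f i)) -> tau_open (\bigcup_i f i)
}.

Definition with_topology (T : choiceType) (tau : topology_on T) : Type := T.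

HB.instance Definition _ (T : choiceType) (tau : topology_on T) :=
  Choice.copy (with_topology tau) T.

HB.instance Definition _ (T : choiceType) (tau : topology_on T) :=
  isOpenTopological.Build (with_topology tau)
    (@tau_openT T tau) (@tau_openI T tau) (@tau_open_bigU T tau).

Definition is_group_topology (G : groupType) (tau : topology_on G) : Prop :=
  continuous (fun p : with_topology tau * with_topology tau =>
                ((p.1 : G) * (p.2 : G))%g : with_topology tau) /\
  continuous (fun g : with_topology tau =>
                ((g : G)^-1)%g : with_topology tau).

Definition continuous_action (R : realType) (k : scalar_kind) (G : groupType)
    (X : normedModType (scalars R k)) (a : isometric_action G X)
    (tau : topology_on G) : Prop :=
  continuous (fun p : with_topology tau * X => a (p.1 : G) p.2).

(** ** Copies of l1 *)

Definition ell1 (R : realType) (k : scalar_kind) : set (nat -> scalars R k) :=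
  [set u | cvgn (series (fun n => rnorm (u n : (scalars R k)^o)))].

Arguments ell1 : clear implicits.

Definition ell1_norm (R : realType) (k : scalar_kind)
    (u : nat -> scalars R k) : R :=
  limn (series (fun n => rnorm (u n : (scalars R k)^o))).

(** [T] is only constrained on [ell1]; there it is a linear isomorphism (in the
    sense of normed spaces) onto the closed subspace [T @` ell1] of [X]. *)
Definition contains_ell1 (R : realType) (k : scalar_kind)
    (X : normedModType (scalars R k)) : Prop :=
  exists T : (nat -> scalars R k) -> X,
    [/\ forall (c : scalars R k) (u v : nat -> scalars R k),
          ell1 R k u -> ell1 R k v ->
          T (fun n => c * u n + v n) = c *: T u + T v,
        exists m M : R, [/\ 0 < m, 0 < M &
          forall u, ell1 R k u ->
            m * ell1_norm u <= rnorm (T u) <= M * ell1_norm u] &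
        closed (T @` ell1 R k)].

(** ** Bochner integral and the Radon-Nikodym property *)

Definition simple_function (d : measure_display) (S : measurableType d)
    (X : Type) (s : S -> X) : Prop :=
  finite_set (range s) /\ forall v : X, measurable (s @^-1` [set v]).

Definition simple_integral (d : measure_display) (S : measurableType d)
    (R : realType) (k : scalar_kind) (X : normedModType (scalars R k))
    (mu : {finite_measure set S -> \bar R}) (s : S -> X) (E : set S) : X :=
  \sum_(v \in range s) of_real k (fine (mu (E `&` s @^-1` [set v]))) *: v.

Definition bochner_approx (d : measure_display) (S : measurableType d)
    (R : realType) (k : scalar_kind) (X : normedModType (scalars R k))
    (mu : {finite_measure set S -> \bar R}) (f : S -> X)
    (s : nat -> S -> X) : Prop :=
  [/\ forall n, simple_function (s n),
      {ae mu, forall x, s ^~ x @ \oo --> f x} &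
      (\int[mu]_x (rnorm (f x - s n x))%:E)%E @[n --> \oo] --> 0%E].

Definition bochner_integrable (d : measure_display) (S : measurableType d)
    (R : realType) (k : scalar_kind) (X : normedModType (scalars R k))
    (mu : {finite_measure set S -> \bar R}) (f : S -> X) : Prop :=
  exists s, bochner_approx mu f s.

(** [v] is the Bochner integral of [f] over [E]. *)
Definition is_bochner_integral (d : measure_display) (S : measurableType d)
    (R : realType) (k : scalar_kind) (X : normedModType (scalars R k))
    (mu : {finite_measure set S -> \bar R}) (f : S -> X) (E : set S)
    (v : X) : Prop :=
  exists2 s, bochner_approx mu f s &
    simple_integral mu (s n) E @[n --> \oo] --> v.

(** Countable additivity forces [F set0 = 0]: take all the [A i] empty. *)
Definition vector_measure (d : measure_display) (S : measurableType d)
    (R : realType) (k : scalar_kind) (X : normedModType (scalars R k))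
    (F : set S -> X) : Prop :=
  forall A : nat -> set S, (forall i, measurable (A i)) ->
    trivIset setT A ->
    (\sum_(0 <= i < n) F (A i)) @[n --> \oo] --> F (\bigcup_i A i).

Definition abs_continuous (d : measure_display) (S : measurableType d)
    (R : realType) (k : scalar_kind) (X : normedModType (scalars R k))
    (mu : {finite_measure set S -> \bar R}) (F : set S -> X) : Prop :=
  forall A, measurable A -> mu A = 0%E -> F A = 0.

Definition finite_variation (d : measure_display) (S : measurableType d)
    (R : realType) (k : scalar_kind) (X : normedModType (scalars R k))
    (F : set S -> X) : Prop :=
  exists M : R, forall (n : nat) (A : 'I_n -> set S),
    (forall i, measurable (A i)) -> trivIset setT A ->
    \bigcup_i A i = setT ->
    \sum_(i < n) rnorm (F (A i)) <= M.

Definition Radon_Nikodym_property (R : realType) (k : scalar_kind)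
    (X : normedModType (scalars R k)) : Prop :=
  forall (d : measure_display) (S : measurableType d)
    (mu : {finite_measure set S -> \bar R}) (F : set S -> X),
    vector_measure F -> abs_continuous mu F -> finite_variation F ->
    exists2 f : S -> X, bochner_integrable mu f &
      forall E, measurable E -> is_bochner_integral mu f E (F E).

(** ** Slicely countably determined sets *)

Definition is_slice (R : realType) (k : scalar_kind)
    (X : normedModType (scalars R k)) (A S : set X) : Prop :=
  S !=set0 /\
  exists (f : {linear X -> (scalars R k)^o}) (a : R),
    bounded_near f (nbhs (0 : X)) /\
    S = [set x | A x /\ a < real_part (f x)].

(** For complex scalars the coefficients [t] in the library's [convex_set]
    satisfy [0 <= t <= 1], hence are real. *)
Definition convex_hull (R : realType) (k : scalar_kind)
    (X : normedModType (scalars R k)) (B : set X) : set X :=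
  \bigcap_(C in [set C : set X | convex_set C /\ B `<=` C]) C.

(** Used for bounded convex [A]. *)
Definition SCD (R : realType) (k : scalar_kind)
    (X : normedModType (scalars R k)) (A : set X) : Prop :=
  exists S : nat -> set X,
    (forall n, is_slice A (S n)) /\
    forall B : set X, B `<=` A -> (forall n, B `&` S n !=set0) ->
      A `<=` closure (convex_hull B).

(* Main.v *)
Require Import Defs.
From HB Require Import structures.
From mathcomp Require Import all_boot all_order all_algebra.
From mathcomp Require Import complex.
From mathcomp Require Import all_classical all_reals all_analysis.
From mathcomp Require Import measurable_realfun.
From mathcomp Require Import ring lra.

Set Implicit Arguments.
Unset Strict Implicit.
Unset Printing Implicit Defensive.

Import Order.TTheory GRing.Theory Num.Theory.
Import numFieldNormedType.Exports.

Local Open Scope classical_set_scope.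
Local Open Scope ring_scope.

(** Write [N] for the real-valued norm and let a _contractive functional_ be a
    real-linear [f] with [f x <= N x].  The Daugavet condition for the rank-one
    operator [f (_) z] says that each slice of the unit ball contains points [y]
    with [N (z + a g y)] almost [N z + 1] for some [g] (stretch_in_slice).  If a
    contractive [f] is almost [1] at [a g y], then it is at least about
    [1 - alpha a] at [y] (alpha_lower), and [1 - alpha a > -1].  All three
    conclusions come from playing this lower bound against the value [-1].

    _Slices._  Let [N x0 = 1] and let slices [S n] be given.  Starting with
    [- x0], add successively [a (g n) (y n)] with [y n] in [S n] such that the
    norms of the sums are almost additive.  Some contractive [f] then is almost
    [1] at [- x0] and at all [a (g n) (y n)] (norming_functional, a consequence
    of the Hahn-Banach theorem dominated_extension).  Thus [f x0] is almost [-1]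
    while [f (y n) >= 1 - alpha a - e], and [x0] is not in the closed convex hull
    of the [y n] (unit_ball_not_SCD).

    _Radon-Nikodym property._  Separation turns the statement on slices into
    one on averages: each [x] of the ball is approximated by averages of points
    of the ball at distance at least almost [gap a] from [x] (far_averages).  Spreading
    the error makes these averages exact, and iteration gives a bush: a bounded
    martingale on nested partitions of the unit interval whose increments stay
    away from [0] (bush_exists).  Its partial integrals over any measurable set
    converge, because every measurable set is almost a union of pieces
    (osc_small, partial_integral_cauchy).  The limits form a vector measure of
    bounded variation; a density would make the increments tend to [0] in mean
    (martingale_not_Radon_Nikodym).

    _Copies of l1._  The averages above allow one to choose a countable set [Y],
    closed under rational operations, in whose ball the statement on slices
    still holds (countable_core).  As in the first part, for each sequence of
    slices of the ball of [Y] some contractive [f] with [f x0] almost [-1] is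
    almost [1] at translates of points in each slice (independent_exists).  A
    weak-star open set of functionals, given by finitely many rational bounds on
    values at points of [Y], is called big if it contains such an [f] for every
    sequence of slices.  There are only countably many of these sets, so some
    sequence of slices forces all sets containing [f] to be big
    (generic_witness).  Given finitely many big sets, take such a generic [f] in
    each.  The point [x0] is close, for these functionals, to convex combinations
    of points in suitable slices (localize), and the slices can be shrunk so
    that a second generic functional in each big set is at least about
    [1 - alpha a] on them (refine_slices_all).  A combination of points of the
    small slices therefore splits each of the given sets into two big ones: one
    where its value is almost [-1], and one where it stays away from [-1]
    (split_all).  Iterating yields a sequence [y] on which functionals realize
    all patterns of the two kinds of values (independent_sequence), and such a
    sequence spans a copy of [l1] (lower_l1_estimate,
    lower_estimate_contains_ell1). *)

(** * Scalars and the real-valued norm *)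

Section Scalars.
Context (R : realType) (k : scalar_kind).
Local Notation K := (scalars R k).
Implicit Types (c d : K) (s t : R).

Lemma real_partD c d : real_part (c + d) = real_part c + real_part d.
Proof. by case: k c d => //= -[? ?] [? ?]. Qed.

Lemma real_partN c : real_part (- c) = - real_part c.
Proof. by case: k c => //= -[? ?]. Qed.

Lemma real_partB c d : real_part (c - d) = real_part c - real_part d.
Proof. by rewrite real_partD real_partN. Qed.

Lemma real_part0 : real_part (0 : K) = 0.
Proof. by case: k. Qed.

Lemma of_realK t : real_part (of_real k t) = t.
Proof. by case: k. Qed.

Lemma of_realD s t : of_real k (s + t) = of_real k s + of_real k t.
Proof. by case: k => //=; rewrite rmorphD. Qed.

Lemma of_realN t : of_real k (- t) = - of_real k t.
Proof. by case: k => //=; rewrite rmorphN. Qed.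

Lemma of_realB s t : of_real k (s - t) = of_real k s - of_real k t.
Proof. by rewrite of_realD of_realN. Qed.

Lemma of_realM s t : of_real k (s * t) = of_real k s * of_real k t.
Proof. by case: k => //=; rewrite rmorphM. Qed.

Lemma of_real0 : of_real k (0 : R) = 0. Proof. by case: k. Qed.
Lemma of_real1 : of_real k (1 : R) = 1. Proof. by case: k. Qed.

Lemma of_real_le s t : (of_real k s <= of_real k t) = (s <= t).
Proof. by case: k => //=; rewrite lecR. Qed.

Lemma of_real_lt s t : (of_real k s < of_real k t) = (s < t).
Proof. by case: k => //=; rewrite ltcR. Qed.

Lemma of_real_eq0 t : (of_real k t == 0) = (t == 0).
Proof. by rewrite -of_real0; case: k => //=; rewrite (inj_eq (@complexI _)). Qed.

Lemma norm_of_real t : `|of_real k t| = of_real k `|t|.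
Proof.
case: k => //=; have [t0|t0] := leP 0 t; first by rewrite !ger0_norm ?ler0c.
by rewrite !ltr0_norm ?ltcR // rmorphN.
Qed.

Lemma ge0_of_real c : 0 <= c -> c = of_real k (real_part c).
Proof.
by case: k c => //= -[a b]; rewrite lecE /= => /andP[/eqP -> _].
Qed.

Lemma norm_real_part c : `|c| = of_real k (real_part `|c|).
Proof. exact: ge0_of_real. Qed.

Lemma real_partZ t c : real_part (of_real k t * c) = t * real_part c.
Proof. by case: k c => //= -[a b] /=; rewrite mul0r subr0. Qed.

Lemma real_part_norm_ge0 c : 0 <= real_part `|c|.
Proof. by rewrite -of_real_le of_real0 -norm_real_part. Qed.

Lemma real_part_normM c d : real_part `|c * d| = real_part `|c| * real_part `|d|.
Proof. by rewrite normrM [in LHS]norm_real_part real_partZ. Qed.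

Lemma real_part_norm_of_real t : real_part `|of_real k t| = `|t|.
Proof. by rewrite norm_of_real of_realK. Qed.

Lemma ler_real_part_normD c d :
  real_part `|c + d| <= real_part `|c| + real_part `|d|.
Proof.
by rewrite -of_real_le of_realD -!norm_real_part ler_normD.
Qed.

Lemma real_part_le_norm c : real_part c <= real_part `|c|.
Proof.
rewrite -of_real_le -norm_real_part; case: k c => /= [c|c]; first exact: ler_norm.
by apply: le_trans (normc_ge_Re c); rewrite lecR ler_norm.
Qed.

Lemma real_part_norm0 : real_part `|0 : K| = 0.
Proof. by rewrite normr0 real_part0. Qed.

Lemma unimodular_rotation c :
  exists2 d : K, real_part `|d| = 1 & d * c = of_real k (real_part `|c|).
Proof.
have [->|c0] := eqVneq c 0.
  exists 1; last by rewrite mulr0 real_part_norm0 of_real0.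
  by rewrite normr1 -of_real1 of_realK.
exists (`|c| / c); last by rewrite divfK// -norm_real_part.
by rewrite normf_div normr_id divff ?normr_eq0// -of_real1 of_realK.
Qed.

End Scalars.

Section RealNorm.
Context (R : realType) (k : scalar_kind) (X : normedModType (scalars R k)).
Local Notation K := (scalars R k).
Implicit Types (x y : X) (s t : R).

Definition rscale t x : X := of_real k t *: x.

Lemma rscaleDr t x y : rscale t (x + y) = rscale t x + rscale t y.
Proof. exact: scalerDr. Qed.
Lemma rscaleDl s t x : rscale (s + t) x = rscale s x + rscale t x.
Proof. by rewrite /rscale of_realD scalerDl. Qed.
Lemma rscaleA s t x : rscale s (rscale t x) = rscale (s * t) x.
Proof. by rewrite /rscale scalerA of_realM. Qed.
Lemma rscale1 x : rscale 1 x = x.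
Proof. by rewrite /rscale of_real1 scale1r. Qed.
Lemma rscale0 x : rscale 0 x = 0.
Proof. by rewrite /rscale of_real0 scale0r. Qed.
Lemma rscaleN t x : rscale t (- x) = - rscale t x.
Proof. exact: scalerN. Qed.
Lemma rscaleNl t x : rscale (- t) x = - rscale t x.
Proof. by rewrite /rscale of_realN scaleNr. Qed.
Lemma rscaleBr t x y : rscale t (x - y) = rscale t x - rscale t y.
Proof. by rewrite rscaleDr rscaleN. Qed.
Lemma rscaleBl s t x : rscale (s - t) x = rscale s x - rscale t x.
Proof. by rewrite rscaleDl rscaleNl. Qed.
Lemma rscale_sumr (I : Type) (r : seq I) (P : pred I) t (F : I -> X) :
  rscale t (\sum_(i <- r | P i) F i) = \sum_(i <- r | P i) rscale t (F i).
Proof. exact: scaler_sumr. Qed.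
Lemma rscale_suml (I : Type) (r : seq I) (P : pred I) (F : I -> R) x :
  rscale (\sum_(i <- r | P i) F i) x = \sum_(i <- r | P i) rscale (F i) x.
Proof.
apply: (big_morph (fun t => rscale t x)) => [s t|]; first exact: rscaleDl.
exact: rscale0.
Qed.
Lemma rscale_nat (n : nat) x : rscale n%:R x = x *+ n.
Proof.
elim: n => [|n IH]; first by rewrite rscale0.
by rewrite -natr1 rscaleDl IH rscale1 mulrSr.
Qed.

Lemma rnormE x : `|x| = of_real k (rnorm x).
Proof. exact: ge0_of_real. Qed.
Lemma rnorm_ge0 x : 0 <= rnorm x.
Proof. by rewrite -(of_real_le k) of_real0 -rnormE. Qed.
Lemma rnormD x y : rnorm (x + y) <= rnorm x + rnorm y.
Proof. by rewrite -(of_real_le k) of_realD -!rnormE ler_normD. Qed.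
Lemma rnormN x : rnorm (- x) = rnorm x.
Proof. by rewrite /rnorm normrN. Qed.
Lemma rnormB x y : rnorm (x - y) <= rnorm x + rnorm y.
Proof. by rewrite (le_trans (rnormD _ _))// rnormN. Qed.
Lemma rnorm_distC x y : rnorm (x - y) = rnorm (y - x).
Proof. by rewrite -rnormN opprB. Qed.
Lemma rnorm0 : rnorm (0 : X) = 0.
Proof. by rewrite /rnorm normr0 real_part0. Qed.
Lemma rnorm_eq0 x : (rnorm x == 0) = (x == 0).
Proof. by rewrite -(of_real_eq0 k) -rnormE normr_eq0. Qed.
Lemma rnorm_gt0 x : (0 < rnorm x) = (x != 0).
Proof. by rewrite lt_neqAle rnorm_ge0 andbT eq_sym rnorm_eq0. Qed.
Lemma rnormMc (c : K) x : rnorm (c *: x) = real_part `|c| * rnorm x.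
Proof. by rewrite /rnorm normrZ [in LHS]norm_real_part real_partZ. Qed.
Lemma rnormZ t x : rnorm (rscale t x) = `|t| * rnorm x.
Proof. by rewrite rnormMc real_part_norm_of_real. Qed.
Lemma rnorm_sum (I : Type) (r : seq I) (P : pred I) (F : I -> X) :
  rnorm (\sum_(i <- r | P i) F i) <= \sum_(i <- r | P i) rnorm (F i).
Proof.
elim/big_ind2 : _ => [|a b c d ab cd|//]; first by rewrite rnorm0.
by rewrite (le_trans (rnormD _ _))// lerD.
Qed.
Lemma rnorm_triangle y x z : rnorm (x - z) <= rnorm (x - y) + rnorm (y - z).
Proof. by rewrite -(subrKA y) rnormD. Qed.
Lemma rnorm_sub_ge x y : rnorm x - rnorm y <= rnorm (x - y).
Proof. by rewrite lerBlDr -{1}(subrK y x) rnormD. Qed.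
Lemma rnorm_add_ge x y : rnorm x - rnorm y <= rnorm (x + y).
Proof. by have := rnorm_sub_ge x (- y); rewrite rnormN opprK. Qed.

End RealNorm.

(** * Sublinear functionals and linear minorants *)

Section HahnBanach.
Context (R : realType) (k : scalar_kind) (X : normedModType (scalars R k)).
Implicit Types (p q f : X -> R) (x y : X) (s t : R).
Local Notation rscale := (@rscale R k X).

Definition sublinear p :=
  [/\ p 0 = 0, forall x y, p (x + y) <= p x + p y &
      forall t x, 0 < t -> p (rscale t x) = t * p x].

Definition rlinear f :=
  (forall x y, f (x + y) = f x + f y) /\
  (forall t x, f (rscale t x) = t * f x).

Lemma rlinear0 f : rlinear f -> f 0 = 0.
Proof. by move=> [_ fZ]; rewrite -(rscale0 0) fZ mul0r. Qed.
Lemma rlinearN f x : rlinear f -> f (- x) = - f x.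
Proof.
by move=> lf; apply/eqP; rewrite -addr_eq0 -lf.1 addNr rlinear0.
Qed.
Lemma rlinearB f x y : rlinear f -> f (x - y) = f x - f y.
Proof. by move=> lf; rewrite lf.1 rlinearN. Qed.
Lemma rlinear_sum f (I : Type) (r : seq I) (P : pred I) (F : I -> X) :
  rlinear f -> f (\sum_(i <- r | P i) F i) = \sum_(i <- r | P i) f (F i).
Proof.
by move=> lf; apply: (big_morph f) => [x y|]; [exact: lf.1|exact: rlinear0].
Qed.

(** A convex cone in [X * R], given by the pairs [(u, s)] in [Q]. *)
Definition cone (Q : X -> R -> Prop) :=
  [/\ Q 0 0, forall u v s t, Q u s -> Q v t -> Q (u + v) (s + t) &
      forall u s t, 0 < t -> Q u s -> Q (rscale t u) (t * s)].

Definition cone_inf p (Q : X -> R -> Prop) x : R :=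
  inf [set r | exists u s, Q u s /\ r = p (x + u) - s].

Section ConeInf.
Variables (p : X -> R) (Q : X -> R -> Prop).
Hypotheses (sp : sublinear p) (cQ : cone Q).
Hypothesis pQ : forall u s, Q u s -> s <= p u.

Let cone_inf_lb x : lbound
  [set r | exists u s, Q u s /\ r = p (x + u) - s] (- p (- x)).
Proof.
move=> _ [u [s [Qus ->]]]; have [_ pD _] := sp.
have := pD (x + u) (- x); rewrite addrAC subrr add0r => h.
have := pQ Qus; lra.
Qed.

Let cone_inf_has_inf x :
  has_inf [set r | exists u s, Q u s /\ r = p (x + u) - s].
Proof.
split; last by exists (- p (- x)); exact: cone_inf_lb.
by exists (p (x + 0) - 0); exists 0, 0; split => //; case: cQ.
Qed.

Lemma cone_inf_le x u s : Q u s -> cone_inf p Q x <= p (x + u) - s.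
Proof.
move=> Qus; apply: ge_inf; first exact: (cone_inf_has_inf x).2.
by exists u, s.
Qed.

Lemma cone_inf_le_self x : cone_inf p Q x <= p x.
Proof.
by have [Q0 _ _] := cQ; have := cone_inf_le x Q0; rewrite addr0 subr0.
Qed.

Lemma cone_inf_ge x : - p (- x) <= cone_inf p Q x.
Proof. by apply: lb_le_inf; [exact: (cone_inf_has_inf x).1|exact: cone_inf_lb]. Qed.

Let cone_inf_approx x e : 0 < e ->
  exists u s, Q u s /\ p (x + u) - s < cone_inf p Q x + e.
Proof.
move=> e0; have [_ [u [s [Qus ->]]] h] := inf_adherent e0 (cone_inf_has_inf x).
by exists u, s.
Qed.

Let cone_inf_scale_le t x : 0 < t ->
  cone_inf p Q (rscale t x) <= t * cone_inf p Q x.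
Proof.
move=> t0; apply/ler_addgt0Pr => e e0.
have [|u [s [Qus h]]] := @cone_inf_approx x (e / t); first exact: divr_gt0.
have [_ _ QZ] := cQ; have [_ _ pZ] := sp.
have := cone_inf_le (rscale t x) (QZ _ _ _ t0 Qus).
rewrite -rscaleDr pZ// -mulrBr => /le_trans; apply.
have: t * (p (x + u) - s) <= t * (cone_inf p Q x + e / t).
  by rewrite ler_pM2l// ltW.
by rewrite [X in _ <= X -> _]mulrDr [t * (e / t)]mulrC divfK ?gt_eqF//.
Qed.

Lemma cone_inf_sublinear : sublinear (cone_inf p Q).
Proof.
have [p0 pD pZ] := sp; have [Q0 QD QZ] := cQ; split.
- apply/eqP; rewrite eq_le; apply/andP; split.
    by have := cone_inf_le_self 0; rewrite p0.
  by have := cone_inf_ge 0; rewrite oppr0 p0 oppr0.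
- move=> x y; apply/ler_addgt0Pr => e e0.
  have e20 : 0 < e / 2 by lra.
  have [u [s [Qu hu]]] := cone_inf_approx x e20.
  have [v [t [Qv hv]]] := cone_inf_approx y e20.
  have := cone_inf_le (x + y) (QD _ _ _ _ Qu Qv).
  have := pD (x + u) (y + v); rewrite addrACA => h1 h2; lra.
- move=> t x t0; apply/eqP; rewrite eq_le cone_inf_scale_le//=.
  have ti : 0 < t^-1 by rewrite invr_gt0.
  have := cone_inf_scale_le (rscale t x) ti.
  rewrite rscaleA mulVf ?gt_eqF// rscale1 => h.
  by rewrite -ler_pdivlMl.
Qed.

End ConeInf.

(** Replacing [q] by its infimum along the ray spanned by [y] keeps it
    sublinear, so a minimal [q] is unchanged; comparing at the parameter [1]
    gives superadditivity. *)
Lemma minimal_sublinear_rlinear q : sublinear q ->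
  (forall r, sublinear r -> (forall x, r x <= q x) -> r = q) -> rlinear q.
Proof.
move=> sq qmin; have [q0 qD qZ] := sq.
have qadd x y : q (x + y) = q x + q y.
  apply/eqP; rewrite eq_le qD /=.
  pose Q (u : X) (s : R) := exists2 t, 0 <= t & u = rscale t y /\ s = t * q y.
  have cQ : cone Q.
    split.
    - by exists 0 => //; rewrite rscale0 mul0r.
    - move=> _ _ _ _ [t t0 [-> ->]] [t' t'0 [-> ->]].
      by exists (t + t'); rewrite ?addr_ge0// rscaleDl mulrDl.
    - move=> _ _ t t0 [t' t'0 [-> ->]]; exists (t * t').
        by rewrite mulr_ge0// ltW.
      by rewrite rscaleA mulrA.
  have qQ u s : Q u s -> s <= q u.
    move=> [t]; rewrite le_eqVlt => /predU1P[<-|t0] [-> ->].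
      by rewrite mul0r rscale0 q0.
    by rewrite qZ.
  have sr := cone_inf_sublinear sq cQ qQ.
  rewrite -{1}(qmin _ sr (cone_inf_le_self sq cQ qQ)).
  have := @cone_inf_le q Q sq cQ qQ x y (q y).
  rewrite -lerBrDr; apply.
  by exists 1; rewrite ?ler01// rscale1 mul1r.
split => // t x.
have qN z : q (- z) = - q z.
  by apply/eqP; rewrite -addr_eq0 -qadd addNr q0.
have [t0|t0|->] := ltgtP t 0; last by rewrite rscale0 mul0r.
  have := qZ (- t) (- x); rewrite oppr_gt0 t0 rscaleNl rscaleN opprK qN mulrNN.
  exact.
exact: qZ.
Qed.

(** The Hahn-Banach theorem in the form of a sandwich: lowering [p] along the
    cone gives a sublinear functional whose linear minorants dominate the
    heights [s], and a minimal sublinear functional is such a minorant. *)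
Theorem dominated_extension p Q : sublinear p -> cone Q ->
  (forall u s, Q u s -> s <= p u) ->
  exists f, [/\ rlinear f, forall x, f x <= p x & forall u s, Q u s -> s <= f u].
Proof.
move=> sp cQ pQ.
pose p0 := cone_inf p Q.
have sp0 : sublinear p0 := cone_inf_sublinear sp cQ pQ.
pose T := {q : X -> R | sublinear q /\ forall x, q x <= p0 x}.
pose Rel (a b : T) : bool := `[< forall x, sval b x <= sval a x >].
have [] := @Zorn T Rel.
- by move=> a; apply/asboolP.
- by move=> a b c /asboolP ab /asboolP bc; apply/asboolP => x; apply: le_trans (ab x).
- move=> [a Ha] [b Hb] /asboolP /= ab /asboolP /= ba.
  have abE : a = b by apply/funext => x; apply/eqP; rewrite eq_le ab ba.
  by subst b; congr exist; exact: Prop_irrelevance.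
- move=> A Atot.
  have [[a0 Aa0]|A0] := pselect (exists a, A a); last first.
    exists (exist _ p0 (conj sp0 (fun x => lexx (p0 x)))) => a Aa.
    by exfalso; apply: A0; exists a.
  pose E x := [set r | exists2 a, A a & r = sval a x].
  have Elb x : lbound (E x) (- p0 (- x)).
    move=> _ [a Aa ->]; have [[q0 qD _] qp] := svalP a.
    have := qD x (- x); rewrite subrr q0 => h; have := qp (- x); lra.
  have Ehi x : has_inf (E x).
    by split; [exists (sval a0 x); exists a0|exists (- p0 (- x)); exact: Elb].
  pose q x := inf (E x).
  have qle a x : A a -> q x <= sval a x.
    by move=> Aa; apply: ge_inf; [exact: (Ehi x).2|exists a].
  have qap x e : 0 < e -> exists2 a, A a & sval a x < q x + e.
    by move=> e0; have [_ [a Aa ->] h] := inf_adherent e0 (Ehi x); exists a.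
  have sq : sublinear q.
    have qsc t x : 0 < t -> q (rscale t x) <= t * q x.
      move=> t0; apply/ler_addgt0Pr => e e0.
      have [|a Aa h] := @qap x (e / t); first exact: divr_gt0.
      have [[_ _ aZ] _] := svalP a.
      apply: (le_trans (qle a _ Aa)); rewrite aZ//.
      have: t * sval a x <= t * (q x + e / t) by rewrite ler_pM2l// ltW.
      by rewrite [X in _ <= X -> _]mulrDr [t * (e / t)]mulrC divfK ?gt_eqF//.
    split.
    - apply/eqP; rewrite eq_le; apply/andP; split.
        by have [[h _ _] _] := svalP a0; rewrite -h; exact: qle.
      apply: lb_le_inf; first exact: (Ehi 0).1.
      by move=> _ [a Aa ->]; have [[-> _ _] _] := svalP a.
    - move=> x y; apply/ler_addgt0Pr => e e0.
      have e20 : 0 < e / 2 by lra.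
      have [a Aa ha] := qap x _ e20; have [b Ab hb] := qap y _ e20.
      have [c [Ac ca cb]] : exists c, [/\ A c, sval c x <= sval a x & sval c y <= sval b y].
        by have [|] := Atot _ _ Aa Ab => /asboolP h; [exists b|exists a]; split.
      have [[_ cD _] _] := svalP c.
      have := qle c (x + y) Ac; have := cD x y; lra.
    - move=> t x t0; apply/eqP; rewrite eq_le qsc//=.
      have ti : 0 < t^-1 by rewrite invr_gt0.
      have := qsc _ (rscale t x) ti.
      rewrite rscaleA mulVf ?gt_eqF// rscale1 => h.
      by rewrite -ler_pdivlMl.
  have qp0 x : q x <= p0 x.
    by apply: le_trans (qle a0 x Aa0) _; have [_] := svalP a0.
  exists (exist _ q (conj sq qp0)) => a Aa; apply/asboolP => x /=.
  exact: qle.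
move=> [f [sf fp0]] fmax.
have lf : rlinear f.
  apply: minimal_sublinear_rlinear => // r sr rf.
  have rp0 x : r x <= p0 x := le_trans (rf x) (fp0 x).
  have := fmax (exist _ r (conj sr rp0)).
  have -> : Rel (exist _ f (conj sf fp0)) (exist _ r (conj sr rp0)).
    exact/asboolP.
  by move=> /(_ isT) [].
exists f; split => //.
- by move=> x; apply: le_trans (fp0 x) _; exact: cone_inf_le_self.
- move=> u s Qus; have := fp0 (- u); rewrite rlinearN// => h.
  have := cone_inf_le sp cQ pQ (- u) Qus; rewrite addNr.
  have [-> _ _] := sp; rewrite -/p0 => h2; lra.
Qed.

End HahnBanach.
(** * Contractive functionals *)

Section Functionals.
Context (R : realType) (k : scalar_kind) (X : normedModType (scalars R k)).
Local Notation K := (scalars R k).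
Implicit Types (x y : X) (f : X -> R).

Definition contractive f := rlinear f /\ forall x, f x <= rnorm x.

Lemma contractive_abs f x : contractive f -> `|f x| <= rnorm x.
Proof.
move=> [lf fN]; rewrite ler_norml fN andbT lerNl -(rlinearN _ lf).
by rewrite -(rnormN x) fN.
Qed.

Lemma rnorm_sublinear : sublinear (@rnorm R k X).
Proof.
split => [|x y|t x t0]; [exact: rnorm0|exact: rnormD|].
by rewrite rnormZ gtr0_norm.
Qed.

(** In the complex case [F x] is [f x - i f (i x)]. *)
Lemma scalar_extension f : rlinear f ->
  exists F : {linear X -> K^o}, forall x, real_part (F x : K) = f x.
Proof.
move: f; move: X; case: (k) => Y f lf.
  have lF : linear (f : Y -> (scalars R RealScalars)^o).
    by move=> c u v; rewrite lf.1 (lf.2 c u).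
  pose F : {linear Y -> (scalars R RealScalars)^o} :=
    HB.pack (f : Y -> (scalars R RealScalars)^o)
      (GRing.isLinear.Build _ _ _ _ (f : Y -> (scalars R RealScalars)^o) lF).
  by exists F.
pose g (x : Y) : (scalars R ComplexScalars)^o :=
  (f x +i* (- f (('i%C : scalars R ComplexScalars) *: x)))%C.
have lF : linear g.
  move=> [s t] u v; rewrite /g.
  have fs (p q : R) w : f (((p +i* q)%C : scalars R ComplexScalars) *: w) =
      p * f w + q * f (('i%C : scalars R ComplexScalars) *: w).
    rewrite -!lf.2 -lf.1 /rscale /= scalerA -scalerDl; congr (f (_ *: _)).
    by apply/eqP; rewrite eq_complex /= !(mulr0, mul0r, mulr1, mul1r, addr0, subr0, add0r, sub0r, oppr0) !eqxx.
  rewrite lf.1 (fs s t) scalerDr lf.1 scalerA.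
  have -> : ('i%C : scalars R ComplexScalars) * (s +i* t)%C = (- t +i* s)%C.
    by apply/eqP; rewrite eq_complex /= !(mulr0, mul0r, mulr1, mul1r, addr0, subr0, add0r, sub0r, oppr0) !eqxx.
  rewrite (fs (- t) s); apply/eqP; rewrite eq_complex /=.
  by apply/andP; split; apply/eqP; ring.
pose F : {linear Y -> (scalars R ComplexScalars)^o} :=
  HB.pack g (GRing.isLinear.Build _ _ _ _ g lF).
by exists F.
Qed.

Lemma linear_real_part_rlinear (F : {linear X -> K^o}) :
  rlinear (fun x => real_part (F x : K)).
Proof.
split => [x y|t x]; first by rewrite linearD real_partD.
by rewrite /rscale linearZ /= real_partZ.
Qed.

(** Rotating the argument turns the modulus of a scalar functional into its
    real part, so both have the same bound. *)
Lemma scalar_extension_bound (F : {linear X -> K^o}) f M :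
  (forall x, real_part (F x : K) = f x) ->
  (forall x, f x <= M * rnorm x) ->
  forall x, real_part `|F x : K| <= M * rnorm x.
Proof.
move=> FE fM x; have [d d1 dE] := unimodular_rotation (F x : K).
have := fM (d *: x); rewrite -FE linearZ /= rnormMc d1 mul1r.
by rewrite -[_ *: _]/(d * F x) dE of_realK.
Qed.

Lemma rnorm_bounded_near (Y : normedModType K) (T : {linear X -> Y}) M :
  (forall x, rnorm (T x) <= M * rnorm x) -> bounded_near T (nbhs (0 : X)).
Proof.
move=> TM; apply/linear_boundedP; exists (of_real k `|M|); split.
  by rewrite realE -of_real0 of_real_le normr_ge0.
move=> r rM x; rewrite !rnormE.
have r0 : 0 <= r by apply: le_trans (ltW rM); rewrite -of_real0 of_real_le.
move: rM; rewrite (ge0_of_real r0) of_real_lt -of_realM of_real_le => rM.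
apply: (le_trans (TM x)); rewrite ler_wpM2r ?rnorm_ge0//.
by rewrite (le_trans (ler_norm M))// ltW.
Qed.

Lemma bounded_near_rnorm (Y : normedModType K) (T : {linear X -> Y}) :
  bounded_near T (nbhs (0 : X)) ->
  exists M, forall x, rnorm (T x) <= M * rnorm x.
Proof.
move=> /linear_boundedP/pinfty_ex_gt0[M M0 TM]; exists (real_part M) => x.
have := TM x; rewrite !rnormE (ge0_of_real (ltW M0)) of_realK.
by rewrite -of_realM of_real_le.
Qed.

Lemma sup_gt_witness (E : set R) r : 0 <= r -> r < sup E ->
  exists2 s, E s & r < s.
Proof.
move=> r0 rE; have hE : has_sup E.
  by apply: contrapT => /sup_out E0; move: rE; rewrite E0 ltNge r0.
have [|s Es] := @sup_adherent _ E (sup E - r) _ hE; first by rewrite subr_gt0.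
by rewrite subKr; exists s.
Qed.

(** The norms of the [z n] are almost additive, so the cone spanned by the pairs
    [(z n, n%:R - e)] lies below the norm.  The bounds on [f (z n)] say that the
    deficits [1 - f (z n.+1 - z n)] have a sum of at most [e], which is more than
    a bound on each of them. *)
Lemma norming_functional (z : nat -> X) e :
  z 0%N = 0 -> (forall n, rnorm (z n.+1 - z n) <= 1) ->
  (forall n, n%:R - e <= rnorm (z n)) -> 0 <= e ->
  exists2 f, contractive f &
    (forall n, n%:R - e <= f (z n)) /\ (forall n, 1 - e <= f (z n.+1 - z n)).
Proof.
move=> z0 zS zn e0.
have zmn m n : (m <= n)%N -> rnorm (z n - z m) <= n%:R - m%:R.
  elim: n => [|n IH]; first by rewrite leqn0 => /eqP ->; rewrite !subrr rnorm0.
  rewrite leq_eqVlt => /predU1P[->|]; first by rewrite !subrr rnorm0.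
  rewrite ltnS => /IH h; have := rnorm_triangle (z n) (z n.+1) (z m).
  have := zS n; rewrite -natr1; lra.
(* The error term makes the union of the rays through the [z n] convex: the
   multiples of [z m] are approximated by those of [z n] for [m <= n]. *)
pose Q u s := exists n t, 0 <= t /\ s <= t * (n%:R - e) - rnorm (u - rscale t (z n)).
have [| |f [lf fN fQ]] := @dominated_extension R k X (@rnorm R k X) Q rnorm_sublinear.
- split.
  + by exists 0%N, 0; rewrite rscale0 subrr rnorm0 mul0r subr0.
  + move=> u v s t [m [p [p0 hs]]] [n [q [q0 ht]]].
    wlog mn : u v s t m n p q p0 q0 hs ht / (m <= n)%N.
      move=> H; have [mn|/ltnW nm] := leqP m n.
        exact: (H u v s t m n p q p0 q0 hs ht mn).
      by rewrite [u + v]addrC [s + t]addrC; exact: (H v u t s n m q p q0 p0 ht hs nm).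
    exists n, (p + q); split; first exact: addr_ge0.
    have -> : u + v - rscale (p + q) (z n) =
        (u - rscale p (z m)) + (v - rscale q (z n)) - rscale p (z n - z m).
      rewrite rscaleDl rscaleBr opprB [X in _ = X + _]addrACA -[RHS]addrA.
      by rewrite [X in _ = _ + X]addrACA addNr add0r opprD [- rscale q _ - _]addrC.
    have := rnormB (u - rscale p (z m) + (v - rscale q (z n))) (rscale p (z n - z m)).
    have := rnormD (u - rscale p (z m)) (v - rscale q (z n)).
    rewrite rnormZ (ger0_norm p0).
    have : p * rnorm (z n - z m) <= p * (n%:R - m%:R) by rewrite ler_wpM2l// zmn.
    nra.
  + move=> u s t t0 [n [p [p0 hs]]]; exists n, (t * p); split.
      by rewrite mulr_ge0// ltW.
    rewrite -rscaleA -rscaleBr rnormZ (gtr0_norm t0) -mulrA -mulrBr.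
    by rewrite ler_pM2l.
- move=> u s [n [t [t0 hs]]].
  have := rnorm_sub_ge (rscale t (z n)) (rscale t (z n) - u).
  rewrite subKr rnormZ (ger0_norm t0) (rnorm_distC _ u).
  have : t * (n%:R - e) <= t * rnorm (z n) by rewrite ler_wpM2l.
  lra.
have fz n : n%:R - e <= f (z n).
  by apply: fQ; exists n, 1; split; rewrite // rscale1 subrr rnorm0 mul1r subr0.
exists f => //; split => // n.
have := fz n.+1; have := fN (z n); have := zmn 0%N n (leq0n _).
rewrite z0 !subr0 rlinearB// -natr1; lra.
Qed.

End Functionals.

(** * Stretching by group translates *)

Section Action.
Context (R : realType) (k : scalar_kind) (X : normedModType (scalars R k)).
Context (G : groupType) (a : isometric_action G X).
Local Notation K := (scalars R k).
Implicit Types (x y : X) (g h : G).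

Lemma actD g x y : a g (x + y) = a g x + a g y.
Proof. by have := iso_act_linear a g 1 x y; rewrite !scale1r. Qed.
Lemma act0 g : a g 0 = 0.
Proof. by apply: (addrI (a g 0)); rewrite -actD !addr0. Qed.
Lemma actZ g (c : K) x : a g (c *: x) = c *: a g x.
Proof. by have := iso_act_linear a g c x 0; rewrite act0 !addr0. Qed.
Lemma actB g x y : a g (x - y) = a g x - a g y.
Proof. by rewrite actD -scaleN1r actZ scaleN1r. Qed.
Lemma rnorm_act g x : rnorm (a g x) = rnorm x.
Proof. by rewrite /rnorm iso_act_norm. Qed.
Lemma actVK g x : a g^-1%g (a g x) = x.
Proof. by rewrite -iso_actM mulVg iso_act1. Qed.

Lemma contractive_act f g : contractive f -> contractive (fun x => f (a g x)).
Proof.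
move=> [[fD fZ] fN]; split; last by move=> x; rewrite -(rnorm_act g).
by split => [x y|t x]; rewrite ?actD ?fD// /rscale actZ -fZ.
Qed.

Lemma alpha_bound g x : rnorm (a g x - x) <= alpha a * rnorm x.
Proof.
have [->|x0] := eqVneq x 0; first by rewrite act0 subrr !rnorm0 mulr0.
have xp : 0 < rnorm x by rewrite rnorm_gt0.
rewrite -ler_pdivrMr//; apply: ub_le_sup.
  exists 2 => _ [h [y y1 ->]]; rewrite (le_trans (rnormB _ _))// rnorm_act.
  by move: y1; rewrite /unit_sphere /= => ->.
exists g, (rscale (rnorm x)^-1 x).
  by rewrite /unit_sphere /= rnormZ ger0_norm ?invr_ge0 ?rnorm_ge0// mulVf// gt_eqF.
rewrite /rscale actZ -/(rscale _ _) -/(rscale _ x) -rscaleBr rnormZ.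
by rewrite ger0_norm ?invr_ge0 ?rnorm_ge0// mulrC.
Qed.

Lemma alpha_lower f g x : contractive f -> f (a g x) - alpha a * rnorm x <= f x.
Proof.
move=> cf; have := cf.2 (a g x - x); rewrite rlinearB ?cf.1//; last by case: cf.
have := alpha_bound g x; lra.
Qed.

Hypothesis hD : G_Daugavet a.
Hypothesis hX : exists x : X, x != 0.

(** The operator [T] is [f (_) z] with [f] extended to the scalar field.  For
    [T] the Daugavet condition gives [y] and [g] with [N (y + a g (T y))] almost
    maximal, which forces [F y] to have almost modulus [1]; rotating [y] makes
    it a real number [p] near [1]. *)
Let stretch_normalized f z e : contractive f ->
  (forall eta, 0 < eta -> exists2 x, rnorm x <= 1 & 1 - eta < f x) ->
  z != 0 -> 0 < e ->
  exists y g, [/\ rnorm y <= 1, 1 - e < f y & rnorm z + 1 - e <= rnorm (z + a g y)].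
Proof.
move=> cf fsup z0 e0; have zp : 0 < rnorm z by rewrite rnorm_gt0.
have [F FE] := scalar_extension cf.1.
have FN x : real_part `|F x : K| <= rnorm x.
  rewrite -(mul1r (rnorm x)); apply: (scalar_extension_bound FE) => y.
  by rewrite mul1r cf.2.
have lT : linear (fun x : X => (F x : K) *: z).
  move=> c x y; rewrite linearP.
  by rewrite -[c *: F x]/(c * (F x : K)) scalerDl scalerA.
pose T : {linear X -> X} := HB.pack (fun x : X => (F x : K) *: z)
  (GRing.isLinear.Build _ _ _ _ (fun x : X => (F x : K) *: z) lT).
have NT x : rnorm (T x) = real_part `|F x : K| * rnorm z by rewrite rnormMc.
have bT : bounded_near T (nbhs (0 : X)).
  apply: (@rnorm_bounded_near _ _ _ _ T (rnorm z)) => x.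
  by rewrite NT mulrC ler_wpM2l// rnorm_ge0.
have rT : rank_one T.
  exists z => //; apply/seteqP; split => [_ [x _ <-]|_ [c _ <-]].
    by exists (F x : K).
  have [x _ fx] := fsup _ ltr01.
  have Fx0 : (F x : K) != 0.
    apply/eqP => Fx0; move: fx; rewrite subrr -FE Fx0 real_part0 ltxx.
    by [].
  exists ((c / (F x : K)) *: x) => //=.
  by rewrite linearZ /= -[_ *: (F x)]/(_ * (F x : K)) divfK.
have oT : rnorm z <= opnorm T.
  apply/ler_addgt0Pr => eta eta0.
  have [|x x1 fx] := fsup (eta / rnorm z); first exact: divr_gt0.
  have : rnorm (T x) <= opnorm T.
    apply: ub_le_sup; last by exists x.
    exists (rnorm z) => _ [y y1 <-]; rewrite NT ler_piMl ?rnorm_ge0//.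
    exact: le_trans (FN y) y1.
  rewrite NT => h.
  have := real_part_le_norm (F x : K); rewrite FE => h2.
  have h3 : (1 - eta / rnorm z) * rnorm z <= real_part `|F x : K| * rnorm z.
    by rewrite ler_pM2r//; lra.
  move: h3; rewrite mulrBl divfK ?gt_eqF// mul1r; lra.
(* The bound [e * rnorm z] controls [1 - p], and [1 / 2] keeps the lower bounds
   positive, where [sup] is a genuine supremum. *)
pose e' := Num.min (1 / 2) (Num.min (e / 2) (e * rnorm z)).
have e'0 : 0 < e'.
  by rewrite !lt_min; apply/and3P; split; [lra|lra|exact: mulr_gt0].
have e'1 : e' <= 1 / 2 by rewrite ge_min lexx.
have e'2 : e' <= e / 2 by rewrite !ge_min lexx orbT.
have e'3 : e' <= e * rnorm z by rewrite !ge_min lexx !orbT.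
have := hD bT rT => hsup.
have [||_ [g _ <-] hg] := @sup_gt_witness R
  [set opnorm (fun x => x + a g (T x)) | g in [set: G]] (1 + rnorm z - e' / 2).
- lra.
- by rewrite hsup; lra.
have [||_ [y y1 <-] hy] := @sup_gt_witness R
  [set rnorm (y + a g (T y)) | y in unit_ball X] (1 + rnorm z - e').
- lra.
- by move: hg; rewrite /opnorm; lra.
have [d d1 dE] := unimodular_rotation (F y : K).
set p := real_part `|F y : K| in dE *.
have p0 : 0 <= p := real_part_norm_ge0 _.
have p1 : p <= 1 := le_trans (FN y) y1.
have hE : rnorm (y + a g (T y)) = rnorm (a g^-1%g (d *: y) + rscale p z).
  transitivity (rnorm (d *: (y + a g (T y)))); first by rewrite rnormMc d1 mul1r.
  rewrite -[T y]/((F y : K) *: z) actZ scalerDr scalerA dE.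
  by rewrite -[in LHS](rnorm_act g^-1%g) actD /rscale !actZ actVK.
have dy1 : rnorm (d *: y) <= 1 by rewrite rnormMc d1 mul1r.
move: hy; rewrite hE => hy.
have hp : e' >= (1 - p) * rnorm z.
  have := rnormD (a g^-1%g (d *: y)) (rscale p z).
  rewrite rnorm_act rnormZ ger0_norm// => h; lra.
exists (d *: y), g^-1%g; split => //.
  rewrite -FE linearZ /= -[_ *: (F y)]/(d * (F y : K)) dE of_realK.
  have : (1 - p) * rnorm z < e * rnorm z \/ p = 1 \/ e' = e * rnorm z.
    have [->|pn1] := eqVneq p 1; first by right; left.
    have [->|en] := eqVneq e' (e * rnorm z); first by right; right.
    by left; apply: le_lt_trans hp _; rewrite lt_neqAle en.
  have hp2 : rnorm (a g^-1%g (d *: y) + rscale p z) <= 1 + p * rnorm z.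
    apply: (le_trans (rnormD _ _)).
    by rewrite rnorm_act rnormZ ger0_norm// lerD2r.
  have : (1 - p) * rnorm z < e * rnorm z by lra.
  rewrite ltr_pM2r//; lra.
have := rnorm_triangle (- z) (a g^-1%g (d *: y)) (- rscale p z).
rewrite !opprK.
have -> : - z + rscale p z = - rscale (1 - p) z by rewrite rscaleBl rscale1 opprB addrC.
rewrite rnormN rnormZ.
rewrite (@ger0_norm _ (1 - p)); last lra.
rewrite [z + _]addrC; lra.
Qed.

(** The reduction to a functional of norm [1] and [z != 0]: for [z = 0] any
    nonzero vector [u] may replace [z], since a bound close to [rnorm u + 1]
    forces [y] to have almost norm [1]. *)
Lemma stretch_in_slice f M x0 c z e : rlinear f -> (forall x, f x <= M * rnorm x) ->
  rnorm x0 <= 1 -> c < f x0 -> 0 < e ->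
  exists y g, [/\ rnorm y <= 1, c < f y & rnorm z + 1 - e <= rnorm (z + a g y)].
Proof.
move=> lf fM x01 cx0 e0.
wlog z0 : z e e0 / z != 0.
  move=> H; have [->|/H] := eqVneq z 0; last exact.
  have [u u0] := hX; have un : 0 < rnorm u by rewrite rnorm_gt0.
  have [y [g [y1 cy h]]] := H u e e0 u0.
  exists y, g; split => //; rewrite add0r rnorm0 add0r.
  have := rnormD u (a g y); lra.
have zp : 0 < rnorm z by rewrite rnorm_gt0.
pose E := [set f x | x in unit_ball X].
have Eub : ubound E `|M|.
  move=> _ [x x1 <-]; apply: (le_trans (fM x)).
  apply: (@le_trans _ _ (`|M| * rnorm x)).
    by rewrite ler_wpM2r ?rnorm_ge0// ler_norm.
  by rewrite ler_piMr.
have Ehs : has_sup E.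
  by split; [exists (f 0); exists 0; rewrite // /unit_ball /= rnorm0 ler01|exists `|M|].
pose m := sup E.
have fm x : f x <= m * rnorm x.
  have [->|xn0] := eqVneq x 0; first by rewrite rlinear0// rnorm0 mulr0.
  have xp : 0 < rnorm x by rewrite rnorm_gt0.
  rewrite -ler_pdivrMr// mulrC -lf.2; apply: ub_le_sup; first by exists `|M|.
  exists (rscale (rnorm x)^-1 x) => //.
  by rewrite /unit_ball /= rnormZ ger0_norm ?invr_ge0 ?rnorm_ge0// mulVf// gt_eqF.
have m0 : 0 <= m.
  have := fm z; have := fm (- z); rewrite rlinearN// rnormN => h1 h2.
  by rewrite -(pmulr_lge0 _ zp); lra.
have cm : c < m.
  apply: lt_le_trans cx0 _; apply: le_trans (fm x0) _.
  by rewrite ler_piMr.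
have [mE|mn0] := eqVneq m 0.
  have f0 x : f x = 0.
    apply/eqP; rewrite eq_le; have := fm x; rewrite mE mul0r => -> /=.
    by have := fm (- x); rewrite mE mul0r rlinearN// oppr_le0.
  exists (rscale (rnorm z)^-1 z), 1%g; split; rewrite ?f0 -?mE//.
    by rewrite rnormZ ger0_norm ?invr_ge0 ?rnorm_ge0// mulVf// gt_eqF.
  rewrite iso_act1 -{2}(rscale1 z) -rscaleDl rnormZ ger0_norm; last first.
    by rewrite addr_ge0// invr_ge0 rnorm_ge0.
  by rewrite mulrDl mulVf ?gt_eqF// mul1r; lra.
have mp : 0 < m by rewrite lt_neqAle eq_sym mn0.
pose f1 x := m^-1 * f x.
have cf1 : contractive f1.
  split; first by split => [x y|t x]; rewrite /f1 ?lf.1 ?lf.2 ?mulrDr// mulrCA.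
  by move=> x; rewrite /f1 ler_pdivrMl.
have e1 : 0 < Num.min e ((m - c) / m).
  by rewrite lt_min e0 divr_gt0// subr_gt0.
have [|y [g [y1 fy h]]] := @stretch_normalized f1 z _ cf1 _ z0 e1.
  move=> eta eta0; have [|_ [x x1 <-] h] := @sup_adherent _ E (eta * m) _ Ehs.
    exact: mulr_gt0.
  exists x => //; rewrite /f1 ltr_pdivlMl//; move: h; rewrite -/m; lra.
exists y, g; split => //.
  have : 1 - (m - c) / m < f1 y.
    by apply: le_lt_trans fy; rewrite lerD2l lerN2 ge_min lexx orbT.
  by rewrite mulrBl divff// subKr /f1 mulrC ltr_pM2l// invr_gt0.
have : Num.min e ((m - c) / m) <= e by rewrite ge_min lexx.
lra.
Qed.

Lemma alpha_ge0 : 0 <= alpha a.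
Proof.
have [x x0] := hX; have xp : 0 < rnorm x by rewrite rnorm_gt0.
by rewrite -(pmulr_lge0 _ xp) (le_trans _ (alpha_bound 1%g x))// rnorm_ge0.
Qed.

Lemma exists_unit_vector : exists x : X, rnorm x = 1.
Proof.
have [x x0] := hX; exists (rscale (rnorm x)^-1 x).
by rewrite rnormZ ger0_norm ?invr_ge0 ?rnorm_ge0// mulVf// rnorm_eq0.
Qed.

End Action.

(** * The unit ball is not slicely countably determined *)

Section NotSCD.
Context (R : realType) (k : scalar_kind) (X : normedModType (scalars R k)).
Local Notation K := (scalars R k).
Implicit Types (x y : X) (f : X -> R).

Lemma convex_superlevel f c : rlinear f ->
  convex_set ([set x | c <= f x] : set (convex_lmodType X)).
Proof.
move=> lf x y l; rewrite !inE /= => cx cy.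
have l0 : 0 <= l%:inum :> K by [].
have l1 : l%:inum <= 1 :> K by [].
rewrite -[conv l x y]/((l%:inum : K) *: (x : X) + (1 - l%:inum : K) *: (y : X)).
move: l0 l1; set t : K := l%:inum => t0 t1.
move: t1; rewrite (ge0_of_real t0); set s := real_part t.
rewrite -[X in _ <= X](@of_real1 R k) of_real_le => s1.
have s0 : 0 <= s by rewrite -(of_real_le k) of_real0 -ge0_of_real.
rewrite -[X in (X - _) *: _](@of_real1 R k) -of_realB lf.1.
rewrite -[of_real k s *: _]/(rscale s (x : X)) -[of_real k _ *: _]/(rscale (1 - s) (y : X)) !lf.2.
nra.
Qed.

Lemma closure_rnorm (A : set X) x e : closure A x -> 0 < e ->
  exists2 y, A y & rnorm (x - y) < e.
Proof.
move=> Ax e0; have ek : 0 < of_real k e by rewrite -of_real0 of_real_lt.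
have [y [Ay]] := Ax _ (nbhsx_ballx x _ ek).
rewrite -ball_normE /ball_ /= rnormE of_real_lt => h.
by exists y.
Qed.

(** The points [y n] of the slices are chosen so that [- x0] and the translates
    [a (g n) (y n)] have almost additive norms.  A functional norming these
    sums separates [x0] from the [y n], because passing from [a (g n) (y n)] to
    [y n] changes its value by at most [alpha a]. *)
Theorem unit_ball_not_SCD (G : groupType) (a : isometric_action G X) :
  (exists x : X, x != 0) -> G_Daugavet a -> alpha a < 2 -> ~ SCD (unit_ball X).
Proof.
move=> hX hD a2 [S [slS SB]].
have [x0 x01] := exists_unit_vector hX.
pose e := (2 - alpha a) / 4; have e0 : 0 < e by rewrite /e; lra.
have /choice [h hP] : forall nz : nat * X, exists p : X * G,
    [/\ S nz.1 p.1, rnorm p.1 <= 1 &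
        rnorm nz.2 + 1 - e / 2 ^+ nz.1.+1 <= rnorm (nz.2 + a p.2 p.1)].
  move=> [n z] /=; have [[x Sx] [F [c [bF SE]]]] := slS n.
  have [M FM] := bounded_near_rnorm bF.
  have [x1 cx] : unit_ball X x /\ c < real_part (F x : K) by move: Sx; rewrite SE.
  have [||y [g [y1 cy hy]]] := @stretch_in_slice R k X G a hD hX
    (fun x => real_part (F x : K)) M x c z (e / 2 ^+ n.+1)
    (linear_real_part_rlinear F) _ x1 cx.
  - by move=> y; apply: le_trans (real_part_le_norm _) (FM y).
  - by rewrite divr_gt0// exprn_gt0.
  - by exists (y, g); split => //=; rewrite SE.
pose fix w n : X := if n is m.+1 then w m + a (h (m, w m)).2 (h (m, w m)).1 else - x0.
pose z n := if n is m.+1 then w m else 0.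
pose y n := (h (n, w n)).1.
have wS n : w n.+1 - w n = a (h (n, w n)).2 (y n).
  by rewrite [LHS]addrC -[w n.+1]/(w n + _) addKr.
have yP n : [/\ S n (y n), rnorm (y n) <= 1 &
    rnorm (w n) + 1 - e / 2 ^+ n.+1 <= rnorm (w n.+1)] := hP (n, w n).
have wN n : n.+1%:R - e + e / 2 ^+ n <= rnorm (w n).
  elim: n => [|n IH]; first by rewrite /= rnormN x01 expr0; lra.
  have [_ _] := yP n; move: IH; rewrite -[n.+2%:R]natr1 exprS invfM.
  by rewrite mulrCA; lra.
have zS n : rnorm (z n.+1 - z n) <= 1.
  case: n => [|n] /=; first by rewrite subr0 rnormN x01.
  by rewrite wS rnorm_act; have [] := yP n.
have zN n : n%:R - e <= rnorm (z n).
  case: n => [|n] /=; first by rewrite rnorm0; lra.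
  apply: le_trans (wN n); rewrite lerDl divr_ge0 ?exprn_ge0// ltW//.
have [f cf [fz fzS]] := norming_functional (erefl : z 0%N = 0) zS zN (ltW e0).
have fx0 : f x0 <= - 1 + e.
  have := fz 1%N; rewrite /= rlinearN; last by case: cf.
  lra.
have fy n : 1 - e - alpha a <= f (y n).
  have [_ yn1 _] := yP n.
  have := alpha_lower a (h (n, w n)).2 (y n) cf.
  have : 1 - e <= f (w n.+1 - w n) := fzS n.+1.
  rewrite wS.
  have : alpha a * rnorm (y n) <= alpha a by rewrite ler_piMr ?alpha_ge0.
  lra.
have [|||v vB] := closure_rnorm (SB (range y) _ _ x0 _) e0.
- by move=> _ [n _ <-]; have [] := yP n.
- by move=> n; exists (y n); split; [exists n|have [] := yP n].
- by rewrite /unit_ball /= x01.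
have : 1 - e - alpha a <= f v.
  apply: (vB [set x | 1 - e - alpha a <= f x]); split.
    by apply: convex_superlevel; case: cf.
  by move=> _ [n _ <-]; exact: fy.
have := cf.2 (v - x0); rewrite rlinearB; last by case: cf.
rewrite (rnorm_distC v); move: fx0; rewrite /e; lra.
Qed.

End NotSCD.
(** * Approximation by averages of finite lists *)

Section Averages.
Context (R : realType) (k : scalar_kind) (X : normedModType (scalars R k)).
Implicit Types (x y : X) (f p : X -> R) (A : set X) (l : seq X).
Local Notation rscale := (@rscale R k X).

Definition avg l : X := rscale (size l)%:R^-1 (\sum_(y <- l) y).

Lemma rlinear_avg f l c : rlinear f -> l != [::] ->
  {in l, forall y, c <= f y} -> c <= f (avg l).
Proof.
move=> lf l0 lc; have s0 : 0 < (size l)%:R :> R by rewrite ltr0n lt0n size_eq0.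
rewrite /avg lf.2 ler_pdivlMl// rlinear_sum//.
elim: l lc {l0 s0} => [|y l IH] lc; first by rewrite big_nil mul0r.
rewrite big_cons /= -add1n natrD mulrDl mul1r lerD ?lc ?mem_head//.
by apply: IH => z zl; rewrite lc// inE zl orbT.
Qed.

Lemma avg_add_const l x : l != [::] -> avg [seq y + x | y <- l] = avg l + x.
Proof.
move=> l0; rewrite /avg size_map big_map big_split /= rscaleDr; congr (_ + _).
rewrite big_const_seq count_predT iter_addr_0 -rscale_nat rscaleA mulVf ?rscale1//.
by rewrite pnatr_eq0 size_eq0.
Qed.

Lemma avg_rscale l t : avg [seq rscale t y | y <- l] = rscale t (avg l).
Proof. by rewrite /avg size_map big_map -rscale_sumr !rscaleA mulrC. Qed.

Lemma rnorm_avg l c : l != [::] -> {in l, forall y, rnorm y <= c} ->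
  rnorm (avg l) <= c.
Proof.
move=> l0 lc; have s0 : 0 < (size l)%:R :> R by rewrite ltr0n lt0n size_eq0.
rewrite /avg rnormZ gtr0_norm ?invr_gt0// ler_pdivrMl//.
apply: (le_trans (rnorm_sum _ _ _)).
elim: l lc {l0 s0} => [|y l IH] lc; first by rewrite big_nil mul0r.
rewrite big_cons /= -add1n natrD mulrDl mul1r lerD ?lc ?mem_head//.
by apply: IH => z zl; rewrite lc// inE zl orbT.
Qed.

(** Otherwise the cone spanned by the pairs [(x - y, tau)] with [y] in [A] would
    lie below [p] and a functional would separate [x] from [A].  Real weights
    are rounded to multiplicities in a list, so that plain averages suffice;
    equal weights later give subintervals of equal length. *)
Lemma approx_by_averages p A x : sublinear p -> (forall v, p (- v) = p v) ->
  (forall u, rlinear u -> (forall v, u v <= p v) ->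
    forall tau, 0 < tau -> exists2 y, A y & u x - tau < u y) ->
  forall tau, 0 < tau ->
  exists l, [/\ l != [::], {in l, forall y, A y} & p (x - avg l) < tau].
Proof.
move=> sp pN sepA tau tau0; have [p0 pD pZ] := sp; apply: contrapT => noavg.
have pge0 v : 0 <= p v by have := pD v (- v); rewrite subrr p0 pN; lra.
have pZ0 t v : 0 <= t -> p (rscale t v) = t * p v.
  by rewrite le_eqVlt => /predU1P[<-|/pZ->//]; rewrite rscale0 mul0r p0.
have far l : {in l, forall y, A y} ->
    tau * (size l)%:R <= p (\sum_(y <- l) (x - y)).
  move=> lA; have [->|l0] := eqVneq l [::]; first by rewrite big_nil p0 mulr0.
  rewrite leNgt; apply/negP => h; apply: noavg; exists l; split => //.
  have s0 : 0 < (size l)%:R :> R by rewrite ltr0n lt0n size_eq0.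
  suff -> : x - avg l = rscale (size l)%:R^-1 (\sum_(y <- l) (x - y)).
    by rewrite pZ ?invr_gt0// ltr_pdivrMl// mulrC.
  rewrite big_split /= sumrN rscaleBr; congr (_ - _).
  rewrite big_const_seq count_predT iter_addr_0 -rscale_nat rscaleA mulVf ?rscale1//.
  by rewrite gt_eqF.
pose Q (u : X) (s : R) := exists w : seq (R * X),
  [/\ forall v, v \in w -> 0 <= v.1 /\ A v.2,
      u = \sum_(v <- w) rscale v.1 (x - v.2) & s = tau * \sum_(v <- w) v.1].
have cQ : cone Q.
  split.
  - by exists [::]; rewrite !big_nil mulr0.
  - move=> u v s t [w1 [w1A -> ->]] [w2 [w2A -> ->]]; exists (w1 ++ w2).
    rewrite !big_cat mulrDr; split => // v0.
    by rewrite mem_cat => /orP[/w1A|/w2A].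
  - move=> u s t t0 [w [wA -> ->]]; exists [seq (t * v.1, v.2) | v <- w].
    rewrite !big_map rscale_sumr mulrCA mulr_sumr; split => //.
      by move=> _ /mapP[v /wA[v0 Av] ->] /=; rewrite mulr_ge0// ltW.
    by apply: eq_bigr => v _; rewrite rscaleA.
have Qp u s : Q u s -> s <= p u.
  move=> [w [wA -> ->]].
  have key (n : nat) : n%:R * (tau * \sum_(v <- w) v.1) <=
      n%:R * p (\sum_(v <- w) rscale v.1 (x - v.2)) +
      \sum_(v <- w) (tau + p (x - v.2)).
    pose m (v : R * X) := Num.truncn (n%:R * v.1).
    have mP v : v \in w -> (m v)%:R <= n%:R * v.1 < (m v)%:R + 1.
      move=> /wA[v0 _]; rewrite natr1; apply: truncn_itv.
      by rewrite mulr_ge0.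
    pose l := flatten [seq nseq (m v) v.2 | v <- w].
    have lA : {in l, forall y, A y}.
      move=> y /flattenP[_ /mapP[v /wA[_ Av] ->]].
      by rewrite mem_nseq => /andP[_ /eqP ->].
    have lS : \sum_(y <- l) (x - y) = \sum_(v <- w) rscale (m v)%:R (x - v.2).
      rewrite /l big_flatten big_map; apply: eq_bigr => v _.
      by rewrite big_nseq iter_addr_0 rscale_nat.
    have lN : (size l)%:R = \sum_(v <- w) (m v)%:R :> R.
      rewrite size_flatten sumnE !big_map natr_sum.
      by apply: eq_bigr => v _; rewrite size_nseq.
    have := far l lA; rewrite lS lN => h1.
    have h2 : p (\sum_(v <- w) rscale (m v)%:R (x - v.2)) <=
        n%:R * p (\sum_(v <- w) rscale v.1 (x - v.2)) + \sum_(v <- w) p (x - v.2).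
      have -> : \sum_(v <- w) rscale (m v)%:R (x - v.2) =
          rscale n%:R (\sum_(v <- w) rscale v.1 (x - v.2)) +
          \sum_(v <- w) rscale ((m v)%:R - n%:R * v.1) (x - v.2).
        rewrite rscale_sumr -big_split; apply: eq_bigr => v _ /=.
        by rewrite rscaleA -rscaleDl [_ * _ + _]addrC subrK.
      apply: (le_trans (pD _ _)); rewrite pZ0// lerD2l.
      rewrite big_seq [leRHS]big_seq.
      elim/big_ind2 : _ => [|a b c d ab cd|v vw]; first by rewrite p0.
        by rewrite (le_trans (pD _ _))// lerD.
      have /andP[m1 m2] := mP v vw.
      rewrite -pN -rscaleNl opprB pZ0 ?subr_ge0//.
      by rewrite ler_piMl// lerBlDl ltW.
    have h3 : \sum_(v <- w) (n%:R * v.1) <= \sum_(v <- w) ((m v)%:R + 1).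
      rewrite big_seq [leRHS]big_seq; apply: ler_sum => v vw.
      by have /andP[_ /ltW] := mP v vw.
    move: h3; rewrite -mulr_sumr !big_split /= => h3.
    have h4 : tau * (n%:R * \sum_(v <- w) v.1) <=
        tau * (\sum_(v <- w) (m v)%:R + \sum_(v <- w) 1).
      by rewrite ler_pM2l.
    have -> : \sum_(v <- w) tau = tau * \sum_(v <- w) 1.
      by rewrite mulr_sumr; apply: eq_bigr => v _; rewrite mulr1.
    rewrite mulrCA; lra.
  rewrite leNgt; apply/negP => plt.
  set C := \sum_(v <- w) (tau + p (x - v.2)) in key.
  set s' := tau * _ in key plt; set pu := p _ in key plt.
  have spu : 0 < s' - pu by lra.
  have C0 : 0 <= C by apply: sumr_ge0 => v _; rewrite addr_ge0// ltW.
  have /andP[_ h] : _ <= C / (s' - pu) < _ := truncn_itv (divr_ge0 C0 (ltW spu)).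
  have := key (Num.truncn (C / (s' - pu))).+1.
  by move: h; rewrite ltr_pdivrMr//; lra.
have [f [lf fp fQ]] := dominated_extension sp cQ Qp.
have [y Ay h] := sepA f lf fp tau tau0.
have : tau <= f (x - y).
  apply: fQ; exists [:: (1, y)]; rewrite !big_seq1 rscale1 mulr1; split => // v.
  by rewrite inE => /eqP -> /=; rewrite ler01.
by rewrite rlinearB//; lra.
Qed.

Context (G : groupType) (a : isometric_action G X).
Hypothesis hD : G_Daugavet a.
Hypothesis hX : exists x : X, x != 0.

(** No functional can separate [x] from the stretching points, because these
    occur in all slices. *)
Lemma stretched_averages z x e : rnorm x <= 1 -> 0 < e ->
  exists l, [/\ l != [::],
    {in l, forall y, rnorm y <= 1 /\ exists g, rnorm z + 1 - e <= rnorm (z + a g y)} &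
    rnorm (x - avg l) < e].
Proof.
move=> x1 e0; pose A := [set y : X | rnorm y <= 1 /\
  exists g, rnorm z + 1 - e <= rnorm (z + a g y)].
apply: (@approx_by_averages (@rnorm R k X) A x) => //.
- exact: rnorm_sublinear.
- exact: rnormN.
move=> u lu uN tau tau0.
have [||y [g [y1 hy hg]]] := @stretch_in_slice R k X G a hD hX u 1 x (u x - tau) z e lu _ x1 _ e0.
- by move=> v; rewrite mul1r.
- by rewrite ltrBlDr ltrDl.
by exists y => //; split => //; exists g.
Qed.

Hypothesis ha : alpha a < 2.

Definition gap : R := Num.min 1 (2 - alpha a).

Lemma gap_gt0 : 0 < gap.
Proof. by rewrite lt_min ltr01 subr_gt0. Qed.

(** If [a g y] is far from [x], then so is [y], since [a g x] is within
    [alpha a * rnorm x] of [x]. *)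
Lemma far_averages x e : rnorm x <= 1 -> 0 < e ->
  exists l, [/\ l != [::],
    {in l, forall y, rnorm y <= 1 /\ gap - e <= rnorm (y - x)} &
    rnorm (x - avg l) < e].
Proof.
move=> x1 e0; have [l [l0 lP lx]] := stretched_averages (- x) x1 e0.
exists l; split => // y /lP[y1 [g]]; rewrite rnormN [- x + _]addrC => hg.
split => //; rewrite -(rnorm_act a g) actB.
have := rnorm_triangle (a g x) (a g y) x; have := alpha_bound a g x.
have a0 := alpha_ge0 a hX; have x0 := rnorm_ge0 x.
have g1 : gap <= 1 by rewrite ge_min lexx.
have g2 : gap <= 2 - alpha a by rewrite ge_min lexx orbT.
nra.
Qed.

(** Moving all points of the list by the same small error makes the average
    exact, at the price of a slightly larger ball. *)
Lemma far_exact_averages x r e : rnorm x <= r -> 1 <= r -> 0 < e ->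
  exists l, [/\ l != [::],
    {in l, forall y, rnorm y <= r + e /\ gap / 2 <= rnorm (y - x)} & avg l = x].
Proof.
move=> xr r1 e0; have r0 : 0 < r by lra.
have g0 := gap_gt0.
pose e1 := Num.min (e / r) (gap / 4).
have e10 : 0 < e1 by rewrite lt_min divr_gt0//; lra.
have e1e : e1 <= e / r by rewrite ge_min lexx.
have e1g : e1 <= gap / 4 by rewrite ge_min lexx orbT.
have x1 : rnorm (rscale r^-1 x) <= 1.
  by rewrite rnormZ gtr0_norm ?invr_gt0// ler_pdivrMl// mulr1.
have [l [l0 lP lx]] := far_averages x1 e10.
pose d := rscale r^-1 x - avg l.
have xE : x = rscale r (rscale r^-1 x) by rewrite rscaleA divff ?rscale1// gt_eqF.
exists [seq rscale r y | y <- [seq y + d | y <- l]]; split.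
- by rewrite -size_eq0 !size_map size_eq0.
- move=> _ /mapP[_ /mapP[y yl ->] ->]; have [y1 hy] := lP y yl.
  have dE : rnorm d < e1 by [].
  split.
    rewrite rnormZ (gtr0_norm r0); have := rnormD y d.
    have : r * e1 <= r * (e / r) by rewrite ler_pM2l.
    rewrite [r * (e / r)]mulrC divfK ?gt_eqF// => h1 h2.
    have : r * rnorm (y + d) <= r * (1 + e1) by rewrite ler_pM2l//; lra.
    lra.
  rewrite {1}xE -rscaleBr rnormZ (gtr0_norm r0) addrAC.
  have := rnorm_add_ge (y - rscale r^-1 x) d; move=> h.
  have h2 : gap / 2 <= rnorm (y - rscale r^-1 x + d) by lra.
  by apply: (le_trans h2); rewrite ler_peMl// rnorm_ge0.
- by rewrite avg_rscale avg_add_const// /d addrCA subrr addr0 -xE.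
Qed.

End Averages.
(** * Limits in terms of the real-valued norm *)

Section Limits.
Context (R : realType) (k : scalar_kind).

Lemma rnorm_cvgP (X : normedModType (scalars R k)) (u : nat -> X) v :
  u @ \oo --> v <->
  forall e, 0 < e -> exists n, forall l, (n <= l)%N -> rnorm (v - u l) < e.
Proof.
split=> [/cvgrPdist_lt uv e e0|uv].
  have ek : 0 < of_real k e by rewrite -of_real0 of_real_lt.
  have [n _ h] := uv _ ek; exists n => l nl.
  by have := h l nl; rewrite /= rnormE of_real_lt.
apply/cvgrPdist_lt => e e0.
have ep : 0 < real_part e.
  by rewrite -(of_real_lt k) of_real0 -(ge0_of_real (ltW e0)).
have [n h] := uv _ ep; exists n => // l nl /=.
by rewrite rnormE (ge0_of_real (ltW e0)) of_real_lt h.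
Qed.

Lemma rnorm_cauchy_cvg (X : completeNormedModType (scalars R k)) (u : nat -> X) :
  (forall e, 0 < e -> exists n, forall l, (n <= l)%N -> rnorm (u n - u l) < e) ->
  cvgn u.
Proof.
move=> uC; apply/cauchy_cvgP/cauchy_ballP => e e0.
have ep : 0 < real_part e / 2.
  by rewrite divr_gt0// -(of_real_lt k) of_real0 -(ge0_of_real (ltW e0)).
have [n h] := uC _ ep.
near=> x y; rewrite -ball_normE /ball_ /=.
have xn : exists2 l, (n <= l)%N & u l = x.
  by near: x; exists n => // l nl /=; exists l.
have yn : exists2 l, (n <= l)%N & u l = y.
  by near: y; exists n => // l nl /=; exists l.
have [p np <-] := xn; have [q nq <-] := yn.
rewrite rnormE (ge0_of_real (ltW e0)) of_real_lt.
have := rnorm_triangle (u n) (u p) (u q).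
have := h p np; have := h q nq; rewrite (rnorm_distC (u n) (u p)); lra.
Unshelve. all: by end_near. Qed.

Lemma lim_rnorm_le (X : normedModType (scalars R k)) (u : nat -> X) v c :
  u @ \oo --> v -> (exists n, forall l, (n <= l)%N -> rnorm (u l) <= c) ->
  rnorm v <= c.
Proof.
move=> /rnorm_cvgP uv [n0 uc]; apply/ler_addgt0Pr => e e0.
have [n h] := uv e e0; have := h (maxn n0 n) (leq_maxr _ _).
have := uc (maxn n0 n) (leq_maxl _ _); have := rnorm_sub_ge v (u (maxn n0 n)).
lra.
Qed.

Lemma rnorm_cvg_ge (X : normedModType (scalars R k)) (u : nat -> X) v c :
  u @ \oo --> v -> (exists n, forall l, (n <= l)%N -> c <= rnorm (u l)) ->
  c <= rnorm v.
Proof.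
move=> /rnorm_cvgP uv [n0 uc]; apply/ler_addgt0Pr => e e0.
have [n h] := uv e e0; have := h (maxn n0 n) (leq_maxr _ _).
have := uc (maxn n0 n) (leq_maxl _ _).
have := rnorm_sub_ge (u (maxn n0 n)) v; rewrite rnorm_distC.
lra.
Qed.

End Limits.

(** * A bush in the unit ball *)

Lemma sum_ord_mul (V : nmodType) (M m : nat) (F : nat -> V) :
  \sum_(i < M * m) F i = \sum_(q < M) \sum_(r < m) F (q * m + r)%N.
Proof.
rewrite -(big_mkord xpredT F) big_nat_mul big_mkord; apply: eq_bigr => q _.
rewrite -{1}[(q * m)%N]add0n big_addn mulSnr addKn big_mkord.
by apply: eq_bigr => r _; rewrite addnC.
Qed.

Lemma sum_periodic (V : nmodType) (s t : nat) (F : nat -> V) :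
  \sum_(r < t * s) F (r %% s)%N = (\sum_(r < s) F r) *+ t.
Proof.
rewrite (sum_ord_mul t s (fun r => F (r %% s)%N)) -[t in RHS]card_ord -sumr_const.
by apply: eq_bigr => q _; apply: eq_bigr => r _; rewrite modnMDl modn_small.
Qed.

Section Bush.
Context (R : realType) (k : scalar_kind) (X : normedModType (scalars R k)).
Context (G : groupType) (a : isometric_action G X).
Hypothesis hD : G_Daugavet a.
Hypothesis hX : exists x : X, x != 0.
Hypothesis ha : alpha a < 2.

(** The children of [x n q] are the [x n.+1 i] with [i %/ m n = q].  Repeating
    the children of a node makes their number the same for all nodes of a level.
    The error allowed at level [n] is [2^-1 ^+ n.+1], which keeps all nodes in
    the ball of radius [2]. *)
Lemma bush_exists : exists (M m : nat -> nat) (x : nat -> nat -> X),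
  [/\ forall n, (0 < M n)%N, forall n, (0 < m n)%N, forall n, M n.+1 = (M n * m n)%N &
   [/\ forall n q, (q < M n)%N -> rnorm (x n q) <= 2,
       forall n q, (q < M n)%N ->
         \sum_(r < m n) x n.+1 (q * m n + r)%N = x n q *+ m n &
       forall n i, (i < M n.+1)%N -> gap a / 2 <= rnorm (x n.+1 i - x n (i %/ m n)%N)]].
Proof.
pose rad n : R := 2 - 2^-1 ^+ n.
have rad1 n : 1 <= rad n by rewrite /rad; have := exprn_ile1 n (_ : 0 <= 2^-1 :> R) _; lra.
have /choice[c cP] : forall nv : nat * X, exists l : seq X,
    rnorm nv.2 <= rad nv.1 -> [/\ l != [::],
    {in l, forall y, rnorm y <= rad nv.1.+1 /\ gap a / 2 <= rnorm (y - nv.2)} & avg l = nv.2].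
  move=> [n v] /=; have [vn|nvn] := leP (rnorm v) (rad n); last first.
    by exists [::].
  have en : 0 < 2^-1 ^+ n.+1 :> R by rewrite exprn_gt0.
  have [l [l0 lP lv]] := far_exact_averages hD hX ha vn (rad1 n) en.
  exists l => _; split => // y /lP[yn hy]; split => //.
  by apply: (le_trans yn); rewrite /rad exprS; lra.
pose mm n (Mx : nat * (nat -> X)) := (\prod_(q < Mx.1) size (c (n, Mx.2 q)))%N.
pose fix st n : nat * (nat -> X) := if n is n'.+1 then
   ((st n').1 * mm n' (st n'),
    fun i => let l := c (n', (st n').2 (i %/ mm n' (st n')))%N in
      nth 0%R l ((i %% mm n' (st n')) %% size l))%N else (1%N, fun=> 0).
pose M n := (st n).1; pose x n := (st n).2; pose m n := mm n (st n).
have xS n i : x n.+1 i = let l := c (n, x n (i %/ m n)%N) in nth 0 l ((i %% m n) %% size l)%N by [].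
have MS n : M n.+1 = (M n * m n)%N by [].
have inv n : (0 < M n)%N /\ forall q, (q < M n)%N -> rnorm (x n q) <= rad n.
  elim: n => [|n [Mn IH]].
    by split => // q _; rewrite /x /= rnorm0 (le_trans ler01).
  have sc q : (q < M n)%N -> (0 < size (c (n, x n q)))%N.
    by move=> /IH /(cP (n, x n q))[l0 _ _]; rewrite lt0n size_eq0.
  have mn : (0 < m n)%N by rewrite prodn_cond_gt0// => q _; apply: sc.
  split; first by rewrite MS muln_gt0 Mn.
  move=> i; rewrite MS -ltn_divLR// => qM; rewrite xS /=.
  have [l0 lP _] := cP (n, x n (i %/ m n)%N) (IH _ qM).
  have [] // := lP (nth 0 (c (n, x n (i %/ m n)%N)) ((i %% m n) %% size (c (n, x n (i %/ m n)%N)))%N).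
  by rewrite mem_nth// ltn_pmod// sc.
have sc n q : (q < M n)%N -> (0 < size (c (n, x n q)))%N.
  by move=> /(inv n).2 /(cP (n, x n q))[l0 _ _]; rewrite lt0n size_eq0.
have mn n : (0 < m n)%N by rewrite prodn_cond_gt0// => q _; apply: sc.
exists M, m, x; split => //; first by move=> n; case: (inv n).
split.
- move=> n q /(inv n).2 /le_trans; apply.
  by rewrite /rad; have := exprn_ge0 n (_ : 0 <= 2^-1 :> R); lra.
- move=> n q qM; have [l0 _ lx] := cP (n, x n q) ((inv n).2 q qM).
  set l := c (n, x n q) in l0 lx.
  have /dvdnP[t mt] : (size l %| m n)%N.
    by rewrite /m /mm (bigD1 (Ordinal qM))//= dvdn_mulr.
  transitivity (\sum_(0 <= r < m n) nth 0 l (r %% size l)%N).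
    rewrite big_mkord; apply: eq_bigr => r _; rewrite xS /= divnMDl// divn_small ?ltn_ord// addn0.
    by rewrite modnMDl [(r %% m n)%N]modn_small.
  rewrite mt big_mkord (sum_periodic _ _ (fun i => nth 0 l i)) mulnC mulrnA; congr (_ *+ _).
  move: lx; rewrite /avg /= => <-.
  rewrite -rscale_nat rscaleA divff ?pnatr_eq0 ?size_eq0// rscale1.
  by rewrite [RHS](big_nth 0) big_mkord.
- move=> n i; rewrite MS -ltn_divLR// => qM; rewrite xS /=.
  have [l0 lP _] := cP (n, x n (i %/ m n)%N) ((inv n).2 _ qM).
  have [] // := lP (nth 0 (c (n, x n (i %/ m n)%N)) ((i %% m n) %% size (c (n, x n (i %/ m n)%N)))%N).
  by rewrite mem_nth// ltn_pmod// sc.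
Qed.

End Bush.
(** * Finite measures and finite partitions *)

Section FiniteMeasure.
Context (R : realType) (d : measure_display) (S : measurableType d).
Variable mu : {finite_measure set S -> \bar R}.
Implicit Types A B E : set S.

Definition nu E : R := fine (mu E).

Lemma nuE E : measurable E -> mu E = (nu E)%:E.
Proof. by move=> mE; rewrite fineK// fin_num_measure. Qed.

Lemma nu_ge0 E : 0 <= nu E.
Proof. by rewrite fine_ge0// measure_ge0. Qed.

Lemma nu0 : nu set0 = 0.
Proof. by rewrite /nu measure0. Qed.

(** For set functions on a sigma-algebra this is finite additivity. *)
Definition split_additive (V : zmodType) (f : set S -> V) :=
  forall A B, measurable A -> measurable B -> f A = f (A `\` B) + f (A `&` B).

Lemma nu_split : split_additive nu.
Proof.
move=> A B mA mB; rewrite /nu (measureDI _ mA mB) fineD//.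
  by rewrite fin_num_measure//; exact: measurableD.
by rewrite fin_num_measure//; exact: measurableI.
Qed.

Lemma split_additive0 (V : zmodType) (f : set S -> V) : split_additive f -> f set0 = 0.
Proof.
by move=> /(_ set0 set0 measurable0 measurable0); rewrite setD0 setI0 => /eqP;
  rewrite addrC -subr_eq subrr eq_sym => /eqP.
Qed.

Lemma split_additiveU (V : zmodType) (f : set S -> V) A B : split_additive f ->
  measurable A -> measurable B -> A `&` B = set0 -> f (A `|` B) = f A + f B.
Proof.
move=> fA mA mB AB; rewrite (fA _ B)//; last exact: measurableU.
congr (f _ + f _).
  by rewrite setDUl setDv setU0; apply/setDidPl.
by rewrite setIUl AB set0U setIid.
Qed.

Lemma split_additive_fibers (V : zmodType) (f : set S -> V) (T : choiceType)
    (s : S -> T) (r : seq T) E :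
  split_additive f -> measurable E ->
  {in r, forall v, measurable (s @^-1` [set v])} -> uniq r ->
  (forall t, E t -> s t \in r) ->
  f E = \sum_(v <- r) f (E `&` s @^-1` [set v]).
Proof.
move=> fA; elim: r E => [|v r IH] E mE mr /= ur Er.
  rewrite big_nil; have -> : E = set0; last exact: split_additive0.
  by apply/seteqP; split => // t /Er.
have /andP[vr {}ur] := ur.
have mv : measurable (s @^-1` [set v]) by apply: mr; rewrite mem_head.
rewrite big_cons (fA _ _ mE mv) addrC; congr (_ + _).
rewrite (IH (E `\` s @^-1` [set v]))//.
- apply: eq_big_seq => w wr; congr f; apply/seteqP; split => t [/=].
    by move=> [].
  by move=> Et sw; do 2 split => //; move=> sv; move: vr; rewrite -sv sw wr.
- exact: measurableD.
- by move=> w wr; apply: mr; rewrite inE wr orbT.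
- by move=> t [/Er]; rewrite inE => /predU1P[sv /(_ sv)|].
Qed.

Lemma nu_le A B : measurable A -> measurable B -> A `<=` B -> nu A <= nu B.
Proof.
move=> mA mB AB; rewrite (nu_split mB mA) setIidr// lerDr; exact: nu_ge0.
Qed.

Lemma nu_leU A B : measurable A -> measurable B -> nu (A `|` B) <= nu A + nu B.
Proof.
move=> mA mB; rewrite (nu_split (measurableU _ _ mA mB) mB) lerD//.
  apply: nu_le => //; first by apply: measurableD => //; exact: measurableU.
  by move=> t [[]].
by apply: nu_le => //; apply: measurableI => //; exact: measurableU.
Qed.

Lemma nu_tail (A : nat -> set S) e : (forall i, measurable (A i)) -> 0 < e ->
  exists n, forall l, (n <= l)%N ->
    nu (\bigcup_i A i `\` \big[setU/set0]_(i < l) A i) < e.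
Proof.
move=> mA e0; pose B l := \big[setU/set0]_(i < l) A i.
have mB l : measurable (B l) by apply: bigsetU_measurable.
have mU : measurable (\bigcup_i A i) by exact: bigcup_measurable.
have BU : \bigcup_l B l = \bigcup_i A i.
  apply/seteqP; split => t.
    by move=> [l _]; rewrite /B -bigcup_mkord => -[i _ Ait]; exists i.
  by move=> [i _ Ait]; exists i.+1 => //; rewrite /B big_ord_recr; right.
have hc : (mu \o B) x @[x --> \oo] --> mu (\bigcup_i A i).
  rewrite -BU; apply: nondecreasing_cvg_mu => //; first by rewrite BU.
  by apply/nondecreasing_seqP => n; apply/subsetPset; rewrite /B big_ord_recr; left.
have := hc; rewrite (nuE mU) => /fine_cvg /= /cvgrPdist_lt/(_ e e0)[n _ h].
exists n => l nl; have := h l nl; rewrite /= -/(nu _).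
have : nu (B l) <= nu (\bigcup_i A i).
  by apply: nu_le => //; rewrite -BU; exact: bigcup_sup.
rewrite (nu_split mU (mB l)) setIidr; last by rewrite -BU; exact: bigcup_sup.
move=> h1; rewrite addrK ger0_norm//; exact: nu_ge0.
Qed.

End FiniteMeasure.

(** * Bochner integrals *)

Section Bochner.
Context (R : realType) (k : scalar_kind) (X : normedModType (scalars R k)).
Context (d : measure_display) (S : measurableType d).
Variable mu : {finite_measure set S -> \bar R}.
Local Notation nu := (nu mu).
Implicit Types (s : S -> X) (E : set S) (v w : X).

Definition values s : seq X := finmap.enum_fset (fset_set (range s)).

Lemma mem_values s t : simple_function s -> s t \in values s.
Proof.
by move=> [fs _]; rewrite /values in_fset_set// inE; exists t.
Qed.

Lemma simple_integralE s E : simple_function s ->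
  simple_integral mu s E = \sum_(v <- values s) rscale (nu (E `&` s @^-1` [set v])) v.
Proof. by move=> [fs _]; rewrite /simple_integral fsbig_finite. Qed.

Lemma simple_fiber_measurable s v : simple_function s -> measurable (s @^-1` [set v]).
Proof. by case. Qed.

Let cell s s' v w := s @^-1` [set v] `&` s' @^-1` [set w].

Let mcell s s' v w : simple_function s -> simple_function s' -> measurable (cell s s' v w).
Proof. by move=> ss ss'; apply: measurableI; apply: simple_fiber_measurable. Qed.

Lemma sum_pred1 (V : zmodType) (T : eqType) (r : seq T) a (F : T -> V) :
  uniq r -> a \in r -> \sum_(v <- r) (if a == v then F v else 0) = F a.
Proof.
move=> ur ar; rewrite (bigD1_seq a)//= eqxx big1 ?addr0// => v va.
by rewrite eq_sym (negbTE va).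
Qed.

Lemma simple_distE s s' t : simple_function s -> simple_function s' ->
  rnorm (s t - s' t) = \sum_(v <- values s) \sum_(w <- values s')
    rnorm (v - w) * \1_(cell s s' v w) t.
Proof.
move=> ss ss'.
under eq_bigr => v _.
  under eq_bigr => w _.
    have -> : rnorm (v - w) * \1_(cell s s' v w) t =
      (if s' t == w then (if s t == v then rnorm (v - w) else 0) else 0).
      rewrite indicE; case: eqP => [e'|ne']; first case: eqP => [e|ne].
      - by rewrite mem_set ?mulr1.
      - by rewrite memNset ?mulr0// => -[].
      - by rewrite memNset ?mulr0// => -[].
    over.
  rewrite (sum_pred1 (fun w => if s t == v then rnorm (v - w) else 0)) ?finmap.fset_uniq ?mem_values//.
  over.
by rewrite (sum_pred1 (fun v => rnorm (v - s' t))) ?finmap.fset_uniq ?mem_values.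
Qed.

Lemma measurable_simple_dist s s' : simple_function s -> simple_function s' ->
  measurable_fun setT (fun t => rnorm (s t - s' t)).
Proof.
move=> ss ss'; under eq_fun do rewrite simple_distE//.
apply: measurable_sum => v; apply: measurable_sum => w.
by apply: measurable_funM => //; apply: measurable_indic; exact: mcell.
Qed.

Lemma simple_integral_dist s s' E : simple_function s -> simple_function s' ->
  measurable E ->
  ((rnorm (simple_integral mu s E - simple_integral mu s' E))%:E <=
   \int[mu]_(t in E) (rnorm (s t - s' t))%:E)%E.
Proof.
move=> ss ss' mE.
have -> : (\int[mu]_(t in E) (rnorm (s t - s' t))%:E)%E =
    (\sum_(v <- values s) \sum_(w <- values s')
      rnorm (v - w) * nu (E `&` cell s s' v w))%:E.
  under eq_integral do rewrite simple_distE// -sumEFin.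
  rewrite ge0_integral_sum//; last 2 first.
  - move=> v; apply/measurable_EFinP; apply: measurable_sum => w.
    apply: measurable_funM => //; apply: (measurable_funS measurableT) => //.
    by apply: measurable_indic; exact: mcell.
  - by move=> v t _; rewrite lee_fin sumr_ge0// => w _; rewrite mulr_ge0 ?rnorm_ge0.
  rewrite -sumEFin; apply: eq_bigr => v _.
  under eq_integral do rewrite -sumEFin.
  have m1 w : measurable_fun E (fun t => (\1_(cell s s' v w) t)%:E : \bar R).
    apply/measurable_EFinP; apply: (measurable_funS measurableT) => //.
    by apply: measurable_indic; exact: mcell.
  rewrite ge0_integral_sum//; last 2 first.
  - move=> w; under eq_fun do rewrite EFinM.
    by apply: emeasurable_funM.
  - by move=> w t _; rewrite lee_fin mulr_ge0 ?rnorm_ge0.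
  rewrite -sumEFin; apply: eq_bigr => w _.
  under eq_integral do rewrite EFinM.
  rewrite ge0_integralZl//; last by rewrite lee_fin rnorm_ge0.
  rewrite integral_indic//; last exact: mcell.
  by rewrite setIC EFinM -nuE//; apply: measurableI => //; exact: mcell.
rewrite lee_fin.
have -> : simple_integral mu s E = \sum_(v <- values s) \sum_(w <- values s')
    rscale (nu (E `&` cell s s' v w)) v.
  rewrite simple_integralE//; apply: eq_bigr => v _.
  rewrite -rscale_suml; congr rscale.
  rewrite (split_additive_fibers (s := s') (r := values s') (@nu_split R d S mu)).
  - by apply: eq_bigr => w _; rewrite setIA.
  - by apply: measurableI => //; exact: simple_fiber_measurable.
  - by move=> w _; exact: simple_fiber_measurable.
  - exact: finmap.fset_uniq.
  - by move=> t _; exact: mem_values.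
have -> : simple_integral mu s' E = \sum_(v <- values s) \sum_(w <- values s')
    rscale (nu (E `&` cell s s' v w)) w.
  rewrite simple_integralE// exchange_big /=; apply: eq_bigr => w _.
  rewrite -rscale_suml; congr rscale.
  rewrite (split_additive_fibers (s := s) (r := values s) (@nu_split R d S mu)).
  - by apply: eq_bigr => v _; rewrite -setIA [s' @^-1` _ `&` _]setIC.
  - by apply: measurableI => //; exact: simple_fiber_measurable.
  - by move=> w' _; exact: simple_fiber_measurable.
  - exact: finmap.fset_uniq.
  - by move=> t _; exact: mem_values.
rewrite -sumrB; apply: (le_trans (rnorm_sum _ _ _)); apply: ler_sum => v _.
rewrite -sumrB; apply: (le_trans (rnorm_sum _ _ _)); apply: ler_sum => w _.
by rewrite -rscaleBr rnormZ ger0_norm ?nu_ge0// mulrC.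
Qed.

Section Approximation.
Variables (f : S -> X) (N : set S) (s_ : nat -> S -> X).
Hypotheses (mN : measurable N) (N0 : mu N = 0%E).
Hypothesis ss_ : forall n, simple_function (s_ n).
Hypothesis s_f : forall t, ~ N t -> s_ ^~ t @ \oo --> f t.

(** Setting the distance from [f] to [s] to zero on the null set where the
    approximations of [f] fail to converge makes it measurable, and it only
    decreases the integral. *)
Definition off_null_dist s t : R := rnorm (f t - s t) * \1_(~` N) t.

Lemma off_null_dist_ge0 s t : 0 <= off_null_dist s t.
Proof. by rewrite mulr_ge0// rnorm_ge0. Qed.

Lemma measurable_off_null_dist s : simple_function s ->
  measurable_fun setT (off_null_dist s).
Proof.
move=> ss.
apply: (@measurable_fun_cvg _ _ _ _ (fun n t => rnorm (s_ n t - s t) * \1_(~` N) t)).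
  move=> n; apply: measurable_funM; first exact: measurable_simple_dist.
  by apply: measurable_indic; exact: measurableC.
move=> t _; rewrite /off_null_dist indicE.
have [tN|tN] := pselect (N t).
  by rewrite memNset ?mulr0; [under eq_fun do rewrite mulr0; exact: cvg_cst|case].
rewrite mem_set//; apply/cvgrPdist_lt => e e0.
have /rnorm_cvgP/(_ e e0)[n hn] := s_f tN.
exists n => // l nl /=; rewrite !mulr1.
have := hn l nl; have := rnorm_sub_ge (f t - s t) (s_ l t - s t).
have := rnorm_sub_ge (s_ l t - s t) (f t - s t).
rewrite !opprB !addrA !subrK (rnorm_distC (s_ l t) (f t)) => h1 h2 h3.
by rewrite ltr_norml; apply/andP; split; lra.
Qed.

Lemma integral_off_null_dist s :
  (\int[mu]_t (off_null_dist s t)%:E <= \int[mu]_t (rnorm (f t - s t))%:E)%E.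
Proof.
rewrite !ge0_integralTE//; last 2 first.
- by move=> t; rewrite lee_fin rnorm_ge0.
- by move=> t; rewrite lee_fin off_null_dist_ge0.
apply: le_ereal_sup => _ [g gf <-]; exists g => // t.
apply: (le_trans (gf t)); rewrite lee_fin /off_null_dist indicE.
by case: (t \in _); rewrite ?mulr1// mulr0 rnorm_ge0.
Qed.

(** The integral of [f] over [E] is a limit of integrals of simple functions [s' n],
    which may depend on [E]; their distance to [s] is at most the distance of
    [s' n] to [f], which tends to zero in mean, plus that of [f] to [s]. *)
Lemma bochner_integral_dist s E v : simple_function s -> measurable E ->
  is_bochner_integral mu f E v ->
  ((rnorm (v - simple_integral mu s E))%:E <= \int[mu]_(t in E) (off_null_dist s t)%:E)%E.
Proof.
move=> ss mE [s' [ss' _ /fine_cvgP[fin0 s'f]]] /rnorm_cvgP s'v.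
apply/lee_addgt0Pr => e e0; have e20 : 0 < e / 2 by lra.
have [n1 h1] := s'v _ e20.
have [n2 _ h2] := fin0.
have /cvgrPdist_lt/(_ _ e20)[n3 _ h3] := s'f.
pose n := maxn n1 (maxn n2 n3).
have {}h1 := h1 n (leq_maxl _ _).
have {}h2 := h2 n (leq_trans (leq_maxl _ _) (leq_maxr _ _)).
have {}h3 := h3 n (leq_trans (leq_maxr _ _) (leq_maxr _ _)).
rewrite /= sub0r normrN in h3; have {}h3 := le_lt_trans (ler_norm _) h3.
have {h2}h3 : (\int[mu]_t (rnorm (f t - s' n t))%:E < (e / 2)%:E)%E.
  by rewrite -(fineK h2) lte_fin.
have me s0 : simple_function s0 -> measurable_fun E (fun t => (off_null_dist s0 t)%:E).
  move=> ss0; apply/measurable_EFinP; apply: (measurable_funS measurableT) => //.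
  exact: measurable_off_null_dist.
have key : ((rnorm (simple_integral mu (s' n) E - simple_integral mu s E))%:E <=
    \int[mu]_(t in E) (off_null_dist (s' n) t)%:E +
    \int[mu]_(t in E) (off_null_dist s t)%:E)%E.
  apply: (le_trans (simple_integral_dist (ss' n) ss mE)).
  rewrite -ge0_integralD//; last 4 first.
  - by move=> t _; rewrite lee_fin off_null_dist_ge0.
  - exact: me.
  - by move=> t _; rewrite lee_fin off_null_dist_ge0.
  - exact: me.
  apply: ae_ge0_le_integral => //.
  - by move=> t _; rewrite lee_fin rnorm_ge0.
  - apply/measurable_EFinP; apply: (measurable_funS measurableT) => //.
    exact: measurable_simple_dist.
  - by move=> t _; rewrite -EFinD lee_fin addr_ge0// off_null_dist_ge0.
  - by apply: emeasurable_funD; exact: me.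
  exists N; split => // t /=; apply: contra_notP => Nt _.
  rewrite -EFinD lee_fin /off_null_dist indicE mem_set// !mulr1.
  have := rnorm_triangle (f t) (s' n t) (s t).
  by rewrite (rnorm_distC (s' n t) (f t)).
have h4 : (\int[mu]_(t in E) (off_null_dist (s' n) t)%:E <= (e / 2)%:E)%E.
  apply: le_trans (ltW h3); apply: le_trans (integral_off_null_dist (s' n)).
  apply: ge0_subset_integral => //.
  - by apply/measurable_EFinP; exact: measurable_off_null_dist.
  - by move=> t _; rewrite lee_fin off_null_dist_ge0.
apply: (@le_trans _ _ ((e / 2)%:E + (rnorm (simple_integral mu (s' n) E - simple_integral mu s E))%:E)%E).
  by rewrite -EFinD lee_fin; have := rnorm_triangle (simple_integral mu (s' n) E) v (simple_integral mu s E); lra.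
apply: (@le_trans _ _ ((e / 2)%:E + ((e / 2)%:E + \int[mu]_(t in E) (off_null_dist s t)%:E))%E).
  by apply: leeD2l; apply: (le_trans key); exact: leeD2r.
by rewrite addeA -EFinD addeC; have -> : e / 2 + e / 2 = e by lra.
Qed.


End Approximation.
End Bochner.
(** * A martingale on nested partitions and its vector measure *)

Section Martingale.
Context (R : realType) (k : scalar_kind) (X : completeNormedModType (scalars R k)).
Context (d : measure_display) (S : measurableType d).
Variable mu : {finite_measure set S -> \bar R}.
Variables (M m : nat -> nat) (x : nat -> nat -> X) (idx : nat -> S -> nat).
Hypotheses (M0 : forall n, (0 < M n)%N) (m0 : forall n, (0 < m n)%N).
Hypothesis MS : forall n, M n.+1 = (M n * m n)%N.
Hypothesis x2 : forall n q, (q < M n)%N -> rnorm (x n q) <= 2.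
Hypothesis xS : forall n q, (q < M n)%N ->
  \sum_(r < m n) x n.+1 (q * m n + r)%N = x n q *+ m n.
Hypothesis idx_lt : forall n t, (idx n t < M n)%N.
Hypothesis idxS : forall n t, idx n t = (idx n.+1 t %/ m n)%N.

Definition piece n i : set S := idx n @^-1` [set i].

Hypothesis mpiece : forall n i, measurable (piece n i).
Hypothesis nu_piece : forall n i, (i < M n)%N -> nu mu (piece n i) = (M n)%:R^-1.
Hypothesis mgen : forall E : set S, measurable E ->
  <<s [set A | exists n i, A = piece n i] >> E.

Local Notation nu := (nu mu).
Implicit Types A B E : set S.

Let mI E n i : measurable E -> measurable (E `&` piece n i).
Proof. by move=> mE; exact: measurableI. Qed.

Let mD E n i : measurable E -> measurable (piece n i `\` E).
Proof. by move=> mE; exact: measurableD. Qed.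

Lemma split_additive_pieces (V : zmodType) (f : set S -> V) n E :
  split_additive f -> measurable E -> f E = \sum_(i < M n) f (E `&` piece n i).
Proof.
move=> fA mE; rewrite -(big_mkord xpredT (fun i => f (E `&` piece n i))).
rewrite (split_additive_fibers (s := idx n) (r := index_iota 0 (M n)) fA mE)//.
- by move=> i _; exact: mpiece.
- exact: iota_uniq.
- by move=> t _; rewrite mem_index_iota /= idx_lt.
Qed.

Lemma split_additive_subpieces (V : zmodType) (f : set S -> V) n q E :
  split_additive f -> measurable E ->
  f (E `&` piece n q) = \sum_(r < m n) f (E `&` piece n.+1 (q * m n + r)).
Proof.
move=> fA mE.
rewrite (split_additive_fibers (s := idx n.+1)
  (r := [seq (q * m n + r)%N | r <- index_iota 0 (m n)]) fA (mI n q mE)).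
- rewrite big_map big_mkord.
  apply: eq_bigr => r _; congr f; apply/seteqP; split => t /=.
    by move=> [[Et _] tr]; split.
  move=> [Et tr]; split; last exact: tr; split => //.
  by rewrite /piece /= idxS tr divnMDl// divn_small// addn0.
- by move=> i _; exact: mpiece.
- by rewrite map_inj_uniq ?iota_uniq// => i j /addnI.
- move=> t [_]; rewrite /piece /= idxS => <-; apply/mapP.
  exists (idx n.+1 t %% m n)%N; last exact: divn_eq.
  by rewrite mem_index_iota /= ltn_pmod.
Qed.

(** The distance from [E] to the nearest union of pieces of level [n]: a piece is
    taken or left according to whether more of it lies in or outside [E]. *)
Definition osc n E : R :=
  \sum_(i < M n) Num.min (nu (E `&` piece n i)) (nu (piece n i `\` E)).

Lemma osc_ge0 n E : 0 <= osc n E.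
Proof. by apply: sumr_ge0 => i _; rewrite le_min !nu_ge0. Qed.

Lemma oscC n E : osc n (~` E) = osc n E.
Proof.
apply: eq_bigr => i _; rewrite setDE setCK minC; congr (Num.min (nu _) (nu _)).
  exact: setIC.
by rewrite setDE setIC.
Qed.

Lemma oscU n A B : measurable A -> measurable B ->
  osc n (A `|` B) <= osc n A + osc n B.
Proof.
move=> mA mB; rewrite -big_split /=; apply: ler_sum => i _.
have h1 : nu ((A `|` B) `&` piece n i) <= nu (A `&` piece n i) + nu (B `&` piece n i).
  by rewrite setIUl nu_leU//; exact: mI.
have h2 : nu (piece n i `\` (A `|` B)) <= nu (piece n i `\` A).
  apply: nu_le; [by apply: mD; exact: measurableU|exact: mD|].
  by apply: setDS; exact: subsetUl.
have h3 : nu (piece n i `\` (A `|` B)) <= nu (piece n i `\` B).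
  apply: nu_le; [by apply: mD; exact: measurableU|exact: mD|].
  by apply: setDS; exact: subsetUr.
have := nu_ge0 mu (A `&` piece n i); have := nu_ge0 mu (B `&` piece n i).
have := nu_ge0 mu (piece n i `\` A); have := nu_ge0 mu (piece n i `\` B).
by move=> cB cA b0 a0; rewrite !minEle; do 3 (case: ifPn; rewrite -?ltNge => ?); lra.
Qed.

Lemma osc_le n E : measurable E -> osc n E <= nu E.
Proof.
move=> mE; rewrite (split_additive_pieces n (@nu_split R d S mu) mE).
by apply: ler_sum => i _; rewrite ge_min lexx.
Qed.

Lemma oscS_le n E : measurable E -> osc n.+1 E <= osc n E.
Proof.
move=> mE; rewrite /osc MS.
rewrite (sum_ord_mul _ _ (fun i => Num.min (nu (E `&` piece n.+1 i)) (nu (piece n.+1 i `\` E)))).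
apply: ler_sum => q _; rewrite le_min; apply/andP; split.
  rewrite (split_additive_subpieces n q (@nu_split R d S mu) mE).
  by apply: ler_sum => r _; rewrite ge_min lexx.
rewrite setDE setIC (split_additive_subpieces n q (@nu_split R d S mu) (measurableC mE)).
by apply: ler_sum => r _; rewrite ge_min setDE [_ `&` ~` E]setIC lexx orbT.
Qed.

Lemma osc_le_level n l E : measurable E -> (n <= l)%N -> osc l E <= osc n E.
Proof.
move=> mE; elim: l => [|l IH]; first by rewrite leqn0 => /eqP ->.
rewrite leq_eqVlt => /predU1P[->//|]; rewrite ltnS => /IH.
exact: le_trans (oscS_le _ mE).
Qed.

Lemma osc_piece n i : osc n (piece n i) = 0.
Proof.
apply: big1 => j _; have [->|ij] := eqVneq (j : nat) i.
  by rewrite setDv nu0; apply/min_idPr; exact: nu_ge0.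
have -> : piece n i `&` piece n j = set0.
  apply/seteqP; split => // t [/= ti tj]; move: ij.
  by rewrite -ti -tj eqxx.
by rewrite nu0; apply/min_idPl; exact: nu_ge0.
Qed.

(** The sets that are almost unions of pieces form a sigma-algebra: [osc] is
    invariant under complements, subadditive, and at most the measure. *)
Lemma osc_small E e : measurable E -> 0 < e -> exists n, osc n E < e.
Proof.
move=> mE; move: (mgen mE) e.
pose good E := measurable E /\ forall e, 0 < e -> exists n, osc n E < e.
suff : <<s [set A | exists n i, A = piece n i] >> `<=` good.
  by move=> sub /sub[].
apply: smallest_sub; last first.
  move=> _ [n [i ->]]; split => // e e0; exists n.
  by rewrite osc_piece.
split.
- split => // e e0; exists 0%N; apply: le_lt_trans e0.
  by apply: (le_trans (osc_le 0 measurable0)); rewrite nu0.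
- move=> A [mA hA]; rewrite setTD; split; first exact: measurableC.
  by move=> e /hA[n h]; exists n; rewrite oscC.
- move=> A gA; have mA i : measurable (A i) by case: (gA i).
  have mU : measurable (\bigcup_i A i) by exact: bigcup_measurable.
  split => // e e0; have e20 : 0 < e / 2 by lra.
  have [l hl] := nu_tail mu mA e20.
  have {}hl := hl l (leqnn l).
  set B := \big[setU/set0]_(i < l) A i in hl.
  have mB : measurable B by exact: bigsetU_measurable.
  have [n hn] : exists n, osc n B < e / 2.
    rewrite /B; elim: l (e / 2) e20 {hl B mB} => [|l IH] f f0.
      exists 0%N; rewrite big_ord0; apply: le_lt_trans f0.
      by apply: (le_trans (osc_le 0 measurable0)); rewrite nu0.
    have f20 : 0 < f / 2 by lra.
    have [n1 h1] := IH _ f20; have [n2 h2] := (gA l).2 _ f20.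
    exists (maxn n1 n2); rewrite big_ord_recr /=.
    have mB : measurable (\big[setU/set0]_(i < l) A i) by exact: bigsetU_measurable.
    apply: (le_lt_trans (oscU _ mB (mA l))).
    have := osc_le_level mB (leq_maxl n1 n2).
    have := osc_le_level (mA l) (leq_maxr n1 n2); lra.
  exists n; have BU : B `<=` \bigcup_i A i.
    by rewrite /B -bigcup_mkord; apply: bigcup_subset.
  have -> : \bigcup_i A i = B `|` (\bigcup_i A i `\` B) by rewrite setDUK.
  have mBD : measurable (\bigcup_i A i `\` B) by exact: measurableD.
  apply: (le_lt_trans (oscU _ mB mBD)); have := osc_le n mBD; lra.
Qed.

(** ** Partial integrals of the martingale *)

Definition partial_integral n E : X :=
  \sum_(i < M n) rscale (nu (E `&` piece n i)) (x n i).

Lemma partial_integral_split n : split_additive (partial_integral n).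
Proof.
move=> A B mA mB; rewrite -big_split /=; apply: eq_bigr => i _.
rewrite -rscaleDl; congr rscale.
rewrite (nu_split mu (mI n i mA) mB); congr (nu _ + nu _).
  by rewrite !setDE setIAC.
by rewrite setIAC.
Qed.

Lemma partial_integral_le n E : measurable E -> rnorm (partial_integral n E) <= 2 * nu E.
Proof.
move=> mE; rewrite (split_additive_pieces n (@nu_split R d S mu) mE) mulr_sumr.
apply: (le_trans (rnorm_sum _ _ _)); apply: ler_sum => i _.
by rewrite rnormZ ger0_norm ?nu_ge0// mulrC ler_wpM2r ?nu_ge0// x2.
Qed.

Lemma same_piece n l t t' : (n <= l)%N -> idx l t = idx l t' -> idx n t = idx n t'.
Proof.
elim: l => [|l IH]; first by rewrite leqn0 => /eqP ->.
rewrite leq_eqVlt => /predU1P[->//|]; rewrite ltnS => nl e.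
by apply: IH => //; rewrite (idxS l t) (idxS l t') e.
Qed.

Lemma partial_integral_piece_same n q : (q < M n)%N ->
  partial_integral n (piece n q) = rscale (nu (piece n q)) (x n q).
Proof.
move=> qM; rewrite /partial_integral (bigD1 (Ordinal qM))//= setIid big1 ?addr0//.
move=> j; rewrite -val_eqE /= => jq.
have -> : piece n q `&` piece n j = set0; last by rewrite nu0 rscale0.
by apply/seteqP; split => // t [/= tq tj]; move: jq; rewrite -tq -tj eqxx.
Qed.

Lemma partial_integral_piece n l q : (q < M n)%N -> (n <= l)%N ->
  partial_integral l (piece n q) = rscale (nu (piece n q)) (x n q).
Proof.
move=> qM; elim: l => [|l IH].
  rewrite leqn0 => /eqP n0; subst n; exact: partial_integral_piece_same.
rewrite leq_eqVlt => /predU1P[<-|]; first exact: partial_integral_piece_same.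
rewrite ltnS => nl; rewrite -(IH nl) /partial_integral MS.
rewrite (sum_ord_mul _ _ (fun i => rscale (nu (piece n q `&` piece l.+1 i)) (x l.+1 i))).
apply: eq_bigr => j _.
have sub r : (r < m l)%N -> piece l.+1 (j * m l + r) `<=` piece l j.
  by move=> rm t; rewrite /piece /= (idxS l t) => ->; rewrite divnMDl// divn_small// addn0.
have jrM r : (r < m l)%N -> (j * m l + r < M l.+1)%N.
  move=> rm; rewrite MS; apply: leq_trans (_ : j.+1 * m l <= _)%N.
    by rewrite mulSnr ltn_add2l.
  by rewrite leq_mul2r ltn_ord orbT.
have h r : (r < m l)%N -> nu (piece n q `&` piece l.+1 (j * m l + r)) =
    nu (piece n q `&` piece l j) / (m l)%:R.
  move=> rm; have [[t [tq tj]]|no] := pselect (exists t, piece n q t /\ piece l j t).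
    have jq : piece l j `<=` piece n q.
      by move=> t' t'j; rewrite /piece /= -tq; apply: (same_piece nl); rewrite t'j tj.
    rewrite (setIidr jq) setIidr; last exact: subset_trans (sub r rm) jq.
    by rewrite !nu_piece ?jrM// MS natrM invfM.
  have -> : piece n q `&` piece l j = set0.
    by apply/seteqP; split => // t [tq tj]; apply: no; exists t.
  have -> : piece n q `&` piece l.+1 (j * m l + r) = set0.
    by apply/seteqP; split => // t [tq /(sub r rm) tj]; apply: no; exists t.
  by rewrite nu0 mul0r.
under eq_bigr do rewrite h//.
rewrite -rscale_sumr xS// -rscale_nat rscaleA divfK// pnatr_eq0 -lt0n//.
Qed.

(** On a piece the two integrals differ by at most four times the measure of the
    part inside [E].  They agree for the whole piece, so complementing gives the
    same bound for the part outside [E]. *)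
Lemma partial_integral_cauchy n l E : measurable E -> (n <= l)%N ->
  rnorm (partial_integral n E - partial_integral l E) <= 4 * osc n E.
Proof.
move=> mE nl; rewrite (split_additive_pieces n (@partial_integral_split l) mE).
rewrite -sumrB mulr_sumr; apply: (le_trans (rnorm_sum _ _ _)).
apply: ler_sum => q _.
have bd A : measurable A -> A `<=` piece n q ->
    rnorm (rscale (nu A) (x n q) - partial_integral l A) <= 4 * nu A.
  move=> mA _; apply: (le_trans (rnormB _ _)).
  have := partial_integral_le l mA; rewrite rnormZ ger0_norm ?nu_ge0// => h.
  have : nu A * rnorm (x n q) <= nu A * 2 by rewrite ler_wpM2l ?nu_ge0// x2.
  lra.
rewrite minr_pMr// le_min; apply/andP; split.
  by apply: bd; [exact: mI|exact: subIsetr].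
have mq := mpiece n q.
have -> : rscale (nu (E `&` piece n q)) (x n q) - partial_integral l (E `&` piece n q) =
    - (rscale (nu (piece n q `\` E)) (x n q) - partial_integral l (piece n q `\` E)).
  have e1 := nu_split mu mq mE; have e2 := partial_integral_split l mq mE.
  rewrite partial_integral_piece// e1 rscaleDl in e2.
  rewrite !(setIC E); apply/eqP; rewrite -addr_eq0 addrACA -opprD.
  by rewrite [_ `&` E]setIC in e2 *; rewrite subr_eq0 [_ + rscale (nu (piece n q `\` E)) _]addrC e2 [partial_integral l _ + _]addrC.
by rewrite rnormN; apply: bd; [exact: mD|move=> t []].
Qed.

Definition limit_integral E : X := limn (fun n => partial_integral n E).

Lemma limit_integral_cvg E : measurable E ->
  (fun n => partial_integral n E) @ \oo --> limit_integral E.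
Proof.
move=> mE; apply: rnorm_cauchy_cvg => e e0.
have [|n hn] := @osc_small E (e / 4) mE; first by rewrite divr_gt0.
exists n => l nl; apply: (le_lt_trans (partial_integral_cauchy mE nl)).
by rewrite -ltr_pdivlMl// mulrC.
Qed.

Lemma limit_integral_split : split_additive limit_integral.
Proof.
move=> A B mA mB; apply: cvg_lim => //.
under eq_fun do rewrite (partial_integral_split _ mA mB).
apply: cvgD; apply: limit_integral_cvg; first exact: measurableD.
exact: measurableI.
Qed.

Lemma limit_integral_le E : measurable E -> rnorm (limit_integral E) <= 2 * nu E.
Proof.
move=> mE; apply: (lim_rnorm_le (limit_integral_cvg mE)).
by exists 0%N => l _; exact: partial_integral_le.
Qed.

Lemma limit_integral_piece n q : (q < M n)%N ->
  limit_integral (piece n q) = rscale (nu (piece n q)) (x n q).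
Proof.
move=> qM; apply: cvg_lim => //; apply/rnorm_cvgP => e e0; exists n => l nl.
by rewrite partial_integral_piece// subrr rnorm0.
Qed.

Lemma limit_integral_vector_measure : vector_measure limit_integral.
Proof.
move=> A mA tA; apply/rnorm_cvgP => e e0.
have mU : measurable (\bigcup_i A i) by exact: bigcup_measurable.
have [|n hn] := @nu_tail R d S mu A (e / 2) mA; first by rewrite divr_gt0.
exists n => l nl; pose B l := \big[setU/set0]_(i < l) A i.
have mB l' : measurable (B l') by exact: bigsetU_measurable.
have -> : \sum_(0 <= i < l) limit_integral (A i) = limit_integral (B l).
  elim: l {nl} => [|l IH].
    by rewrite big_nil /B big_ord0 (split_additive0 limit_integral_split).
  rewrite big_nat_recr//= IH /B big_ord_recr /=.
  rewrite (split_additiveU limit_integral_split)//; first exact: mB.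
  apply/seteqP; split => // t; rewrite -bigcup_mkord => -[[i /= il Ai] Al].
  have := tA i l I I (ex_intro _ t (conj Ai Al)) => eil.
  by rewrite eil ltnn in il.
have BU : B l `<=` \bigcup_i A i by rewrite /B -bigcup_mkord; apply: bigcup_subset.
rewrite (limit_integral_split mU (mB l)) (setIidr BU) addrK.
apply: (le_lt_trans (limit_integral_le (measurableD mU (mB l)))).
by rewrite -ltr_pdivlMl// mulrC; exact: hn.
Qed.

Lemma limit_integral_abs_continuous : abs_continuous mu limit_integral.
Proof.
move=> A mA A0; apply/eqP; rewrite -rnorm_eq0 eq_le rnorm_ge0 andbT.
by apply: (le_trans (limit_integral_le mA)); rewrite /nu A0 mulr0.
Qed.

Lemma limit_integral_finite_variation : finite_variation limit_integral.
Proof.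
exists (2 * nu setT) => n A mA tA UA.
apply: (@le_trans _ _ (\sum_(i < n) 2 * nu (A i))).
  by apply: ler_sum => i _; exact: limit_integral_le.
rewrite -mulr_sumr ler_pM2l//.
pose s (t : S) := [pick i : 'I_n | t \in A i].
have sE t i : A i t -> s t = Some i.
  move=> Ait; rewrite /s; case: pickP => [j|/(_ i)]; last by rewrite mem_set.
  rewrite inE => Ajt; congr Some.
  exact: (tA j i I I (ex_intro _ t (conj Ajt Ait))).
have fib i : s @^-1` [set Some i] = A i.
  apply/seteqP; split => t /=; last exact: sE.
  by rewrite /s; case: pickP => // j; rewrite inE => Ajt [<-].
rewrite (split_additive_fibers (s := s) (r := [seq Some i | i <- enum 'I_n])
  (@nu_split R d S mu) measurableT).
- rewrite big_map big_enum /=; under [leRHS]eq_bigr do rewrite setTI fib.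
  exact: lexx.
- by move=> _ /mapP[i _ ->]; rewrite fib.
- by rewrite map_inj_uniq ?enum_uniq// => i j [].
- move=> t _; have : (\bigcup_i A i) t by rewrite UA.
  by move=> [i _ /sE ->]; rewrite map_f// mem_enum.
Qed.

(** ** No density *)

(** A piece and its subpieces contain almost the same proportion of [A], as this
    proportion is almost [0] or almost [1]. *)
Lemma osc_refine n A : measurable A ->
  \sum_(q < M n) \sum_(r < m n)
    `|nu (A `&` piece n.+1 (q * m n + r)) - nu (A `&` piece n q) / (m n)%:R|
  <= 2 * osc n A.
Proof.
move=> mA; rewrite mulr_sumr; apply: ler_sum => q _.
have mn : 0 < (m n)%:R :> R by rewrite ltr0n.
have bd B : measurable B -> \sum_(r < m n)
    `|nu (B `&` piece n.+1 (q * m n + r)) - nu (B `&` piece n q) / (m n)%:R|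
    <= 2 * nu (B `&` piece n q).
  move=> mB; apply: (@le_trans _ _ (\sum_(r < m n)
    (nu (B `&` piece n.+1 (q * m n + r)) + nu (B `&` piece n q) / (m n)%:R))).
    apply: ler_sum => r _; apply: (le_trans (ler_normB _ _)).
    by rewrite !ger0_norm ?divr_ge0 ?nu_ge0.
  rewrite big_split /= -(split_additive_subpieces n q (@nu_split R d S mu) mB).
  rewrite sumr_const card_ord -[_ / _ *+ _]mulr_natr divfK ?gt_eqF//; lra.
rewrite minr_pMr// le_min bd//=.
rewrite setDE [_ `&` ~` A]setIC; apply: le_trans (bd _ (measurableC mA)).
apply: ler_sum => r _.
have jM : (q * m n + r < M n.+1)%N.
  rewrite MS; apply: leq_trans (_ : q.+1 * m n <= _)%N.
    by rewrite mulSnr ltn_add2l.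
  by rewrite leq_mul2r ltn_ord orbT.
have e1 := nu_split mu (mpiece n.+1 (q * m n + r)) mA.
have e2 := nu_split mu (mpiece n q) mA.
rewrite !setDE ![_ `&` ~` A]setIC ![_ `&` A]setIC nu_piece// in e1.
rewrite !setDE ![_ `&` ~` A]setIC ![_ `&` A]setIC nu_piece// in e2.
rewrite MS natrM invfM in e1.
have {}e2 := congr1 (fun c => c / (m n)%:R) e2; rewrite mulrDl in e2.
by rewrite -normrN le_eqVlt; apply/orP; left; apply/eqP; congr `|_|; lra.
Qed.

Variable gapX : R.
Hypothesis gapX0 : 0 < gapX.
Hypothesis x_far : forall n i, (i < M n.+1)%N ->
  gapX <= rnorm (x n.+1 i - x n (i %/ m n)%N).

Lemma sum_osc_small (V : eqType) (r : seq V) (A : V -> set S) (c : V -> R) e :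
  (forall v, measurable (A v)) -> (forall v, 0 <= c v) -> 0 < e ->
  exists n, \sum_(v <- r) c v * (2 * osc n (A v)) < e.
Proof.
move=> mA c0; elim: r e => [|v r IH] e e0; first by exists 0%N; rewrite big_nil.
have e20 : 0 < e / 2 by lra.
have [n1 h1] := IH _ e20.
have c1 : 0 < 2 * (c v + 1) by have := c0 v; lra.
have [|n2 h2] := @osc_small (A v) (e / 2 / (2 * (c v + 1))) (mA v).
  exact: divr_gt0.
exists (maxn n1 n2); rewrite big_cons.
have h3 : \sum_(w <- r) c w * (2 * osc (maxn n1 n2) (A w)) <=
    \sum_(w <- r) c w * (2 * osc n1 (A w)).
  apply: ler_sum => w _; rewrite ler_wpM2l// ler_pM2l//.
  by apply: osc_le_level => //; exact: leq_maxl.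
have h4 := osc_le_level (mA v) (leq_maxr n1 n2).
rewrite ltr_pdivlMr// in h2.
have h5 : c v * (2 * osc (maxn n1 n2) (A v)) <= c v * (2 * osc n2 (A v)).
  by rewrite ler_wpM2l// ler_pM2l.
have := osc_ge0 n2 (A v); lra.
Qed.

(** A density would be close in mean to a simple function, whose averages over
    the pieces barely change from one level to the next; but the averages of
    the measure over the pieces are the nodes of the bush. *)
Theorem martingale_not_Radon_Nikodym : ~ Radon_Nikodym_property X.
Proof.
move=> RN; have [f [s_ app] fF] := RN d S mu limit_integral
  limit_integral_vector_measure limit_integral_abs_continuous
  limit_integral_finite_variation.
have [ss_ [N [mN N0 Nf]] /fine_cvgP[fin0 /cvgrPdist_lt s_f]] := app.
have eta0 : 0 < gapX / 4 by rewrite divr_gt0.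
have s_cvg t : ~ N t -> s_ ^~ t @ \oo --> f t.
  by move=> Nt; apply: contrapT => nc; apply: Nt; apply: Nf.
have [n1 _ h1] := fin0; have [n2 _ h2] := s_f _ eta0.
pose s := s_ (maxn n1 n2); have ss : simple_function s by exact: ss_.
have {}h1 := h1 (maxn n1 n2) (leq_maxl _ _).
have {}h2 := h2 (maxn n1 n2) (leq_maxr _ _).
rewrite /= sub0r normrN in h2; have {}h2 := le_lt_trans (ler_norm _) h2.
pose h t := (off_null_dist f N s t)%:E.
have mh : measurable_fun setT h.
  by apply/measurable_EFinP; exact: (measurable_off_null_dist mN ss_ s_cvg).
have h0 t : (0 <= h t)%E by rewrite lee_fin off_null_dist_ge0.
have hT : (\int[mu]_t h t < (gapX / 4)%:E)%E.
  apply: le_lt_trans (integral_off_null_dist mu f N s) _.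
  by rewrite -(fineK h1) lte_fin.
have hfin E : measurable E -> (\int[mu]_(t in E) h t)%E \is a fin_num.
  move=> mE; rewrite ge0_fin_numE ?integral_ge0//.
  apply: (@le_lt_trans _ _ (\int[mu]_t h t)%E); last exact: lt_trans hT (ltry _).
  exact: ge0_subset_integral.
pose H E := fine (\int[mu]_(t in E) h t)%E.
have H_split : split_additive H.
  move=> A B mA mB; rewrite /H -fineD; last 2 first.
  - by apply: hfin; exact: measurableD.
  - by apply: hfin; exact: measurableI.
  rewrite -ge0_integral_setU//; last 4 first.
  - exact: measurableD.
  - exact: measurableI.
  - exact: measurable_funS mh.
  - by rewrite disj_set2E setDE setIACA [~` B `&` B]setIC setICr setI0.
  by rewrite setUC setUIDK.
have HE E : measurable E -> rnorm (limit_integral E - simple_integral mu s E) <= H E.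
  move=> mE; rewrite -lee_fin /H fineK ?hfin//.
  exact: (bochner_integral_dist mN N0 ss_ s_cvg ss mE (fF E mE)).
have HP n : \sum_(i < M n) rnorm (limit_integral (piece n i) - simple_integral mu s (piece n i)) < gapX / 4.
  apply: (@le_lt_trans _ _ (H setT)).
    rewrite (split_additive_pieces n H_split measurableT); apply: ler_sum => i _.
    by rewrite setTI HE.
  by rewrite -lte_fin /H fineK ?hfin.
have ms v : measurable (s @^-1` [set v]) := simple_fiber_measurable v ss.
have [n hn] := sum_osc_small (values s) ms (@rnorm_ge0 R k X) eta0.
pose I := simple_integral mu s; pose F := limit_integral.
have mn : 0 < (m n)%:R :> R by rewrite ltr0n.
have Mn l : 0 < (M l)%:R :> R by rewrite ltr0n.
(* On the subpieces [F] takes the values given by the children, and they are far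
   from the parent. *)
have total : gapX <= \sum_(q < M n) \sum_(r < m n)
    rnorm (F (piece n.+1 (q * m n + r)) - rscale (m n)%:R^-1 (F (piece n q))).
  have key q r : (q < M n)%N -> (r < m n)%N -> (M n.+1)%:R^-1 * gapX <=
      rnorm (F (piece n.+1 (q * m n + r)) - rscale (m n)%:R^-1 (F (piece n q))).
    move=> qM rm; have jM : (q * m n + r < M n.+1)%N.
      rewrite MS; apply: leq_trans (_ : q.+1 * m n <= _)%N.
        by rewrite mulSnr ltn_add2l.
      by rewrite leq_mul2r qM orbT.
    rewrite /F !limit_integral_piece// !nu_piece// rscaleA.
    rewrite [_^-1 * _^-1]mulrC -invfM -natrM -MS -rscaleBr rnormZ gtr0_norm ?invr_gt0//.
    rewrite ler_pM2l ?invr_gt0//.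
    by have := x_far jM; rewrite divnMDl// divn_small// addn0.
  apply: (@le_trans _ _ (\sum_(q < M n) \sum_(r < m n) ((M n.+1)%:R^-1 * gapX))).
    rewrite sumr_const card_ord sumr_const card_ord -mulrnA mulnC -MS.
    by rewrite -[(_ * gapX) *+ _]mulr_natr mulrAC mulVf ?mul1r ?gt_eqF.
  by apply: ler_sum => q _; apply: ler_sum => r _; apply: key.
have split3 : \sum_(q < M n) \sum_(r < m n)
    rnorm (F (piece n.+1 (q * m n + r)) - rscale (m n)%:R^-1 (F (piece n q))) <=
  \sum_(q < M n) \sum_(r < m n)
    rnorm (F (piece n.+1 (q * m n + r)) - I (piece n.+1 (q * m n + r))) +
  \sum_(q < M n) \sum_(r < m n)
    rnorm (I (piece n.+1 (q * m n + r)) - rscale (m n)%:R^-1 (I (piece n q))) +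
  \sum_(q < M n) \sum_(r < m n)
    (m n)%:R^-1 * rnorm (F (piece n q) - I (piece n q)).
  rewrite -!big_split /=; apply: ler_sum => q _.
  rewrite -!big_split /=; apply: ler_sum => r _.
  have := rnorm_triangle (I (piece n.+1 (q * m n + r)))
    (F (piece n.+1 (q * m n + r))) (rscale (m n)%:R^-1 (F (piece n q))).
  have := rnorm_triangle (rscale (m n)%:R^-1 (I (piece n q)))
    (I (piece n.+1 (q * m n + r))) (rscale (m n)%:R^-1 (F (piece n q))).
  rewrite -[rscale _ (I _) - rscale _ (F _)]rscaleBr rnormZ gtr0_norm ?invr_gt0//.
  rewrite (rnorm_distC (I (piece n q))); lra.
have first_sum := HP n.+1.
rewrite MS (sum_ord_mul (M n) (m n) (fun j => rnorm (F (piece n.+1 j) - I (piece n.+1 j)))) in first_sum.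
have third_sum : \sum_(q < M n) \sum_(r < m n) ((m n)%:R^-1 * rnorm (F (piece n q) - I (piece n q))) < gapX / 4.
  apply: le_lt_trans (HP n); apply: ler_sum => q _.
  by rewrite sumr_const card_ord -[(_ * rnorm _) *+ _]mulr_natr mulrAC mulVf ?mul1r ?gt_eqF.
have second_sum : \sum_(q < M n) \sum_(r < m n)
    rnorm (I (piece n.+1 (q * m n + r)) - rscale (m n)%:R^-1 (I (piece n q))) < gapX / 4.
  apply: le_lt_trans hn.
  apply: (@le_trans _ _ (\sum_(q < M n) \sum_(r < m n) \sum_(v <- values s)
     rnorm v * `|nu (s @^-1` [set v] `&` piece n.+1 (q * m n + r)) -
                nu (s @^-1` [set v] `&` piece n q) / (m n)%:R|)).
    apply: ler_sum => q _; apply: ler_sum => r _.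
    rewrite /I !simple_integralE// rscale_sumr -sumrB.
    apply: (le_trans (rnorm_sum _ _ _)); apply: ler_sum => v _.
    rewrite rscaleA -rscaleBl rnormZ mulrC ler_wpM2l ?rnorm_ge0//.
    by rewrite ![piece _ _ `&` _]setIC [_^-1 * _]mulrC.
  under eq_bigr do rewrite exchange_big /=.
  rewrite exchange_big /=; apply: ler_sum => v _.
  under eq_bigr do rewrite -mulr_sumr.
  by rewrite -mulr_sumr ler_wpM2l ?rnorm_ge0// osc_refine.
have := gapX0; move: first_sum; rewrite -/F -/I; lra.
Qed.

End Martingale.
(** * Nested partitions of the unit interval *)

Section UnitInterval.
Context (R : realType) (M m : nat -> nat).
Hypotheses (M0 : forall n, (0 < M n)%N) (m0 : forall n, (0 < m n)%N).
Hypothesis MS : forall n, M n.+1 = (M n * m n)%N.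

(** Points outside the half-open unit interval are sent to the first piece of each
    level, so that the pieces of a level cover the whole line. *)
Definition clamp (t : R) : R := if 0 <= t < 1 then t else 0.

Definition interval_index n (t : R) : nat := Num.truncn ((M n)%:R * clamp t).

Let clamp01 t : 0 <= clamp t < 1.
Proof. by rewrite /clamp; case: ifP => //; rewrite lexx ltr01. Qed.

Let MR n : 0 < (M n)%:R :> R. Proof. by rewrite ltr0n. Qed.

Lemma interval_indexP n t i :
  interval_index n t = i <-> i%:R <= (M n)%:R * clamp t < i.+1%:R.
Proof.
have [c0 c1] := andP (clamp01 t).
have Mc : 0 <= (M n)%:R * clamp t by rewrite mulr_ge0.
split=> [<-|h]; first exact: truncn_itv.
by apply: truncn_def.
Qed.

Lemma interval_index_lt n t : (interval_index n t < M n)%N.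
Proof.
have [/(_ erefl)/andP[h _] _] := interval_indexP n t (interval_index n t).
rewrite -(ltr_nat R); apply: le_lt_trans h _.
by have [_ c1] := andP (clamp01 t); rewrite gtr_pMr.
Qed.

Lemma interval_indexS n t :
  interval_index n t = (interval_index n.+1 t %/ m n)%N.
Proof.
apply/interval_indexP.
have [/(_ erefl) h _] := interval_indexP n.+1 t (interval_index n.+1 t).
have mn : 0 < (m n)%:R :> R by rewrite ltr0n.
move: h; set i := interval_index n.+1 t; rewrite MS natrM mulrAC => /andP[h1 h2].
apply/andP; split.
  rewrite -(ler_pM2r mn) -natrM; apply: le_trans h1.
  by rewrite ler_nat leq_trunc_div.
rewrite -(ltr_pM2r mn) -natrM; apply: lt_le_trans h2 _.
by rewrite ler_nat ltn_ceil.
Qed.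

Lemma interval_piece n i : (i < M n)%N ->
  interval_index n @^-1` [set i] `&` `[0, 1[ =
  `[i%:R / (M n)%:R, i.+1%:R / (M n)%:R[%classic.
Proof.
move=> iM; apply/seteqP; split => t /=; rewrite !in_itv /=.
  move=> [/interval_indexP]; rewrite /clamp => h t01; move: h; rewrite t01.
  by rewrite ler_pdivrMr// ltr_pdivlMr// mulrC.
rewrite ler_pdivrMr// ltr_pdivlMr// => /andP[h1 h2].
have t01 : 0 <= t < 1.
  apply/andP; split.
    by rewrite -(pmulr_lge0 _ (MR n)); apply: le_trans h1.
  rewrite -(ltr_pM2r (MR n)) mul1r; apply: lt_le_trans h2 _.
  by rewrite ler_nat.
by split => //; apply/interval_indexP; rewrite /clamp t01 mulrC h1.
Qed.

(** The part of a piece outside the unit interval is everything for the first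
    piece and empty for the others. *)
Lemma measurable_interval_piece n i : measurable (interval_index n @^-1` [set i]).
Proof.
have [iM|Mi] := ltnP i (M n); last first.
  rewrite (_ : _ @^-1` _ = set0)//; apply/seteqP; split => // t /= ti.
  by move: Mi; rewrite -ti leqNgt interval_index_lt.
rewrite -[X in measurable X]setIT -(setvU `[0, 1[%classic) setIUr.
apply: measurableU; last by rewrite interval_piece.
have [i0|i0] := eqVneq i 0%N.
  rewrite (_ : _ `&` _ = ~` `[0, 1[%classic); first exact: measurableC.
  apply/seteqP; split => t /=; first by case.
  move=> ht; split => //; apply/interval_indexP; rewrite i0 /clamp.
  case: ifP => [t01|_]; last by rewrite mulr0 lexx ltr01.
  by exfalso; apply: ht; rewrite in_itv.
rewrite (_ : _ `&` _ = set0)//; apply/seteqP; split => // t /= [/interval_indexP].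
rewrite /clamp; case: ifP => [t01 _|_]; first by rewrite in_itv /= t01.
by rewrite mulr0 lern0 (negbTE i0).
Qed.

Definition pieces : set (set R) :=
  [set A | exists n i, A = interval_index n @^-1` [set i]].

Local Notation S := (g_sigma_algebraType pieces).

Let measurable_sub (A : set S) : measurable A -> measurable (A : set R).
Proof.
move=> mA; apply: (smallest_sub (@sigma_algebra_measurable _ R) _ mA).
by move=> _ [n [i ->]]; exact: measurable_interval_piece.
Qed.

(** Lebesgue measure of the part in the unit interval, on the sigma-algebra
    generated by the pieces. *)
Definition piece_measure (A : set S) : \bar R :=
  lebesgue_measure ((A : set R) `&` `[0, 1[%classic).

Let piece_measure0 : piece_measure set0 = 0%E.
Proof. by rewrite /piece_measure set0I measure0. Qed.

Let piece_measure_ge0 A : (0 <= piece_measure A)%E.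
Proof. exact: measure_ge0. Qed.

Let piece_measure_sigma_additive : semi_sigma_additive piece_measure.
Proof.
move=> F mF tF mUF.
have mD : measurable (`[0, 1[%classic : set R) by exact: measurable_itv.
apply: (@measure_semi_sigma_additive _ _ _ (mrestr lebesgue_measure mD) F) => //.
- by move=> i; apply: measurable_sub; exact: mF.
- exact: (measurable_sub mUF).
Qed.

HB.instance Definition _ := isMeasure.Build _ S R piece_measure
  piece_measure0 piece_measure_ge0 piece_measure_sigma_additive.

Let piece_measure_fin : fin_num_fun piece_measure.
Proof.
move=> A mA; rewrite ge0_fin_numE//.
apply: (@le_lt_trans _ _ (lebesgue_measure (`[0, 1[%classic : set R))).
  apply: le_measure; rewrite ?inE.
  - by apply: measurableI => //; exact: measurable_sub.
  - exact: measurable_itv.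
  - exact: subIsetr.
by rewrite lebesgue_measure_itv /= lte_fin ltr01 -EFinB ltry.
Qed.

HB.instance Definition _ := Measure_isFinite.Build _ S R piece_measure piece_measure_fin.

Lemma nu_interval_piece n i : (i < M n)%N ->
  nu piece_measure (interval_index n @^-1` [set i] : set S) = (M n)%:R^-1.
Proof.
move=> iM; suff h : piece_measure (interval_index n @^-1` [set i]) = ((M n)%:R^-1)%:E.
  exact: (congr1 fine h).
transitivity (lebesgue_measure (`[i%:R / (M n)%:R, i.+1%:R / (M n)%:R[%classic : set R)).
  by congr lebesgue_measure; exact: interval_piece.
rewrite lebesgue_measure_itv /= lte_fin ltr_pM2r ?invr_gt0// ltr_nat ltnSn.
by rewrite -EFinB /= -mulrBl -natrB// subSnn mul1r.
Qed.

Lemma nested_partitions_exist : exists (d : measure_display)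
    (T : measurableType d) (mu : {finite_measure set T -> \bar R}) (idx : nat -> T -> nat),
  [/\ forall n t, (idx n t < M n)%N, forall n t, idx n t = (idx n.+1 t %/ m n)%N &
  [/\ forall n i, measurable (piece idx n i),
      forall n i, (i < M n)%N -> nu mu (piece idx n i) = (M n)%:R^-1 &
      forall E : set T, measurable E ->
        <<s [set A | exists n i, A = piece idx n i] >> E]].
Proof.
exists _, S, piece_measure, interval_index; split.
- exact: interval_index_lt.
- exact: interval_indexS.
- split => [n i||E mE].
  + by apply: sub_sigma_algebra; exists n, i.
  + exact: nu_interval_piece.
  + exact: mE.
Qed.

End UnitInterval.

Theorem Daugavet_not_Radon_Nikodym (R : realType) (k : scalar_kind)
    (X : completeNormedModType (scalars R k)) (G : groupType)
    (a : isometric_action G X) :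
  (exists x : X, x != 0) -> G_Daugavet a -> alpha a < 2 ->
  ~ Radon_Nikodym_property X.
Proof.
move=> hX hD ha.
have [M [m [x [M0 m0 MS] [x2 xS xfar]]]] := bush_exists hD hX ha.
have g0 : 0 < gap a / 2 by rewrite divr_gt0// gap_gt0.
have [d [T [mu [idx [il iS [mp np gen]]]]]] := nested_partitions_exist R M0 m0 MS.
exact: (martingale_not_Radon_Nikodym M0 m0 MS x2 xS il iS mp np gen g0 xfar).
Qed.
(** * A countable set capturing the stretching property *)

Section CountableCore.
Context (R : realType) (k : scalar_kind) (X : normedModType (scalars R k)).
Context (G : groupType) (a : isometric_action G X).
Hypothesis hD : G_Daugavet a.
Hypothesis hX : exists x : X, x != 0.
Implicit Types (x y z w : X).

Lemma stretched_choice : exists c : X * X * nat -> seq (X * X),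
  forall z x j, rnorm x <= 1 ->
  [/\ c (z, x, j) != [::],
    forall p, p \in c (z, x, j) -> [/\ rnorm p.1 <= 1, exists g, p.2 = a g p.1 &
      rnorm z + 1 - j.+1%:R^-1 <= rnorm (z + p.2)] &
    rnorm (x - avg [seq p.1 | p <- c (z, x, j)]) < j.+1%:R^-1].
Proof.
have /choice[c cP] : forall t : X * X * nat, exists l : seq (X * X),
    rnorm t.1.2 <= 1 -> [/\ l != [::],
    forall p, p \in l -> [/\ rnorm p.1 <= 1, exists g, p.2 = a g p.1 &
      rnorm t.1.1 + 1 - t.2.+1%:R^-1 <= rnorm (t.1.1 + p.2)] &
    rnorm (t.1.2 - avg [seq p.1 | p <- l]) < t.2.+1%:R^-1].
  move=> [[z x] j] /=; have [x1|] := leP (rnorm x) 1; last by exists [::].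
  have e0 : 0 < j.+1%:R^-1 :> R by rewrite invr_gt0.
  have [l [l0 lP lx]] := stretched_averages hD hX z x1 e0.
  have /choice[g gP] : forall y, exists g, y \in l ->
      rnorm z + 1 - j.+1%:R^-1 <= rnorm (z + a g y).
    move=> y; have [/lP[_ [g hg]]|ny] := boolP (y \in l); first by exists g.
    by exists 1%g.
  exists [seq (y, a (g y) y) | y <- l] => _; split.
  - by rewrite -size_eq0 size_map size_eq0.
  - move=> _ /mapP[y yl ->] /=; split; [by case: (lP y yl)|by exists (g y)|exact: gP].
  - by rewrite -map_comp map_id_in.
by exists c => z x j x1; exact: (cP (z, x, j)).
Qed.

(** The enumeration runs over the values of all terms built from [x0] by sums,
    opposites, division by integers and the choices above.  It is the
    formulation by averages that passes to a countable set: a functional above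
    [c] at [x] must be above [c] at some entry of a list whose average is close
    to [x]. *)
Lemma countable_core x0 : exists Y : nat -> X,
  [/\ range Y x0,
   forall z w, range Y z -> range Y w -> range Y (z + w),
   forall z, range Y z -> range Y (- z),
   forall l, {in l, forall y, range Y y} -> range Y (avg l) &
   forall f M z x c e, rlinear f -> (forall v, f v <= M * rnorm v) ->
     range Y z -> range Y x -> rnorm x <= 1 -> c < f x -> 0 < e ->
     exists y g, [/\ range Y y, range Y (a g y), rnorm y <= 1, c < f y &
       rnorm z + 1 - e <= rnorm (z + a g y)]].
Proof.
have [c cP] := stretched_choice.
(* The labels 0 to 4 encode sum, opposite, division, and the two components of
   the entry [i] of the chosen list. *)
pose fix eval (t : GenTree.tree nat) : X := match t with
  | GenTree.Leaf _ => x0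
  | GenTree.Node 0 [:: u; v] => eval u + eval v
  | GenTree.Node 1 [:: u] => - eval u
  | GenTree.Node 2 [:: u; GenTree.Leaf n] => rscale n%:R^-1 (eval u)
  | GenTree.Node 3 [:: u; v; GenTree.Leaf j; GenTree.Leaf i] =>
      (nth (0, 0) (c (eval u, eval v, j)) i).1
  | GenTree.Node 4 [:: u; v; GenTree.Leaf j; GenTree.Leaf i] =>
      (nth (0, 0) (c (eval u, eval v, j)) i).2
  | _ => 0
  end.
pose Y n := if unpickle n is Some t then eval t else 0.
have YE t : range Y (eval t) by exists (pickle t); rewrite // /Y pickleK.
have EY v : range Y v -> exists t, v = eval t.
  move=> [n _ <-]; rewrite /Y; case: unpickle => [t|]; first by exists t.
  by exists (GenTree.Node 0 [::]).
have YD z w : range Y z -> range Y w -> range Y (z + w).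
  by move=> /EY[t ->] /EY[u ->]; exact: (YE (GenTree.Node 0 [:: t; u])).
exists Y; split => //.
- exact: (YE (GenTree.Leaf 0%N)).
- by move=> z /EY[t ->]; exact: (YE (GenTree.Node 1 [:: t])).
- move=> l lY; have [t tE] : exists t, \sum_(y <- l) y = eval t.
    apply: EY; elim: l lY => [|y l IH] lY.
      by rewrite big_nil; exact: (YE (GenTree.Node 0 [::])).
    rewrite big_cons; apply: YD; first by apply: lY; rewrite mem_head.
    by apply: IH => z zl; apply: lY; rewrite inE zl orbT.
  by rewrite /avg tE; exact: (YE (GenTree.Node 2 [:: t; GenTree.Leaf (size l)])).
move=> f M z x b e lf fM /EY[t zE] /EY[u xE] x1 bx e0.
pose j := Num.truncn (Num.max e^-1 ((`|M| + 1) / (f x - b))).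
have fxb : 0 < f x - b by rewrite subr_gt0.
have /andP[_ jP] : j%:R <= Num.max e^-1 ((`|M| + 1) / (f x - b)) < j.+1%:R.
  by apply: truncn_itv; rewrite le_max invr_ge0 ltW.
move: jP; rewrite gt_max => /andP[j1 j2].
have je : j.+1%:R^-1 < e by rewrite -[e]invrK ltf_pV2 ?posrE ?invr_gt0.
have jM : `|M| * j.+1%:R^-1 < f x - b.
  move: j2; rewrite ltr_pdivrMr// mulrC -ltr_pdivrMr// => h.
  apply: le_lt_trans h; rewrite ler_wpM2r ?invr_ge0//; lra.
have [l0 lP lx] := cP z x j x1; set l := c (z, x, j) in l0 lP lx.
set A := avg _ in lx.
have [p pl fp] : exists2 p, p \in l & b < f p.1.
  apply: contrapT => no.
  have h : - b <= - f A.
    apply: (@rlinear_avg R k X (fun v => - f v)).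
    - by split => [v w|s v]; rewrite ?lf.1 ?opprD// lf.2 mulrN.
    - by rewrite -size_eq0 size_map size_eq0.
    - move=> _ /mapP[p pl ->]; rewrite lerN2 leNgt; apply/negP => fp.
      by apply: no; exists p.
  have := fM (x - A); rewrite rlinearB// => h2.
  have h3 : M * rnorm (x - A) <= `|M| * j.+1%:R^-1.
    apply: (le_trans (ler_wpM2r (rnorm_ge0 _) (ler_norm M))).
    by rewrite ler_wpM2l// ltW.
  have := le_lt_trans (le_trans h2 h3) jM; rewrite ltrD2l ltrN2 => h4.
  by move: h; rewrite lerN2 leNgt h4.
have [p1 [g pE] pz] := lP p pl.
have pI : (nth (0, 0) l (index p l)) = p by rewrite nth_index.
exists p.1, g; split => //.
- have := YE (GenTree.Node 3 [:: t; u; GenTree.Leaf j; GenTree.Leaf (index p l)]).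
  by rewrite /= -zE -xE -/l pI.
- have := YE (GenTree.Node 4 [:: t; u; GenTree.Leaf j; GenTree.Leaf (index p l)]).
  by rewrite /= -zE -xE -/l pI pE.
- by rewrite -pE (le_trans _ pz)// lerD2l lerN2 ltW.
Qed.

End CountableCore.
(** * Independence *)

Section Independence.
Context (R : realType) (k : scalar_kind) (X : normedModType (scalars R k)).
Context (G : groupType) (a : isometric_action G X).
Implicit Types (x y z w : X) (f : X -> R).
Variables (x0 : X) (Y : nat -> X).
Hypothesis x01 : rnorm x0 = 1.
Hypothesis Yx0 : range Y x0.
Hypothesis YD : forall z w, range Y z -> range Y w -> range Y (z + w).
Hypothesis YN : forall z, range Y z -> range Y (- z).
Hypothesis Yavg : forall l, {in l, forall y, range Y y} -> range Y (avg l).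
Hypothesis Ystretch :
  forall f M z x c e, rlinear f -> (forall v, f v <= M * rnorm v) ->
     range Y z -> range Y x -> rnorm x <= 1 -> c < f x -> 0 < e ->
     exists y g, [/\ range Y y, range Y (a g y), rnorm y <= 1, c < f y &
       rnorm z + 1 - e <= rnorm (z + a g y)].
Hypothesis alpha0 : 0 <= alpha a.
Hypothesis alpha2 : alpha a < 2.

(** ** Slices of the countable ball *)

Definition cball : set X := [set y | range Y y /\ rnorm y <= 1].

Definition rbounded f := rlinear f /\ exists M, forall v, f v <= M * rnorm v.

Definition csup f : R := sup [set f y | y in cball].

Definition slice f t : set X := [set y | cball y /\ csup f - t < f y].

Lemma cball_x0 : cball x0.
Proof. by split => //; rewrite x01. Qed.

Lemma csup_has_sup f : rbounded f -> has_sup [set f y | y in cball].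
Proof.
move=> [lf [M fM]]; split; first by exists (f x0), x0 => //; exact: cball_x0.
exists `|M| => _ [y [_ y1] <-]; apply: (le_trans (fM y)).
apply: (le_trans (ler_wpM2r (rnorm_ge0 _) (ler_norm M))).
by rewrite ler_piMr.
Qed.

Lemma csup_ge f y : rbounded f -> cball y -> f y <= csup f.
Proof. by move=> bf yY; apply: ub_le_sup; [case: (csup_has_sup bf)|exists y]. Qed.

Lemma slice_nonempty f t : rbounded f -> 0 < t -> slice f t !=set0.
Proof.
move=> bf t0; have [_ [y yY <-] h] := sup_adherent t0 (csup_has_sup bf).
by exists y.
Qed.

Lemma contractive_rbounded f : contractive f -> rbounded f.
Proof. by move=> [lf fN]; split => //; exists 1 => v; rewrite mul1r. Qed.

Lemma rboundedD f f' : rbounded f -> rbounded f' -> rbounded (fun v => f v + f' v).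
Proof.
move=> [lf [M fM]] [lf' [M' fM']]; split.
  split => [v w|t v]; first by rewrite lf.1 lf'.1 addrACA.
  by rewrite lf.2 lf'.2 mulrDr.
by exists (M + M') => v; rewrite mulrDl lerD.
Qed.

(** The slice [n] consists of the points where [psi n] is within the depth
    [tau n] of its supremum. *)
Definition slices (psi : nat -> X -> R) (tau : nat -> R) :=
  forall n, rbounded (psi n) /\ 0 < tau n.

Variable e0 : R.
Hypothesis e00 : 0 < e0.

(** A bound at the translate [a g y] is one at [y] up to [alpha a]; it is stated
    at the translate since [f \o a g] then attains almost its norm on the slice,
    so that the slice can be shrunk to points sharing the bound. *)
Definition independent f (psi : nat -> X -> R) (tau : nat -> R) :=
  [/\ contractive f, f x0 <= - 1 + e0 &
    forall n, exists y g, slice (psi n) (tau n) y /\ 1 - tau n <= f (a g y)].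

(** Each slice is visited infinitely often while building a sequence with almost
    additive norms; as the deficits are summable, one visit has a small one.
    This is why the bound at the translate can be as close to [1] as desired
    while that at [x0] is only [e0]. *)
Lemma independent_exists psi tau : slices psi tau ->
  exists f, independent f psi tau.
Proof.
move=> sl.
have /choice[h hP] : forall nz : nat * X, exists p : X * G, range Y nz.2 ->
    [/\ range Y (a p.2 p.1),
       slice (psi (logn 2 nz.1.+1)) (tau (logn 2 nz.1.+1)) p.1 &
       rnorm nz.2 + 1 - e0 / 2 ^+ nz.1.+1 <= rnorm (nz.2 + a p.2 p.1)].
  move=> [i z] /=; have [zY|] := pselect (range Y z); last by exists (0, 1%g).
  set n := logn 2 i.+1; have [bn tn] := sl n; have [ln [M lM]] := bn.
  have [x [[xY x1] hx]] := slice_nonempty bn tn.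
  have [|y [g [yY gY y1 hy hz]]] :=
    Ystretch (e := e0 / 2 ^+ i.+1) ln lM zY xY x1 hx.
    by rewrite divr_gt0// exprn_gt0.
  by exists (y, g).
pose fix w n : X := if n is m.+1 then w m + a (h (m, w m)).2 (h (m, w m)).1 else - x0.
pose z n := if n is m.+1 then w m else 0.
pose y n := (h (n, w n)).1; pose g n := (h (n, w n)).2.
have wS n : w n.+1 - w n = a (g n) (y n).
  by rewrite [LHS]addrC -[w n.+1]/(w n + _) addKr.
have wY n : range Y (w n).
  elim: n => [|n IH]; first exact: YN.
  by apply: YD => //; have [] := hP (n, w n) IH.
have yP n : [/\ range Y (a (g n) (y n)),
    slice (psi (logn 2 n.+1)) (tau (logn 2 n.+1)) (y n) &
    rnorm (w n) + 1 - e0 / 2 ^+ n.+1 <= rnorm (w n.+1)] := hP (n, w n) (wY n).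
have y1 n : rnorm (y n) <= 1 by have [_ [[]]] := yP n.
have wN n : n.+1%:R - e0 + e0 / 2 ^+ n <= rnorm (w n).
  elim: n => [|n IH]; first by rewrite /= rnormN x01 expr0; lra.
  have [_ _] := yP n; move: IH; rewrite -[n.+2%:R]natr1 exprS invfM.
  by rewrite mulrCA; lra.
have zS n : rnorm (z n.+1 - z n) <= 1.
  case: n => [|n] /=; first by rewrite subr0 rnormN x01.
  by rewrite wS rnorm_act.
have zN n : n%:R - e0 <= rnorm (z n).
  case: n => [|n] /=; first by rewrite rnorm0; have := e00; lra.
  by apply: le_trans (wN n); rewrite lerDl divr_ge0 ?exprn_ge0// ltW.
have [f cf [fz fzS]] := norming_functional (erefl : z 0%N = 0) zS zN (ltW e00).
exists f; split => //.
  have := fz 1%N; rewrite /= rlinearN; last by case: cf.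
  lra.
move=> n.
pose E := [set f (w i) - i%:R | i in [set: nat]].
have Einf : has_inf E.
  split; first by exists (f (w 0%N) - 0%:R), 0%N.
  exists (- e0) => _ [i _ <-]; have := fz i.+1; rewrite -natr1 /=.
  lra.
have Edec i j : (i <= j)%N -> f (w j) - j%:R <= f (w i) - i%:R.
  elim: j => [|j IH]; first by rewrite leqn0 => /eqP ->.
  rewrite leq_eqVlt => /predU1P[->//|]; rewrite ltnS => /IH /(le_trans _); apply.
  have := cf.2 (a (g j) (y j)); rewrite -wS rlinearB; last by case: cf.
  by rewrite wS rnorm_act -natr1; have := y1 j; lra.
have [bn tn] := sl n.
have [_ [i0 _ <-] hi0] := inf_adherent tn Einf.
(* The step [i] serves the slice [logn 2 i.+1]. *)
pose i := (2 ^ n * 3 ^ i0).-1.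
have iE : i.+1 = (2 ^ n * 3 ^ i0)%N by rewrite prednK// muln_gt0 !expn_gt0.
have li : logn 2 i.+1 = n.
  rewrite iE lognM ?expn_gt0// pfactorK// (_ : logn 2 (3 ^ i0) = 0)%N ?addn0//.
  by apply: logn_coprime; rewrite coprimeXr.
have i0i : (i0 <= i)%N.
  rewrite -ltnS iE; apply: leq_trans (leq_pmull _ _); last by rewrite expn_gt0.
  exact: ltn_expl.
have [_ ys _] := yP i; rewrite li in ys.
exists (y i), (g i); split => //.
have h1 := Edec _ _ i0i.
have h2 : inf E <= f (w i.+1) - i.+1%:R.
  by apply: ge_inf; [case: Einf|exists i.+1].
rewrite -wS rlinearB; last by case: cf.
by move: h2; rewrite -natr1; lra.
Qed.

(** ** Constraints on countably many values *)

(** A finite list of rational lower ([true]) and upper ([false]) bounds on the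
    values of a functional at points of the countable set. *)
Definition constraints := seq (nat * bool * rat).

Definition satisfies f (c : constraints) := forall t, t \in c ->
  if t.1.2 then ratr t.2 < f (Y t.1.1) else f (Y t.1.1) < ratr t.2.

(** Largeness is measured by independence from all sequences of slices. *)
Definition big c := forall psi tau, slices psi tau ->
  exists f, satisfies f c /\ independent f psi tau.

Definition generic f := forall c, satisfies f c -> big c.

Lemma zero_rbounded : rbounded (fun=> 0 : R).
Proof.
split; last by exists 0 => v; rewrite mul0r.
by split => [v w|t v]; rewrite ?addr0 ?mulr0.
Qed.

(** There are only countably many lists of constraints, so the witnesses for all
    those that are not big can be merged into one sequence of slices. *)
Lemma generic_witness : exists psi tau, slices psi tau /\
  forall f, independent f psi tau -> generic f.
Proof.
have /choice[w wP] : forall c : constraints, exists pt : (nat -> X -> R) * (nat -> R),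
    slices pt.1 pt.2 /\
    (~ big c -> forall f, satisfies f c -> ~ independent f pt.1 pt.2).
  move=> c; have [bc|nbc] := pselect (big c).
    by exists (fun _ _ => 0, fun=> 1); split => // n; split; [exact: zero_rbounded|exact: ltr01].
  move: nbc => /existsNP[psi] /existsNP[tau] /not_implyP[sl nf].
  by exists (psi, tau); split => // _ f fc indf; apply: nf; exists f.
pose psi n := if unpickle n is Some (m, c) then (w c).1 m else (fun _ => 0).
pose tau n := if unpickle n is Some (m, c) then (w c).2 m else 1.
exists psi, tau; split.
  move=> n; rewrite /psi /tau; case: unpickle => [[m c]|].
    by have [sl _] := wP c; exact: sl.
  by split; [exact: zero_rbounded|exact: ltr01].
move=> f [cf fx fn] c fc; apply: contrapT => nbc.
have [_ /(_ nbc f fc)] := wP c; apply; split => // m.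
by have := fn (pickle (m, c)); rewrite /psi /tau pickleK.
Qed.

Lemma big_generic c psi tau : big c -> slices psi tau ->
  exists f, [/\ satisfies f c, independent f psi tau & generic f].
Proof.
move=> bc sl; have [psi0 [tau0 [sl0 gen]]] := generic_witness.
pose psi1 n := if odd n then psi n./2 else psi0 n./2.
pose tau1 n := if odd n then tau n./2 else tau0 n./2.
have [|f [fc [cf fx fn]]] := bc psi1 tau1.
  by move=> n; rewrite /psi1 /tau1; case: odd.
exists f; split => //.
  split => // n; have := fn n.*2.+1; rewrite /psi1 /tau1 /= odd_double /=.
  by rewrite uphalf_double.
apply: gen; split => // n; have := fn n.*2; rewrite /psi1 /tau1 odd_double.
by rewrite doubleK.
Qed.

(** ** Refining slices *)

Definition refines psi' tau' psi tau := forall n : nat,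
  slice (psi' n) (tau' n) `<=` slice (psi n) (tau n).

(** Where [psi n] and the translate of [f] are jointly almost maximal, each of
    them is almost maximal; their sum defines the smaller slice. *)
Lemma refine_slices psi tau eta : slices psi tau -> 0 < eta ->
  exists tau1, slices psi tau1 /\ forall f, independent f psi tau1 ->
  exists psi' tau', [/\ slices psi' tau', refines psi' tau' psi tau &
    forall n y, slice (psi' n) (tau' n) y -> 1 - eta - alpha a <= f y].
Proof.
move=> sl eta0; pose t n := Num.min (tau n) eta / 3.
have t0 n : 0 < t n by rewrite divr_gt0// lt_min eta0 (sl n).2.
have tt n : t n * 3 <= tau n by rewrite divfK// ge_min lexx.
have te n : t n * 3 <= eta by rewrite divfK// ge_min lexx orbT.
exists t; split; first by move=> n; split => //; case: (sl n).
move=> f [cf _ fn].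
have /choice[y /choice[g yg]] : forall n, exists y, exists g,
  slice (psi n) (t n) y /\ 1 - t n <= f (a g y) by exact: fn.
pose psi' n v := psi n v + f (a (g n) v).
have cg n := contractive_act a (g n) cf.
have b' n : rbounded (psi' n).
  by apply: rboundedD; [case: (sl n)|exact: contractive_rbounded].
have key n v : slice (psi' n) (t n) v ->
    cball v /\ csup (psi n) - t n * 3 < psi n v /\ 1 - t n * 3 <= f (a (g n) v).
  move=> [vY hv]; have [[yY hy] hg] := yg n.
  have h1 := csup_ge (b' n) yY; have h2 := csup_ge (sl n).1 vY.
  have [_ v1] := vY; have := (cg n).2 v; rewrite /psi' in h1 hv => h3.
  by split => //; split; lra.
exists psi', t; split; first by move=> n.
- move=> n v /key[vY [h _]]; split => //; have := tt n; lra.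
- move=> n v /key[[_ v1] [_ h]]; have := alpha_lower a (g n) v cf.
  have : alpha a * rnorm v <= alpha a by rewrite ler_piMr.
  have := te n; lra.
Qed.

Lemma refine_slices_all (cs : seq constraints) psi tau eta :
  {in cs, forall c, big c} -> slices psi tau -> 0 < eta ->
  exists psi' tau', [/\ slices psi' tau', refines psi' tau' psi tau &
    {in cs, forall c, exists f, [/\ satisfies f c, generic f, contractive f &
      forall n y, slice (psi' n) (tau' n) y -> 1 - eta - alpha a <= f y]}].
Proof.
elim: cs psi tau => [|c cs IH] psi tau bcs sl eta0.
  by exists psi, tau; split => // n.
have [tau1 [sl1 ind1]] := refine_slices sl eta0.
have [f [fc indf gf]] := big_generic (bcs c (mem_head _ _)) sl1.
have cf : contractive f by case: indf.
have [psi2 [tau2 [sl2 ref2 f2]]] := ind1 f indf.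
have [|psi3 [tau3 [sl3 ref3 cs3]]] := IH psi2 tau2 _ sl2 eta0.
  by move=> c' c'cs; apply: bcs; rewrite inE c'cs orbT.
exists psi3, tau3; split => //.
  by move=> n y /ref3/ref2.
move=> c'; rewrite inE => /predU1P[->|/cs3//].
by exists f; split => // n y /ref3; exact: f2.
Qed.

(** ** Small slices with respect to finitely many functionals *)

(** In the space of values of the [F i], the point of a bounded set farthest from
    a centre far away in the direction of [- u] is strongly exposed and almost
    maximizes [u].  In terms of the ball: almost maximize the convex function
    [\sum_(i < n) F i v ^+ 2 + 2 * r * u v] for large [r]; its derivative at
    the resulting point [y] is the functional [psi]. *)
Lemma localized_point (n : nat) (F : nat -> X -> R) x e u tau :
  (forall i, contractive (F i)) -> cball x -> 0 < e ->
  rlinear u -> (forall v, u v <= \sum_(i < n) `|F i v|) -> 0 < tau ->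
  exists y psi t, [/\ cball y, u x - tau < u y, rbounded psi, 0 < t &
    forall c i, slice psi t c -> (i < n)%N -> `|F i c - F i y| <= e].
Proof.
move=> cF xY e_gt0 lu uF tau0.
pose kappa := e ^+ 2 / 2; have kappa0 : 0 < kappa by rewrite divr_gt0// exprn_gt0.
pose r := (n%:R + 1 + kappa) / (2 * tau).
have n0 : 0 <= n%:R :> R by [].
have r0 : 0 < r by rewrite divr_gt0//; lra.
have F1 v i : cball v -> `|F i v| <= 1.
  by move=> [_ v1]; exact: le_trans (contractive_abs v (cF i)) v1.
pose q v := \sum_(i < n) F i v ^+ 2.
have q0 v : 0 <= q v by apply: sumr_ge0 => i _; exact: sqr_ge0.
have qn v : cball v -> q v <= n%:R.
  move=> vY; have -> : n%:R = \sum_(i < n) (1 : R) by rewrite sumr_const card_ord.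
  apply: ler_sum => i _.
  by rewrite -real_normK ?num_real//; apply: exprn_ile1 => //; exact: F1.
have un v : u v <= n%:R * rnorm v.
  apply: (le_trans (uF v)).
  have -> : n%:R * rnorm v = \sum_(i < n) rnorm v by rewrite sumr_const card_ord mulr_natl.
  by apply: ler_sum => i _; exact: contractive_abs.
have un1 v : cball v -> u v <= n%:R.
  by move=> [_ v1]; apply: (le_trans (un v)); rewrite ler_piMr.
pose h v := q v + 2 * r * u v.
have hs : has_sup [set h y | y in cball].
  split; first by exists (h x), x.
  exists (n%:R + 2 * r * n%:R) => _ [y yY <-]; rewrite lerD ?qn//.
  by rewrite ler_pM2l ?un1//; lra.
have [_ [y yY <-] hy] := sup_adherent kappa0 hs.
have hle c : cball c -> h c < h y + kappa.
  move=> cY; have : h c <= sup [set h y | y in cball].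
    by apply: ub_le_sup; [case: hs|exists c].
  lra.
pose psi c := \sum_(i < n) 2 * F i y * F i c + 2 * r * u c.
have bpsi : rbounded psi.
  split.
    split=> [v w|t v].
      rewrite /psi lu.1 mulrDr addrACA -big_split /=; congr (_ + _).
      by apply: eq_bigr => i _; rewrite (cF i).1.1 mulrDr.
    rewrite /psi lu.2 mulrDr mulr_sumr; congr (_ + _); last by rewrite mulrCA.
    by apply: eq_bigr => i _; rewrite (cF i).1.2 mulrCA.
  exists (\sum_(i < n) 2 + 2 * r * n%:R) => v; rewrite mulrDl mulr_suml lerD//.
    apply: ler_sum => i _; have := contractive_abs v (cF i); have := F1 y i yY.
    rewrite !ler_norml => /andP[a1 a2] /andP[b1 b2]; have := rnorm_ge0 v; nra.
  have : 2 * r * u v <= 2 * r * (n%:R * rnorm v) by rewrite ler_pM2l//; lra.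
  by rewrite [2 * r * (_ * _)]mulrA.
exists y, psi, kappa; split => //.
  have := hle x xY; have := q0 x; have := qn y yY; rewrite /h => h1 h2 h3.
  have h4 : 2 * r * (u x - u y) < n%:R + 1 + kappa by lra.
  have h5 : n%:R + 1 + kappa = 2 * r * tau.
    by rewrite /r; field; rewrite gt_eqF.
  by move: h4; rewrite h5 ltr_pM2l; lra.
move=> c i [cY hc] ilt.
have key : h c = h y + (psi c - psi y) + \sum_(i < n) (F i c - F i y) ^+ 2.
  rewrite /h /psi /q.
  have -> : \sum_(i < n) (F i c - F i y) ^+ 2 = \sum_(i < n) F i c ^+ 2 -
      \sum_(i < n) 2 * F i y * F i c + \sum_(i < n) F i y ^+ 2.
    rewrite -sumrB -big_split /=; apply: eq_bigr => j _; ring.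
  have -> : \sum_(i < n) 2 * F i y * F i y = 2 * \sum_(i < n) F i y ^+ 2.
    by rewrite mulr_sumr; apply: eq_bigr => j _; ring.
  ring.
have sq : \sum_(i < n) (F i c - F i y) ^+ 2 < e ^+ 2.
  have := hle c cY; have := csup_ge bpsi yY.
  have : e ^+ 2 = kappa + kappa by rewrite /kappa; lra.
  lra.
have : (F i c - F i y) ^+ 2 < e ^+ 2.
  apply: le_lt_trans sq; rewrite (bigD1 (Ordinal ilt))//= lerDl.
  by apply: sumr_ge0 => j _; exact: sqr_ge0.
rewrite -[X in X < _]real_normK ?num_real// ltr_pXn2r// ?nnegrE//; last exact: ltW.
exact: ltW.
Qed.

(** Weak neighbourhoods of [x] contain convex combinations of slices: by
    localized_point no functional continuous for the values of the [F i]
    separates [x] from the points having small slices around them. *)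
Lemma localize (n : nat) (F : nat -> X -> R) x e :
  (forall i, contractive (F i)) -> cball x -> 0 < e ->
  exists l psi tau, [/\ l != [::], slices psi tau,
    forall i, (i < n)%N -> `|F i x - F i (avg l)| <= e &
    forall i j c, (i < n)%N -> (j < size l)%N -> slice (psi j) (tau j) c ->
      `|F i c - F i (nth x l j)| <= e].
Proof.
move=> cF xY e_gt0; pose p v := \sum_(i < n) `|F i v|.
have sp : sublinear p.
  split=> [|v w|t v t0].
  - by apply: big1 => i _; rewrite (rlinear0 (cF i).1) normr0.
  - rewrite -big_split; apply: ler_sum => i _ /=.
    by rewrite (cF i).1.1 ler_normD.
  - rewrite mulr_sumr; apply: eq_bigr => i _.
    by rewrite (cF i).1.2 normrM gtr0_norm.
have pN v : p (- v) = p v.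
  by apply: eq_bigr => i _; rewrite (rlinearN _ (cF i).1) normrN.
pose good y (pt : (X -> R) * R) := [/\ rbounded pt.1, 0 < pt.2 &
  forall c i, slice pt.1 pt.2 c -> (i < n)%N -> `|F i c - F i y| <= e].
have [|l [l0 lA lx]] := @approx_by_averages R k X p
  [set y | exists pt, good y pt] x sp pN _ e e_gt0.
  move=> u lu up tau tau0.
  have [y [psi [t [yY uy bpsi t0 hc]]]] := localized_point cF xY e_gt0 lu up tau0.
  by exists y => //; exists (psi, t).
have /choice[s sP] : forall y, exists pt, rbounded pt.1 /\ 0 < pt.2 /\
    ((exists pt, good y pt) -> good y pt).
  move=> y; have [[pt gy]|ny] := pselect (exists pt, good y pt).
    by exists pt; case: (gy).
  by exists (fun=> 0, 1); split; [exact: zero_rbounded|split; [exact: ltr01|move=> /ny]].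
exists l, (fun j => (s (nth x l j)).1), (fun j => (s (nth x l j)).2); split => //.
- by move=> j; have [b [t _]] := sP (nth x l j).
- move=> i ilt; rewrite -(rlinearB _ _ (cF i).1); apply: le_trans (ltW lx).
  by rewrite /p (bigD1 (Ordinal ilt))//= lerDl sumr_ge0.
- move=> i j c ilt jl hc; have [_ [_ /(_ _)[|_ _]]] := sP (nth x l j).
    by apply: lA; exact: mem_nth.
  by apply.
Qed.

(** ** Splitting all constraints by one vector *)

Lemma big_nil_constraints : big [::].
Proof.
move=> psi tau sl; have [f indf] := independent_exists sl.
by exists f; split => // t; rewrite in_nil.
Qed.

Lemma rlinear_avg_mkseq f (g : nat -> X) n : rlinear f ->
  f (avg (mkseq g n)) = n%:R^-1 * \sum_(j < n) f (g j).
Proof.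
move=> lf; rewrite /avg lf.2 size_mkseq rlinear_sum// big_map.
by rewrite -(big_mkord xpredT (fun j => f (g j))) /index_iota subn0.
Qed.

Lemma generic_big_cons f c i b (r : rat) : generic f -> satisfies f c ->
  (if b then ratr r < f (Y i) else f (Y i) < ratr r) -> big ((i, b, r) :: c).
Proof.
move=> gf fc h; apply: gf => t; rewrite inE => /predU1P[->//|]; exact: fc.
Qed.

(** Two generic functionals in each set are compared: one chosen before the
    slices near [x0], whose value at the new vector is close to that at [x0],
    and one chosen after, which is bounded below on the refined slices. *)
Lemma split_all (cs : seq constraints) : {in cs, forall c, big c} ->
  exists i (cs' : seq constraints), [/\ rnorm (Y i) <= 1, {in cs', forall c, big c} &
    {in cs, forall c, forall b : bool, exists2 c', c' \in cs' &
      forall f, satisfies f c' -> satisfies f c /\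
        if b then - 1 + (2 - alpha a) / 2 < f (Y i) else f (Y i) < - 1 + 4 * e0}].
Proof.
move=> bcs.
have sl0 : slices (fun _ _ => 0) (fun=> 1).
  by move=> n; split; [exact: zero_rbounded|exact: ltr01].
have /choice[F FP] : forall i, exists f, [/\ satisfies f (nth [::] cs i),
    contractive f, f x0 <= - 1 + e0 & generic f].
  move=> i; have bi : big (nth [::] cs i).
    have [ics|ics] := ltnP i (size cs); first exact: (bcs _ (mem_nth _ ics)).
    by rewrite nth_default//; exact: big_nil_constraints.
  by have [f [fc [cf fx _] gf]] := big_generic bi sl0; exists f.
have cF i : contractive (F i) by case: (FP i).
have [l [psi [tau [l0 sl Fx Fs]]]] := localize (size cs) cF cball_x0 e00.
have eta0 : 0 < (2 - alpha a) / 4 by rewrite divr_gt0// subr_gt0.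
have [psi' [tau' [sl' ref cs'P]]] := refine_slices_all bcs sl eta0.
have /choice[y yP] j : exists y, slice (psi' j) (tau' j) y.
  by have [b t] := sl' j; exact: slice_nonempty.
pose v := avg (mkseq y (size l)).
have s0 : 0 < (size l)%:R :> R by rewrite ltr0n lt0n size_eq0.
have vY : range Y v.
  by apply: Yavg => _ /mapP[j _ ->]; have [[]] := yP j.
have v1 : rnorm v <= 1.
  apply: rnorm_avg; first by rewrite -size_eq0 size_mkseq size_eq0.
  by move=> _ /mapP[j _ ->]; have [[]] := yP j.
have Fv i : (i < size cs)%N -> F i v <= - 1 + 3 * e0.
  move=> ics; have [_ _ Fx0 _] := FP i.
  have lE : avg l = avg (mkseq (nth x0 l) (size l)) by rewrite mkseq_nth.
  have : F i v <= F i (avg l) + e0.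
    rewrite lE !rlinear_avg_mkseq; try by case: (cF i).
    rewrite ler_pdivrMl// mulrDr mulrA divff ?gt_eqF// mul1r.
    rewrite [leRHS](_ : _ = \sum_(j < size l) (F i (nth x0 l j) + e0)).
      apply: ler_sum => j _; have := Fs i j (y j) ics (ltn_ord j) (ref j _ (yP j)).
      by rewrite ler_norml => /andP[_]; lra.
    by rewrite big_split /= sumr_const card_ord mulr_natl.
  have := Fx i ics; rewrite ler_norml => /andP[h _]; lra.
have [|q1] := @rat_in_itvoo R (- 1 + 3 * e0) (- 1 + 4 * e0).
  by have := e00; lra.
rewrite in_itv /= => /andP[q1l q1r].
have [|q2] := @rat_in_itvoo R (- 1 + (2 - alpha a) / 2) (- 1 + 3 * (2 - alpha a) / 4).
  by have := alpha2; lra.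
rewrite in_itv /= => /andP[q2l q2r].
have [i0 _ Yi0] := vY.
exists i0, ([seq (i0, false, q1) :: c | c <- cs] ++ [seq (i0, true, q2) :: c | c <- cs]).
split; first by rewrite Yi0.
- move=> c'; rewrite mem_cat => /orP[|] /mapP[c ccs ->].
    have ics : (index c cs < size cs)%N by rewrite index_mem.
    have [fc _ _ gf] := FP (index c cs); rewrite nth_index// in fc.
    apply: (generic_big_cons gf fc); rewrite Yi0.
    exact: le_lt_trans (Fv _ ics) q1l.
  have [f [fc gf cf fs]] := cs'P c ccs.
  apply: (generic_big_cons gf fc); rewrite Yi0; apply: (lt_le_trans q2r).
  apply: (rlinear_avg cf.1); first by rewrite -size_eq0 size_mkseq size_eq0.
  move=> _ /mapP[j _ ->]; apply: le_trans (fs j (y j) (yP j)).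
  lra.
- move=> c ccs b; exists ((i0, b, if b then q2 else q1) :: c).
    by rewrite mem_cat; case: b; rewrite map_f ?orbT.
  move=> f fc; split; first by move=> t tc; apply: fc; rewrite inE tc orbT.
  have := fc _ (mem_head _ _); case: b {fc} => /=; first exact: lt_trans.
  by move=> /lt_trans; apply.
Qed.

(** The lists of constraints form a binary tree whose branches of length [n] are
    the patterns [b] on the first [n] vectors. *)
Theorem independent_sequence : exists y : nat -> X, (forall j, rnorm (y j) <= 1) /\
  forall n (b : nat -> bool), exists f, contractive f /\
    forall j, (j < n)%N -> if b j then - 1 + (2 - alpha a) / 2 < f (y j)
                           else f (y j) < - 1 + 4 * e0.
Proof.
have /choice[s sP] : forall cs : seq constraints, exists p : nat * seq constraints,
    {in cs, forall c, big c} ->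
    [/\ rnorm (Y p.1) <= 1, {in p.2, forall c, big c} &
    {in cs, forall c, forall b : bool, exists2 c', c' \in p.2 &
      forall f, satisfies f c' -> satisfies f c /\
        if b then - 1 + (2 - alpha a) / 2 < f (Y p.1) else f (Y p.1) < - 1 + 4 * e0}].
  move=> cs; have [bcs|nb] := pselect {in cs, forall c, big c}.
    by have [i [cs' H]] := split_all bcs; exists (i, cs').
  by exists (0%N, [::]).
pose fix level n : seq constraints := if n is m.+1 then (s (level m)).2 else [:: [::]].
pose y n := Y (s (level n)).1.
have bl n : {in level n, forall c, big c}.
  elim: n => [|n IH]; last by have [] := sP (level n) IH.
  by move=> c; rewrite inE => /eqP ->; exact: big_nil_constraints.
exists y; split; first by move=> j; have [] := sP (level j) (bl j).
move=> n b.
have [c cl hc] : exists2 c, c \in level n & forall f, satisfies f c ->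
    forall j, (j < n)%N -> if b j then - 1 + (2 - alpha a) / 2 < f (y j)
                           else f (y j) < - 1 + 4 * e0.
  elim: n => [|n [c cl IH]]; first by exists [::]; rewrite ?inE.
  have [_ _ /(_ c cl (b n))[c' c'l h]] := sP (level n) (bl n).
  exists c' => // f /h[fc fb] j; rewrite ltnS leq_eqVlt => /predU1P[->//|].
  exact: IH.
have sl0 : slices (fun _ _ => 0) (fun=> 1).
  by move=> i; split; [exact: zero_rbounded|exact: ltr01].
have [f [fc [cf _ _]]] := bl n c cl _ _ sl0.
by exists f; split => //; exact: hc.
Qed.

End Independence.
(** * Copies of l1 *)

Section ScalarNets.
Context (R : realType) (k : scalar_kind).
Local Notation K := (scalars R k).
Local Notation abs c := (real_part `|c : K|).

Lemma real_net (e : R) : 0 < e -> exists r : seq R,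
  forall t, `|t| <= 1 -> exists2 s, s \in r & `|s - t| <= e.
Proof.
move=> e0; pose n := (Num.truncn (2 / e)).+1.
exists [seq - 1 + i%:R * e | i <- iota 0 n.+1] => t; rewrite ler_norml => /andP[t1 t2].
have te : 0 <= (t + 1) / e by rewrite divr_ge0 ?(ltW e0)//; lra.
pose i := Num.truncn ((t + 1) / e).
have /andP[i1 i2] : i%:R <= (t + 1) / e < i.+1%:R := truncn_itv te.
rewrite ler_pdivlMr// in i1; rewrite ltr_pdivrMr// -[i.+1%:R]natr1 mulrDl mul1r in i2.
exists (- 1 + i%:R * e).
  apply: (map_f (fun i => - 1 + i%:R * e)); rewrite mem_iota /= add0n ltnS /n.
  apply: leq_trans (leqnSn _); rewrite /i; apply: le_truncn.
  by rewrite ler_pM2r ?invr_gt0//; lra.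
by rewrite ler_norml; apply/andP; split; lra.
Qed.

Lemma abs_complex_le (s t : R) :
  real_part (k := ComplexScalars) `|((s +i* t)%C : scalars R ComplexScalars)| <= `|s| + `|t|.
Proof.
rewrite normc_def /= -[leRHS]ger0_norm ?addr_ge0// -sqrtr_sqr ler_wsqrtr//.
rewrite sqrrD !real_normK ?num_real// addrAC lerDl.
by rewrite mulrn_wge0// mulr_ge0.
Qed.

Lemma scalar_net (e : R) : 0 < e -> exists r : seq K,
  forall c, abs c <= 1 -> exists2 s, s \in r & abs (s - c) <= e.
Proof.
case: (k) => e0; first exact: real_net e0.
have e20 : 0 < e / 2 by rewrite divr_gt0.
have [r rP] := real_net e20.
exists [seq (s +i* t)%C | s <- r, t <- r] => -[s t] st1.
have [s1 t1] : `|s| <= 1 /\ `|t| <= 1.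
  move: st1; rewrite normc_def /= => st1.
  by split; apply: le_trans st1; rewrite -sqrtr_sqr ler_wsqrtr// ?lerDl ?lerDr sqr_ge0.
have [s' s'r hs] := rP s s1; have [t' t'r ht] := rP t t1.
exists (s' +i* t')%C; first by apply/allpairsP; exists (s', t').
by apply: (le_trans (abs_complex_le (s' - s) (t' - t))); lra.
Qed.

(** A net for the rotations of unimodular_rotation. *)
Lemma rotation_net (e : R) : 0 < e -> exists r : seq K, r != [::] /\
  forall c, exists2 s, s \in r & abs (s * c - of_real k (abs c)) <= e * abs c.
Proof.
move=> e0; have [r rP] := scalar_net e0.
have h c : exists2 s, s \in r & abs (s * c - of_real k (abs c)) <= e * abs c.
  have [s s1 sE] := unimodular_rotation c.
  have [|t tr ts] := rP s; first by rewrite s1.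
  exists t => //; rewrite -sE -mulrBl real_part_normM ler_wpM2r//.
  exact: real_part_norm_ge0.
exists r; split => //; have [s sr _] := h 0.
by apply: contraTneq sr => ->.
Qed.

Lemma exists_max_term (T : eqType) (r : seq T) (F : T -> R) : r != [::] ->
  exists2 s, s \in r & \sum_(t <- r) F t <= (size r)%:R * F s.
Proof.
case: r => // t r _; elim: r t => [|t' r IH] t.
  by exists t; rewrite ?mem_head// big_seq1 mul1r.
have [s sr hs] := IH t'; rewrite big_cons.
have sz z : (size [:: t, t' & r])%:R * z = z + (size (t' :: r))%:R * z :> R.
  by rewrite -[size [:: t, t' & r]]/((size (t' :: r)).+1) -natr1 mulrDl mul1r addrC.
have [ts|/ltW st] := leP (F t) (F s).
  by exists s; [rewrite in_cons sr orbT|rewrite sz lerD].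
by exists t; rewrite ?mem_head// sz lerD// (le_trans hs)// ler_wpM2l.
Qed.

End ScalarNets.

Section LowerEstimate.
Context (R : realType) (k : scalar_kind) (X : normedModType (scalars R k)).
Local Notation K := (scalars R k).
Local Notation abs c := (real_part `|c : K|).

Lemma contractive_extension (f : X -> R) : contractive f ->
  exists F : {linear X -> K^o}, (forall x, real_part (F x : K) = f x) /\
    forall x, abs (F x) <= rnorm x.
Proof.
move=> [lf fN]; have [F FE] := scalar_extension lf.
exists F; split => // x; rewrite -[leRHS]mul1r.
by apply: (scalar_extension_bound FE) => v; rewrite mul1r.
Qed.

Lemma abs_near_minus_one (c : K) e : abs c <= 1 -> real_part c <= - 1 + e ->
  0 <= e -> abs (c + 1) <= Num.sqrt (2 * e).
Proof.
case: (k) c => [c|[s t]].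
  rewrite /= ler_norml => /andP[c1 c2] ce e0.
  have c10 : 0 <= c + 1 by lra.
  rewrite ger0_norm// -[leLHS]ger0_norm// -sqrtr_sqr ler_wsqrtr//.
  by rewrite expr2; nra.
rewrite !normc_def /= addr0 => c1 ce e0; apply: ler_wsqrtr.
have : s ^+ 2 + t ^+ 2 <= 1.
  have st0 : 0 <= s ^+ 2 + t ^+ 2 by rewrite addr_ge0// sqr_ge0.
  by rewrite -(sqr_sqrtr st0) exprn_ile1// sqrtr_ge0.
by rewrite !expr2; lra.
Qed.

(** A combination whose coefficients are, up to a common factor [s], almost
    positive on [b] is detected there by the difference of the functional for
    the pattern [b] and that for the empty pattern; off [b] this difference is
    small because both functionals are almost [-1].  A net of factors reduces
    the general case to this one. *)
Lemma lower_l1_estimate (delta : R) : 0 < delta -> delta <= 1 ->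
  exists e1, 0 < e1 /\ forall y : nat -> X, (forall j, rnorm (y j) <= 1) ->
  (forall n (b : nat -> bool), exists f, contractive f /\
    forall j, (j < n)%N -> if b j then - 1 + delta < f (y j) else f (y j) < - 1 + e1) ->
  exists2 m, 0 < m & forall n (u : nat -> K),
    m * \sum_(j < n) abs (u j) <= rnorm (\sum_(j < n) u j *: y j).
Proof.
move=> d0 d1; have d80 : 0 < delta / 8 by rewrite divr_gt0.
have [r [r0 rP]] := rotation_net k d80.
have T0 : 0 < (size r)%:R :> R by rewrite ltr0n lt0n size_eq0.
pose B := \sum_(s <- r) abs s + 1.
have B1 : 1 <= B.
  by rewrite lerDr; apply: sumr_ge0 => s _; exact: real_part_norm_ge0.
have sB s : s \in r -> abs s <= B.
  move=> sr; rewrite /B (big_rem s)//= -addrA lerDl addr_ge0//.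
  by apply: sumr_ge0 => t _; exact: real_part_norm_ge0.
pose rho := delta / (8 * (size r)%:R * B).
have rho0 : 0 < rho by rewrite divr_gt0// !mulr_gt0//; lra.
pose e1 := Num.min (delta / 4) (rho ^+ 2 / 2).
have e10 : 0 < e1 by rewrite lt_min !divr_gt0// exprn_gt0.
have e1d : e1 <= delta / 4 by rewrite ge_min lexx.
have e1r : Num.sqrt (2 * e1) <= rho.
  have : 2 * e1 <= rho ^+ 2.
    have : e1 <= rho ^+ 2 / 2 by rewrite ge_min lexx orbT.
    lra.
  by move=> /ler_wsqrtr; rewrite sqrtr_sqr gtr0_norm.
exists e1; split => // y y1 yf.
have m0 : 0 < delta / (8 * (size r)%:R * B) by [].
exists (rho / 2); first by rewrite divr_gt0.
move=> n u.
have /choice[th thP] : forall j, exists s, s \in r /\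
    abs (s * u j - of_real k (abs (u j))) <= delta / 8 * abs (u j).
  by move=> j; have [s sr hs] := rP (u j); exists s.
have [s sr hs] := exists_max_term
  (fun s => \sum_(j < n) (if th j == s then abs (u j) else 0)) r0.
have {}hs : \sum_(j < n) abs (u j) <=
    (size r)%:R * \sum_(j < n) (if th j == s then abs (u j) else 0).
  apply: le_trans hs; rewrite exchange_big /=; apply: ler_sum => j _.
  rewrite (big_rem (th j)) ?eqxx//=; last by case: (thP j).
  rewrite lerDl; apply: sumr_ge0 => t _; case: ifP => // _.
  exact: real_part_norm_ge0.
have [f [cf ff]] := yf n (fun j => th j == s).
have [g [cg gg]] := yf n (fun=> false).
have [F [FE FN]] := contractive_extension cf.
have [H [HE HN]] := contractive_extension cg.
pose D j : K := (F (y j) : K) - (H (y j) : K).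
have D2 j : abs (D j) <= 2.
  have := ler_real_part_normD (F (y j) : K) (- (H (y j) : K)); rewrite normrN.
  have := FN (y j); have := HN (y j); have := y1 j; rewrite /D; lra.
(* [D] is close to [0] off the pattern, and on it has real part about at least
   [delta]; [s] makes the coefficients there almost positive. *)
have term (j : 'I_n) : (if th j == s then abs (u j) else 0) * (delta / 2) - 
    B * (abs (u j) * (2 * rho)) <= real_part (s * (u j * D j)).
  have uj0 := real_part_norm_ge0 (u j); have B0 : 0 < B by lra.
  case: ifP => [/eqP ts|nts].
    have -> : s * (u j * D j) = of_real k (abs (u j)) * D j +
        (s * u j - of_real k (abs (u j))) * D j by rewrite mulrBl addrC subrK mulrA.
    rewrite real_partD real_partZ.
    have h1 : delta - e1 <= real_part (D j).
      rewrite /D real_partB FE HE.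
      have := ff j (ltn_ord j); rewrite ts eqxx; have := gg j (ltn_ord j); lra.
    have := real_part_le_norm (- ((s * u j - of_real k (abs (u j))) * D j)).
    rewrite real_partN normrN real_part_normM => h2.
    have [_ h3] := thP j; rewrite ts in h3.
    have h4 : abs (s * u j - of_real k (abs (u j))) * abs (D j) <= delta / 8 * abs (u j) * 2.
      by apply: ler_pM => //; exact: real_part_norm_ge0.
    have h5 : abs (u j) * (delta - e1) <= abs (u j) * real_part (D j) by rewrite ler_wpM2l.
    have h6 : 0 <= B * (abs (u j) * (2 * rho)).
      by rewrite mulr_ge0 ?(ltW B0)// mulr_ge0// mulr_ge0// ltW.
    have h7 : abs (u j) * e1 <= abs (u j) * (delta / 4) by rewrite ler_wpM2l.
    lra.
  have h1 : abs (D j) <= 2 * rho.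
    have -> : D j = ((F (y j) : K) + 1) - ((H (y j) : K) + 1).
      by rewrite opprD addrACA subrr addr0.
    apply: (le_trans (ler_real_part_normD _ _)); rewrite normrN.
    have := ff j (ltn_ord j); rewrite nts => /ltW; rewrite -FE => Fj.
    have := gg j (ltn_ord j) => /ltW; rewrite -HE => Hj.
    have := abs_near_minus_one (le_trans (FN _) (y1 j)) Fj (ltW e10).
    have := abs_near_minus_one (le_trans (HN _) (y1 j)) Hj (ltW e10).
    lra.
  rewrite mul0r sub0r -lerN2 opprK.
  have := real_part_le_norm (- (s * (u j * D j))); rewrite real_partN normrN.
  move=> /le_trans; apply; rewrite !real_part_normM.
  apply: ler_pM; [exact: real_part_norm_ge0| |exact: sB|].
    by rewrite mulr_ge0// real_part_norm_ge0.
  by rewrite ler_wpM2l.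
set v := \sum_(j < n) u j *: y j.
have vE : s * ((F v : K) - (H v : K)) = \sum_(j < n) s * (u j * D j).
  have lin (L : {linear X -> K^o}) : (L v : K) = \sum_(j < n) u j * (L (y j) : K).
    by rewrite /v linear_sum; apply: eq_bigr => j _; rewrite linearZ.
  rewrite !lin -sumrB mulr_sumr; apply: eq_bigr => j _.
  by rewrite -mulrBr.
have up : real_part (s * ((F v : K) - (H v : K))) <= B * (2 * rnorm v).
  apply: (le_trans (real_part_le_norm _)); rewrite real_part_normM.
  apply: ler_pM; [exact: real_part_norm_ge0|exact: real_part_norm_ge0|exact: sB|].
  have := ler_real_part_normD (F v : K) (- (H v : K)); rewrite normrN.
  have := FN v; have := HN v; lra.
have low : \sum_(j < n) ((if th j == s then abs (u j) else 0) * (delta / 2) - 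
    B * (abs (u j) * (2 * rho))) <= real_part (s * ((F v : K) - (H v : K))).
  rewrite vE (big_morph (@real_part R k) (@real_partD R k) (@real_part0 R k)).
  by apply: ler_sum => j _; exact: term.
move: low; rewrite sumrB -mulr_suml -mulr_sumr -mulr_suml.
set A := \sum_(j < n) (if _ then _ else _) in hs *.
set U := \sum_(j < n) _ in hs *.
move=> low.
have B0 : 0 < B by lra.
have rhoE : delta = rho * (8 * (size r)%:R * B).
  by rewrite /rho divfK// !mulf_neq0// ?gt_eqF.
have h1 : U * (rho * 4 * B) <= A * (delta / 2).
  have -> : A * (delta / 2) = (size r)%:R * A * (rho * 4 * B) by rewrite {1}rhoE; field.
  rewrite ler_wpM2r// mulr_ge0 ?(ltW B0)//; lra.
have h2 : B * (2 * (rho / 2 * U) ) <= B * (2 * rnorm v).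
  apply: le_trans (le_trans low up); apply: le_trans (lerB h1 (lexx _)).
  have U0 : 0 <= U by apply: sumr_ge0 => j _; exact: real_part_norm_ge0.
  have : 0 <= B * rho * U by apply: mulr_ge0 => //; apply: mulr_ge0; exact: ltW.
  lra.
by move: h2; rewrite ler_pM2l// ler_pM2l.
Qed.

End LowerEstimate.
Section Ell1.
Context (R : realType) (k : scalar_kind) (X : completeNormedModType (scalars R k)).
Local Notation K := (scalars R k).
Local Notation abs c := (real_part `|c : K|).
Implicit Types (u v : nat -> K).

Lemma scalar_complete u :
  (forall e, 0 < e -> exists n, forall l, (n <= l)%N -> abs (u n - u l) < e) ->
  exists c : K, forall e, 0 < e -> exists n, forall l, (n <= l)%N -> abs (c - u l) < e.
Proof.
have rc (w : nat -> R) :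
    (forall e, 0 < e -> exists n, forall l, (n <= l)%N -> `|w n - w l| < e) ->
    exists c : R, forall e, 0 < e -> exists n, forall l, (n <= l)%N -> `|c - w l| < e.
  move=> wC; have wc : cvgn w.
    exact: (@rnorm_cauchy_cvg R RealScalars R^o w).
  by exists (limn w); exact/(@rnorm_cvgP R RealScalars R^o w).
move: u; case: (k) => u uC; first exact: rc.
have absE (c : scalars R ComplexScalars) :
    `|complex.Re c| <= real_part `|c| /\ `|complex.Im c| <= real_part `|c|.
  case: c => s t; rewrite normc_def /=.
  by split; rewrite -sqrtr_sqr ler_wsqrtr// ?lerDl ?lerDr sqr_ge0.
have [|s hs] := rc (fun n => complex.Re (u n : R[i])).
  move=> e /uC[n hn]; exists n => l /hn; apply: le_lt_trans.
  by have [h _] := absE (u n - u l); move: h; case: (u n); case: (u l).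
have [|t ht] := rc (fun n => complex.Im (u n : R[i])).
  move=> e /uC[n hn]; exists n => l /hn; apply: le_lt_trans.
  by have [_ h] := absE (u n - u l); move: h; case: (u n); case: (u l).
exists (s +i* t)%C => e e0; have e20 : 0 < e / 2 by rewrite divr_gt0.
have [n1 h1] := hs _ e20; have [n2 h2] := ht _ e20.
exists (maxn n1 n2) => l; rewrite geq_max => /andP[/h1 l1 /h2 l2].
case: (u l) l1 l2 => s' t' /= l1 l2.
by apply: (le_lt_trans (abs_complex_le (s - s') (t - t'))); lra.
Qed.

Definition abs_sum u n : R := \sum_(j < n) abs (u j).

Lemma abs_sum_series u : abs_sum u = series (fun n => rnorm (u n : K^o)).
Proof. by apply/funext => n; rewrite /series /= big_mkord. Qed.

Lemma ell1E u : ell1 R k u = cvgn (abs_sum u).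
Proof. by rewrite abs_sum_series. Qed.

Lemma ell1_normE u : ell1_norm u = limn (abs_sum u).
Proof. by rewrite abs_sum_series. Qed.

Lemma abs_sum_mono u : nondecreasing_seq (abs_sum u).
Proof.
apply/nondecreasing_seqP => n; rewrite /abs_sum big_ord_recr /= lerDl.
exact: real_part_norm_ge0.
Qed.

Lemma abs_sum_le u n : ell1 R k u -> abs_sum u n <= ell1_norm u.
Proof.
rewrite ell1E ell1_normE => cu.
by apply: nondecreasing_cvgn_le => //; exact: abs_sum_mono.
Qed.

Lemma abs_term_le u n : ell1 R k u -> abs (u n) <= ell1_norm u.
Proof.
move=> /(abs_sum_le n.+1); apply: le_trans; rewrite /abs_sum big_ord_recr /= lerDr.
by apply: sumr_ge0 => j _; exact: real_part_norm_ge0.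
Qed.

Lemma ell1_bounded u c : (forall n, abs_sum u n <= c) ->
  ell1 R k u /\ ell1_norm u <= c.
Proof.
move=> uc; have cu : cvgn (abs_sum u).
  apply: nondecreasing_is_cvgn; first exact: abs_sum_mono.
  by exists c => _ [n _ <-].
split; first by rewrite ell1E.
by rewrite ell1_normE; apply: limr_le => //; exact: nearW.
Qed.

Lemma abs_sumD u v n : abs_sum (fun j => u j + v j) n <= abs_sum u n + abs_sum v n.
Proof.
rewrite /abs_sum -big_split /=; apply: ler_sum => j _.
exact: ler_real_part_normD.
Qed.

Lemma abs_sumN u n : abs_sum (fun j => - u j) n = abs_sum u n.
Proof. by apply: eq_bigr => j _; rewrite normrN. Qed.

Lemma ell1B u v : ell1 R k u -> ell1 R k v -> ell1 R k (fun j => u j - v j).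
Proof.
move=> hu hv; apply: (proj1 (@ell1_bounded _ (ell1_norm u + ell1_norm v) _)) => n.
by apply: (le_trans (abs_sumD u (fun j => - v j) n)); rewrite abs_sumN lerD ?abs_sum_le.
Qed.

Lemma abs_sum_cauchy u e : ell1 R k u -> 0 < e ->
  exists n, forall l, (n <= l)%N -> abs_sum u l - abs_sum u n < e.
Proof.
move=> hu e0; have := hu; rewrite ell1E => /cvgrPdist_lt/(_ e e0)[n _ h].
exists n => l nl; have := h n (leqnn n); rewrite /= -ell1_normE.
have := abs_sum_le l hu; rewrite ltr_norml => h1 /andP[_ h2]; lra.
Qed.

Variables (y : nat -> X) (m : R).
Hypotheses (y1 : forall j, rnorm (y j) <= 1) (m0 : 0 < m).
Hypothesis ym : forall n u, m * abs_sum u n <= rnorm (\sum_(j < n) u j *: y j).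

(** The synthesis operator of the sequence [y], defined on all sequences but
    meaningful on [l1]. *)
Definition synthesis u : X := limn (fun n => \sum_(j < n) u j *: y j).

Lemma synthesis_cvg u : ell1 R k u ->
  (fun n => \sum_(j < n) u j *: y j) @ \oo --> synthesis u.
Proof.
move=> hu; apply: rnorm_cauchy_cvg => e e0.
have [n hn] := abs_sum_cauchy hu e0; exists n => l nl.
apply: le_lt_trans (hn l nl); rewrite rnorm_distC.
elim: l nl {hn} => [|l IH]; first by rewrite leqn0 => /eqP ->; rewrite !subrr rnorm0.
rewrite leq_eqVlt => /predU1P[<-|]; first by rewrite !subrr rnorm0.
rewrite ltnS => /IH h; rewrite /abs_sum !big_ord_recr /= addrAC [leRHS]addrAC.
apply: (le_trans (rnormD _ _)); rewrite lerD//.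
by rewrite rnormMc ler_piMr// real_part_norm_ge0.
Qed.

Lemma synthesis_linear (c : K) u v : ell1 R k u -> ell1 R k v ->
  synthesis (fun n => c * u n + v n) = c *: synthesis u + synthesis v.
Proof.
move=> hu hv; apply: cvg_lim => //.
under eq_fun => n.
  have -> : \sum_(j < n) (c * u j + v j) *: y j =
      c *: (\sum_(j < n) u j *: y j) + \sum_(j < n) v j *: y j.
    rewrite scaler_sumr -big_split /=; apply: eq_bigr => j _.
    by rewrite scalerDl scalerA.
  over.
apply: cvgD; last exact: synthesis_cvg.
by apply: cvgZr; exact: synthesis_cvg.
Qed.

Lemma synthesis_bounds u : ell1 R k u ->
  m * ell1_norm u <= rnorm (synthesis u) <= 1 * ell1_norm u.
Proof.
move=> hu; apply/andP; split; last first.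
  rewrite mul1r; apply: (lim_rnorm_le (synthesis_cvg hu)); exists 0%N => n _.
  apply: le_trans (abs_sum_le n hu); apply: (le_trans (rnorm_sum _ _ _)).
  by apply: ler_sum => j _; rewrite rnormMc ler_piMr// real_part_norm_ge0.
rewrite mulrC -ler_pdivlMr// ell1_normE; apply: limr_le; first by rewrite -ell1E.
apply: nearW => n; rewrite ler_pdivlMr// mulrC.
apply: (rnorm_cvg_ge (synthesis_cvg hu)); exists n => l nl.
apply: le_trans (ym l u); rewrite ler_pM2l//; exact: abs_sum_mono.
Qed.

Lemma synthesisB u v : ell1 R k u -> ell1 R k v ->
  synthesis (fun n => u n - v n) = synthesis u - synthesis v.
Proof.
move=> hu hv.
have := synthesis_linear (- 1) hv hu; rewrite scaleN1r addrC => <-.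
by congr synthesis; apply/funext => n; rewrite mulN1r addrC.
Qed.

(** Almost preimages of a point of the closure form a Cauchy sequence in [l1] by
    the lower bound; its coordinatewise limit [u] is a preimage. *)
Lemma closed_synthesis : closed (synthesis @` ell1 R k).
Proof.
move=> x xcl.
pose recip (p : nat) : R := p.+1%:R^-1.
have p0 p : 0 < recip p by rewrite invr_gt0.
have recip_le p n : (n <= p)%N -> recip p <= recip n.
  by move=> np; rewrite lef_pV2 ?posrE// ler_nat.
have /choice[w wP] : forall p : nat, exists u, ell1 R k u /\
    rnorm (x - synthesis u) < recip p.
  by move=> p; have [_ [u hu <-] hx] := closure_rnorm xcl (p0 p); exists u.
have w1 p : ell1 R k (w p) by case: (wP p).
pose e p q : R := m^-1 * (recip p + recip q).
have wd p q : ell1_norm (fun j => w p j - w q j) <= e p q.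
  have /andP[h _] := synthesis_bounds (ell1B (w1 p) (w1 q)).
  rewrite /e ler_pdivlMl//; apply: (le_trans h); rewrite synthesisB//.
  have := rnorm_triangle x (synthesis (w p)) (synthesis (w q)).
  have [_ hp] := wP p; have [_ hq] := wP q.
  rewrite (rnorm_distC _ x); lra.
have small d : 0 < d -> exists n, forall p, (n <= p)%N -> recip p < d.
  move=> d0; exists (Num.truncn d^-1) => p np.
  rewrite -[d]invrK ltf_pV2 ?posrE ?invr_gt0//.
  have /andP[_ h] : (Num.truncn d^-1)%:R <= d^-1 < (Num.truncn d^-1).+1%:R.
    by apply: truncn_itv; rewrite invr_ge0 ltW.
  by apply: (lt_le_trans h); rewrite ler_nat.
have emono p q n : (n <= p)%N -> (n <= q)%N -> e p q <= m^-1 * (2 * recip n).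
  move=> np nq; rewrite /e ler_pM2l ?invr_gt0//.
  have := recip_le _ _ np; have := recip_le _ _ nq; lra.
have small2 d : 0 < d -> exists n, m^-1 * (2 * recip n) < d.
  move=> d0; have [|n hn] := small (m * d / 2); first by rewrite divr_gt0// mulr_gt0.
  exists n; rewrite ltr_pdivrMl//; have := hn n (leqnn n); lra.
have /choice[u uP] : forall j, exists c : K, forall d, 0 < d ->
    exists n, forall l, (n <= l)%N -> abs (c - w l j) < d.
  move=> j; apply: scalar_complete => d /small2[n hn]; exists n => l nl.
  apply: le_lt_trans hn; apply: le_trans (emono n l n (leqnn n) nl).
  exact: le_trans (abs_term_le j (ell1B (w1 n) (w1 l))) (wd n l).
have ud p n : abs_sum (fun j => w p j - u j) n <= m^-1 * (2 * recip p).
  apply/ler_addgt0Pr => d d0.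
  have dn : 0 < d / n.+1%:R by rewrite divr_gt0.
  have [q [pq hq]] : exists q, (p <= q)%N /\
      forall j, (j < n)%N -> abs (u j - w q j) <= d / n.+1%:R.
    have : exists q, (p <= q)%N /\ forall q', (q <= q')%N ->
        forall j, (j < n)%N -> abs (u j - w q' j) <= d / n.+1%:R.
      elim: {1}n => [|n' [q [pq hq]]]; first by exists p.
      have [q2 hq2] := uP n' _ dn; exists (maxn q q2); split.
        exact: leq_trans pq (leq_maxl _ _).
      move=> q'; rewrite geq_max => /andP[qq' q2q'] j.
      rewrite ltnS leq_eqVlt => /predU1P[->|jn']; first exact/ltW/hq2.
      exact: hq qq' j jn'.
    by move=> [q [pq hq]]; exists q; split => // j jn; apply: hq.
  apply: (@le_trans _ _ (abs_sum (fun j => w p j - w q j) n +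
      abs_sum (fun j => w q j - u j) n)).
    rewrite /abs_sum -big_split /=; apply: ler_sum => j _.
    have -> : w p j - u j = (w p j - w q j) + (w q j - u j) by rewrite subrKA.
    exact: ler_real_part_normD.
  apply: lerD.
    apply: (le_trans (abs_sum_le n (ell1B (w1 p) (w1 q)))).
    by apply: (le_trans (wd p q)); exact: emono.
  apply: (@le_trans _ _ (\sum_(j < n) d / n.+1%:R)).
    by apply: ler_sum => j _; rewrite distrC; exact: hq.
  rewrite sumr_const card_ord -[_ *+ n]mulr_natr -mulrA ler_piMr ?(ltW d0)//.
  by rewrite mulrC ler_pdivrMr// mul1r ler_nat.
have diff p : ell1 R k (fun j => w p j - u j) /\
    ell1_norm (fun j => w p j - u j) <= m^-1 * (2 * recip p).
  exact: ell1_bounded (ud p).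
have hu : ell1 R k u.
  have := ell1B (w1 0%N) (diff 0%N).1.
  by congr (ell1 R k _); apply/funext => j; rewrite subKr.
exists u => //; apply/eqP; rewrite -subr_eq0 -rnorm_eq0 eq_le rnorm_ge0 andbT.
apply/ler_addgt0Pr => d d0; rewrite add0r.
have d20 : 0 < d / 2 by rewrite divr_gt0.
have [n1 h1] := small2 _ d20; have [n2 h2] := small _ d20.
pose p := maxn n1 n2.
have [_ hp] := wP p; have h2p := h2 p (leq_maxr _ _).
have /andP[_ hb] := synthesis_bounds (diff p).1.
rewrite mul1r synthesisB// in hb.
have := emono p p n1 (leq_maxl _ _) (leq_maxl _ _).
have := (diff p).2; have eE : e p p = m^-1 * (2 * recip p) by rewrite /e mulr_natl mulr2n.
rewrite eE.
have := rnorm_triangle (synthesis (w p)) (synthesis u) x.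
rewrite (rnorm_distC (synthesis u) (synthesis (w p))) (rnorm_distC (synthesis (w p)) x).
move: hb hp h2p h1; rewrite -/p; lra.
Qed.

Lemma lower_estimate_contains_ell1 : contains_ell1 X.
Proof.
exists synthesis; split; [exact: synthesis_linear| |exact: closed_synthesis].
by exists m, 1; split => // u; exact: synthesis_bounds.
Qed.

End Ell1.

Theorem Daugavet_contains_ell1 (R : realType) (k : scalar_kind)
    (X : completeNormedModType (scalars R k)) (G : groupType)
    (a : isometric_action G X) :
  (exists x : X, x != 0) -> G_Daugavet a -> alpha a < 2 -> contains_ell1 X.
Proof.
move=> hX hD ha; have a0 := alpha_ge0 a hX.
have [x0 x01] := exists_unit_vector hX.
have [Y [Yx0 YD YN Yavg Yst]] := countable_core hD hX x0.
have d0 : 0 < (2 - alpha a) / 2 by rewrite divr_gt0// subr_gt0.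
have d1 : (2 - alpha a) / 2 <= 1 by lra.
have [e1 [e10 low]] := @lower_l1_estimate R k X _ d0 d1.
have e40 : 0 < e1 / 4 by rewrite divr_gt0.
have [y [y1 yf]] := independent_sequence x01 Yx0 YD YN Yavg Yst a0 ha e40.
have eE : 4 * (e1 / 4) = e1 by lra.
rewrite eE in yf; have [m m0 ym] := low y y1 yf.
exact: (lower_estimate_contains_ell1 y1 m0 ym).
Qed.

Theorem theorem5p7 (R : realType) (k : scalar_kind)
    (X : completeNormedModType (scalars R k)) (G : groupType)
    (a : isometric_action G X)
    (hX : exists x : X, x != 0)
    (hD : G_Daugavet a)
    (halpha : alpha a < 2) :
  [/\ forall tau : topology_on G,
        is_group_topology tau -> continuous_action a tau -> contains_ell1 X,
      ~ Radon_Nikodym_property X &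
      ~ SCD (unit_ball X)].
Proof.
split.
- by move=> tau _ _; exact: Daugavet_contains_ell1 hX hD halpha.
- exact: Daugavet_not_Radon_Nikodym hX hD halpha.
- exact: unit_ball_not_SCD hX hD halpha.
Qed.
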